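(* Let $n\ge d\ge2$. Let $Q$ and $Q'$ be neighborly $(d-2)$-polytopes, each with $n-1$ ordered vertices in general position. If $Q$ and $Q'$ are not combinatorially isomorphic, then the neighborly cubical polytopes $\mathrm{NCP}_{n,d}(Q)$ and $\mathrm{NCP}_{n,d}(Q')$ are not combinatorially isomorphic. Moreover, there are at least as many different combinatorial types of $d$-dimensional neighborly cubical polytopes (with the $(\lfloor\frac d2\rfloor-1)$-skeleton of the $n$-cube) as there are combinatorial types of neighborly simplicial $(d-2)$-polytopes on $n-1$ vertices.
   Context: A $(d-2)$-polytope $Q$ is neighborly if every set of at most $\lfloor\frac{d-2}{2}\rfloor$ of its vertices is the vertex set of a face. Its vertices are in general position if no $d-1$ of them lie on a common affine hyperplane of $\mathbb{R}^{d-2}$. Two polytopes are combinatorially isomorphic (have the same combinatorial type) if their face lattices are isomorphic. A neighborly cubical $d$-polytope (for the parameters $n,d$) is a $d$-polytope all of whose proper faces are combinatorial cubes and whose $(\lfloor\frac d2\rfloor-1)$-skeleton is isomorphic to that of the $n$-cube. Gale transform. If the rows of $V\in\mathbb{R}^{(n-1)\times(d-2)}$ are the ordered vertices of $Q$, a Gale transform of $Q$ is a matrix $G\in\mathbb{R}^{(n-1)\times(n-d)}$ whose columns form a basis of the orthogonal complement of the column span of $(V,\mathbf 1)$. By general position one can choose $G=\binom{I_{n-d}}{\overline G}$ with $\overline G$ having rows $g_1,\dots,g_{d-1}\in\mathbb{R}^{n-d}$; $\overline G$ is then unique. Construction of $\mathrm{NCP}_{n,d}(Q)$. The deformed cube $C_n(Q)=\{x\in\mathbb{R}^n:Ax\le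 b\}$ has $2n$ inequalities labeled $\pm1,\dots,\pm n$; with $e_1,\dots,e_n$ the standard unit row vectors, the normal vectors with labels $\pm i$ are: for $i=1$: $\pm\varepsilon e_1$; for $2\le i\le n-d+1$: $e_{i-1}\pm\varepsilon e_i$; for $i=n-d+1+j$ with $1\le j\le d-1$: $(g_j,0)\pm\varepsilon e_i$, where $(g_j,0)$ has $g_j$ in the first $n-d$ coordinates and zeros elsewhere (for $n=d$ the normals are simply $\pm\varepsilon e_i$). Here $\varepsilon>0$ is sufficiently small (depending on $Q$ and the vertex order) and $b$ is such that all $2n$ inequalities are facet-defining and the sets of inequalities tight at the vertices are exactly the sets $\{\sigma_11,\dots,\sigma_nn\}$, $\sigma\in\{+,-\}^n$ (so $C_n(Q)$ is a combinatorial $n$-cube; such $b$ exist). Then $\mathrm{NCP}_{n,d}(Q)=\pi_d(C_n(Q))$, where $\pi_d:\mathbb{R}^n\to\mathbb{R}^d$ is the projection to the last $d$ coordinates; it is a neighborly cubical $d$-polytope. *)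

(* Defs.v *)
From mathcomp Require Import all_boot all_order all_algebra.
From mathcomp Require Import boolp classical_sets functions cardinality reals.

Set Implicit Arguments.
Unset Strict Implicit.
Unset Printing Implicit Defensive.

Import Order.TTheory GRing.Theory Num.Theory.
Local Open Scope classical_set_scope.
Local Open Scope ring_scope.

(* Points of R^m are row vectors, and a k x m matrix is a list of k points. *)

Section Polytopes.
Variable R : realType.

Definition affinely_independent k m (V : 'M[R]_(k, m)) : bool :=
  row_free (row_mx V (const_mx 1 : 'cV[R]_k)).

(* Affine dimension: one less than the largest number of affinely independent
   points of S; in R^m there are at most m + 1 of them. The empty set has
   dimension -1. *)
Definition affdim m (S : set 'rV[R]_m) : int :=
  (\max_(k < m.+2 | `[< exists V : 'M[R]_(k, m),
      affinely_independent V /\ forall i, S (row i V) >]) k)%N%:Z - 1.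

Definition convhull k m (V : 'M[R]_(k, m)) : set 'rV[R]_m :=
  [set x | exists w : 'rV[R]_k,
     [/\ forall i, 0 <= w 0 i, \sum_i w 0 i = 1 & x = w *m V]].

Definition polytope m (P : set 'rV[R]_m) : Prop :=
  exists k (V : 'M[R]_(k, m)), P = convhull V.

(* The functional c may be zero, so P itself (t = 0) and the empty set (t = 1)
   are faces of P. *)
Definition face m (P F : set 'rV[R]_m) : Prop :=
  exists (c : 'cV[R]_m) (t : R),
    (forall x, P x -> (x *m c) 0 0 <= t) /\
    F = [set x | P x /\ (x *m c) 0 0 = t].

Definition vertices m (P : set 'rV[R]_m) : set 'rV[R]_m :=
  [set v | face P [set v]].

Definition facet m (P F : set 'rV[R]_m) : Prop :=
  face P F /\ affdim F = affdim P - 1.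

Definition proper_face m (P F : set 'rV[R]_m) : Prop :=
  [/\ face P F, F !=set0 & F <> P].

Definition inclusion_iso (T U : Type) (A : set (set T)) (B : set (set U)) :
    Prop :=
  exists f : set T -> set U, set_bij A B f /\
    forall F F', A F -> A F' -> (F `<=` F' <-> f F `<=` f F').

(* An order isomorphism between lattices is a lattice isomorphism. *)
Definition comb_iso m m' (P : set 'rV[R]_m) (P' : set 'rV[R]_m') : Prop :=
  inclusion_iso (face P) (face P').

Definition comb_type m (P : set 'rV[R]_m) : set (set 'rV[R]_m) :=
  [set P' | polytope P' /\ comb_iso P P'].

Definition skeleton (k : int) m (P : set 'rV[R]_m) : set (set 'rV[R]_m) :=
  [set F | face P F /\ affdim F <= k].

Definition cube k : set 'rV[R]_k := [set x | forall i, 0 <= x 0 i <= 1].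

Definition comb_cube m (P : set 'rV[R]_m) : Prop :=
  exists k, comb_iso P (@cube k).

Definition simplex m (P : set 'rV[R]_m) : Prop :=
  exists k (V : 'M[R]_(k, m)), affinely_independent V /\ P = convhull V.

Definition simplicial m (P : set 'rV[R]_m) : Prop :=
  forall F, proper_face P F -> simplex F.

Definition full_polytope m (P : set 'rV[R]_m) : Prop :=
  polytope P /\ affdim P = m%:Z.

Definition neighborly m (P : set 'rV[R]_m) : Prop :=
  full_polytope P /\
  forall S, S `<=` vertices P -> (S #<= `I_(m./2)%N)%card ->
    exists2 F, face P F & vertices F = S.

Definition neighborly_cubical (n d : nat) (P : set 'rV[R]_d) : Prop :=
  [/\ full_polytope P,
      forall F, proper_face P F -> comb_cube F
    & inclusion_iso (skeleton ((d./2)%N%:Z - 1) P)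
                    (skeleton ((d./2)%N%:Z - 1) (@cube n))].

Definition ordered_vertices k m (V : 'M[R]_(k, m)) : Prop :=
  injective (fun i => row i V) /\
  vertices (convhull V) = range (fun i => row i V).

Definition general_position k m (V : 'M[R]_(k, m)) : Prop :=
  forall I : {set 'I_k}, #|I| = m.+1 ->
    ~ exists (c : 'cV[R]_m) (t : R),
        c != 0 /\ forall i, i \in I -> (V *m c) i 0 = t.

(* kermx computes the left kernel, that is, the vectors orthogonal to all
   columns of (V, 1). *)
Definition gale_transform k m r (V : 'M[R]_(k, m)) (G : 'M[R]_(k, r)) : Prop :=
  row_free G^T /\ (G^T :=: kermx (row_mx V (const_mx 1 : 'cV[R]_k)))%MS.

(* G is of the form (I over Gbar); such a Gale transform is unique. *)
Definition normalized k r (G : 'M[R]_(k, r)) : Prop :=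
  forall (i : 'I_k) (j : 'I_r), (i < r)%N -> G i j = ((i : nat) == j)%:R.

End Polytopes.

Section DeformedCube.
Variables (R : realType) (n d : nat).

(* Row i (counted from 0) is the normal vector with label i + 1, taken with
   sign + for s = false and - for s = true. The first summand has row 0 equal
   to 0 and, for i > 0, row i equal to (row (i - 1) of G, 0, ..., 0). For
   G = (I over Gbar) the latter is e_i (counted from 1) when i <= n - d, and
   (g_j, 0) when i = n - d + j. *)
Definition cube_normals (G : 'M[R]_(n.-1, (n - d)%N)) (eps : R) (s : bool) :
    'M[R]_n :=
  (\matrix_(i < n, j < n.-1) ((i : nat) == j.+1)%:R)
    *m G *m (pid_mx (n - d)%N : 'M[R]_((n - d)%N, n))
  + ((-1) ^+ s * eps)%:M.

Section System.
Variables (A : bool -> 'M[R]_n) (b : bool -> 'I_n -> R).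

Definition solutions : set 'rV[R]_n :=
  [set x | forall s i, (x *m (A s)^T) 0 i <= b s i].

Definition tight (x : 'rV[R]_n) : set (bool * 'I_n) :=
  [set l | (x *m (A l.1)^T) 0 l.2 = b l.1 l.2].

Definition cube_system : Prop :=
  (forall l, facet solutions [set x | solutions x /\ tight x l]) /\
  [set tight v | v in vertices solutions] =
    range (fun sigma : 'I_n -> bool => [set l | l.1 = sigma l.2]).

End System.

Definition proj_last (x : 'rV[R]_n) : 'rV[R]_d :=
  x *m \matrix_(i < n, j < d) ((i : nat) == (n - d + j)%N)%:R.

(* P is NCP_{n,d}(Q) for Q with ordered vertices V, built with the given eps
   and some admissible right-hand side b. *)
Definition NCP (V : 'M[R]_(n.-1, (d - 2)%N)) (eps : R) (P : set 'rV[R]_d) :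
    Prop :=
  exists (G : 'M[R]_(n.-1, (n - d)%N)) (b : bool -> 'I_n -> R),
    [/\ gale_transform V G, normalized G, cube_system (cube_normals G eps) b
      & P = proj_last @` solutions (cube_normals G eps) b].

End DeformedCube.

(* Main.v *)
(* The Gale transform G of Q turns faces of Q into cofaces: T is the complement
   of the vertex set of a face iff some positive combination of the rows of G
   with indices in T vanishes. Dually, a face of the cube C_n(Q) is a sign
     vector
   t in {+,-,0}^n, its normal cone is spanned by the normals in the support of
     t,
   and it survives the projection iff the normals truncated to the first n - d
   coordinates have a vanishing positive combination. The face lattice of NCP is
   thus the set of surviving sign vectors. When label 1 is not in the support
     the
   truncated normals are a small perturbation of rows of G, so survival does not
   depend on the signs and is exactly the coface condition for Q. All vertices
   and edges of the n-cube survive; hence an isomorphism of two NCPs induces an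
   automorphism of the graph of the n-cube, that is, a signed permutation. Label
   1 is the only label k such that survival of the sign vectors vanishing at k
   does not depend on signs: the truncated normal of label 1 is a multiple of
   the first unit vector whose sign can be reversed, and reversing it destroys a
   minimal coface containing it. So label 1 is preserved and Q is recovered.

   For the count, the Gale transform of an arbitrary neighborly simplicial Q is
   perturbed into a generic one with the same cofaces; no realization of the
   perturbed configuration as a polytope is needed. *)
Require Import Defs.
From mathcomp Require Import all_boot all_order all_algebra.
From mathcomp Require Import fingroup perm.
From mathcomp Require Import boolp classical_sets functions cardinality reals.
From mathcomp Require Import ring lra zify.

Set Implicit Arguments.
Unset Strict Implicit.
Unset Printing Implicit Defensive.

Import Order.TTheory GRing.Theory Num.Theory.
Local Open Scope classical_set_scope.
Local Open Scope ring_scope.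

(** * Vector configurations and their cofaces *)

(** Comparisons become robust because the coface condition splits into two open ones. In a
    simplicial configuration a nonempty index set is either positively spanning, and then a coface,
    or contained in an open half-space, and then not a coface. Index sets and sign patterns being
    finite in number, one bound on [eps] serves for all. Positive spanning also passes to larger
    sets; this gives the survival of vertices and edges and, once the truncated normals are generic
    for all signs, makes every proper face a cube.

    Of the deformed cube only [cubical_system] enters the face lattice: invertible normals and
    prescribed tight sets at each vertex. The triangular shape of the normals yields the
    invertibility and also an explicit right-hand side.

    The Gale transform of a simplicial [Q] may have dependent first rows and hence no normalized
    form. Passing to a generic configuration repairs this but loosens its tie to [Q]; therefore
    [realizes] links [Q] to the cube through cofaces alone, and both claims follow from
    [realizes_iso]. *)

Lemma farkas (R : realFieldType) p r (M : 'M[R]_(p, r)) (c : 'rV[R]_r) :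
  (exists l : 'rV[R]_p, (forall i, 0 <= l 0 i) /\ l *m M = c) \/
  (exists y : 'cV[R]_r, (forall i, 0 <= (M *m y) i 0) /\ (c *m y) 0 0 < 0).
Proof.
elim: p M c => [|p IH] M c.
  have [->|c0] := eqVneq c 0.
    by left; exists 0; rewrite mul0mx; split=> // i; rewrite mxE.
  right; exists (- c^T); split=> [[]//|].
  rewrite mulmxN mxE oppr_lt0 mxE.
  have [j cj] : exists j, c 0 j != 0.
    apply/existsP; apply: contraNT c0; rewrite negb_exists => /forallP c0.
    by apply/eqP/rowP => j; rewrite mxE; apply/eqP; move: (c0 j); rewrite negbK.
  rewrite (bigD1 j) //= ltr_wpDr //.
    by apply: sumr_ge0 => k _; rewrite mxE -expr2 sqr_ge0.
  by rewrite mxE -expr2 exprn_even_gt0.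
pose a := row ord0 M; pose M1 : 'M[R]_(p, r) := row' ord0 M.
have rowM (y : 'cV[R]_r) i : (M *m y) (lift ord0 i) 0 = (M1 *m y) i 0.
  by rewrite !mxE; apply: eq_bigr => j _; rewrite !mxE.
have row0 (y : 'cV[R]_r) : (M *m y) ord0 0 = (a *m y) 0 0.
  by rewrite !mxE; apply: eq_bigr => j _; rewrite !mxE.
have mulM (s : R) (l : 'rV[R]_p) :
    (\row_i (if unlift ord0 i is Some j then l 0 j else s)) *m M
      = s *: a + l *m M1.
  apply/rowP => j; rewrite !mxE big_ord_recl !mxE unlift_none; congr (_ + _).
  by apply: eq_bigr => i _; rewrite !mxE liftK.
have nneg (s : R) (l : 'rV[R]_p) : 0 <= s -> (forall i, 0 <= l 0 i) ->
    forall i, 0 <= (\row_i (if unlift ord0 i is Some j then l 0 j else s)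
      : 'rV[R]_p.+1) 0 i.
  by move=> s0 l0 i; rewrite mxE; case: unliftP.
have allM (y : 'cV[R]_r) : (forall i, 0 <= (M1 *m y) i 0) ->
  0 <= (a *m y) 0 0 ->
    forall i, 0 <= (M *m y) i 0.
  move=> My ay i; case: (unliftP ord0 i) => [j|] ->.
    by rewrite rowM.
  by rewrite row0.
(* A certificate for the remaining rows [M1] serves for [M] too, except when it is a functional [y0]
   that is negative on the removed row [a]. *)
have [[l [l0 <-]]|[y0 [My0 cy0]]] := IH M1 c.
  left; exists (\row_i (if unlift ord0 i is Some j then l 0 j else 0)).
  by rewrite mulM scale0r add0r; split=> //; apply: nneg.
have [ay0|ay0] := leP 0 ((a *m y0) 0 0).
  by right; exists y0; split=> //; apply: allM.
set q := (a *m y0) 0 0 in ay0; have q0 : q != 0 by rewrite lt_eqF.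
(* Project everything along [a] onto the hyperplane orthogonal to [y0]. *)
pose M2 := M1 - (q^-1 *: (M1 *m y0)) *m a.
pose u := (c *m y0) 0 0 / q; pose c2 := c - u *: a.
have u0 : 0 <= u by rewrite ltW // /u nmulr_rgt0 // invr_lt0.
have proj (y : 'cV[R]_r) : (a *m y) 0 0 = 0 ->
   M2 *m y = M1 *m y /\ (c2 *m y) 0 0 = (c *m y) 0 0.
  move=> ay; have {}ay : a *m y = 0.
    by apply/matrixP => i j; rewrite !ord1 ay mxE.
  by rewrite /M2 /c2 !mulmxBl -mulmxA -!scalemxAl ay mulmx0 !scaler0 !subr0.
have y0_ker : M2 *m y0 = 0 /\ c2 *m y0 = 0.
  have ea : a *m y0 = q%:M by rewrite [LHS]mx11_scalar.
  have ec : c *m y0 = ((c *m y0) 0 0)%:M by rewrite [LHS]mx11_scalar.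
  split.
    rewrite /M2 mulmxBl -mulmxA ea mul_mx_scalar scalerA mulfV //.
    by rewrite scale1r subrr.
  by rewrite /c2 mulmxBl -scalemxAl ea scale_scalar_mx /u divfK // -ec subrr.
have [[l [l0 lM]]|[y [My cy]]] := IH M2 c2.
  (* The coefficient [s] of [a] undoes the projection. It is nonnegative because [u], [l] and
     [M1 *m y0] are, while [q] is negative. *)
  left; pose s := u - (l *m (q^-1 *: (M1 *m y0))) 0 0.
  exists (\row_i (if unlift ord0 i is Some j then l 0 j else s)); split.
    apply: nneg => //; rewrite addr_ge0 // oppr_ge0 mxE.
    apply: sumr_le0 => i _; rewrite mulr_ge0_le0 // mxE.
    by rewrite nmulr_rle0 // invr_lt0.
  rewrite mulM; apply/eqP; rewrite -subr_eq0.
  have -> : s *: a + l *m M1 - c = l *m M2 - c2.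
    rewrite /M2 /c2 mulmxBr mulmxA.
    rewrite [X in _ = _ - X *m a - _]mx11_scalar mul_scalar_mx.
    rewrite /s scalerBl opprB addrA; congr (_ - c).
    by rewrite addrC -!addrA [- _ + _]addrC.
  by rewrite lM subrr.
right; exists (y - ((a *m y) 0 0 / q) *: y0).
set y' := y - _.
have ay' : (a *m y') 0 0 = 0.
  rewrite /y' mulmxBr -scalemxAr [LHS]mxE [X in _ + X]mxE [X in _ - X]mxE -/q.
  by rewrite divfK // subrr.
have [M2y c2y] := proj y' ay'.
split; first apply: allM; rewrite -?M2y -?c2y ?ay' //.
  by move=> i; rewrite /y' mulmxBr -scalemxAr y0_ker.1 scaler0 subr0.
by rewrite /y' mulmxBr -scalemxAr y0_ker.2 scaler0 subr0.
Qed.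

Section Configurations.
Variables (R : realFieldType) (p r : nat).
Implicit Types (M : 'M[R]_(p, r)) (T : {set 'I_p}).

Definition coface M T := exists l : 'rV[R]_p,
  [/\ l *m M = 0, forall i, i \in T -> 0 < l 0 i
    & forall i, i \notin T -> l 0 i = 0].

(** Dual form of the statement that the rows in [T] generate the whole space as a convex cone. *)
Definition pspanning M T := forall y : 'cV[R]_r,
  (forall i, i \in T -> 0 <= (M *m y) i 0) -> y = 0.

Definition spanning M T := forall y : 'cV[R]_r,
  (forall i, i \in T -> (M *m y) i 0 = 0) -> y = 0.

Definition separable M T := exists y : 'cV[R]_r,
  forall i, i \in T -> 0 < (M *m y) i 0.

(** Gale dual of simpliciality: the rows of a Gale transform in [T] span exactly when the vertices
    outside [T] are affinely independent. *)
Definition simplicial_config M := forall T, T != finset.set0 ->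
  coface M T -> spanning M T.

Definition generic M := forall T, (r <= #|T|)%N -> spanning M T.

Lemma pspanningS M T T' : T \subset T' -> pspanning M T -> pspanning M T'.
Proof. by move=> /fintype.subsetP sTT' pT y My; apply: pT => i /sTT' /My. Qed.

Lemma pspanning_spanning M T : pspanning M T -> spanning M T.
Proof. by move=> pT y My; apply: pT => i /My ->. Qed.

Lemma farkas_in M T (c : 'rV[R]_r) :
  (exists l : 'rV[R]_p, [/\ l *m M = c, forall i, 0 <= l 0 i
      & forall i, i \notin T -> l 0 i = 0]) \/
  (exists y : 'cV[R]_r,
      (forall i, i \in T -> 0 <= (M *m y) i 0) /\ (c *m y) 0 0 < 0).
Proof.
pose D : 'M[R]_p := diag_mx (\row_i (i \in T)%:R).
have [[l [l0 lM]]|[y [My cy]]] := farkas (D *m M) c; [left|right].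
  exists (l *m D); split=> [|i|i iT]; rewrite -?mulmxA // mul_mx_diag.
    by rewrite !mxE mulr_ge0 // ler0n.
  by rewrite !mxE (negPf iT) mulr0.
exists y; split=> // i iT; move: (My i).
by rewrite -mulmxA mul_diag_mx !mxE iT mul1r.
Qed.

(** By Farkas, minus any row in [T] is a nonnegative combination of rows in [T]. This gives for each
    [j] in [T] a dependency positive at [j]; their sum is positive on all of [T]. *)
Lemma pspanning_coface M T : pspanning M T -> coface M T.
Proof.
move=> pT.
have /choice [l lP] : forall j, exists l : 'rV[R]_p, j \in T ->
    [/\ l *m M = 0, forall i, 0 <= l 0 i, forall i, i \notin T -> l 0 i = 0
      & 0 < l 0 j].
  move=> j; case: (boolP (j \in T)) => jT; last by exists 0.
  have [[l [lM l0 lT]]|[y [My]]] := farkas_in M T (- row j M).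
    exists (l + delta_mx 0 j) => _; split=> [|i|i iT|].
    - by rewrite mulmxDl lM -rowE addNr.
    - by rewrite !mxE addr_ge0 // ler0n.
    - rewrite !mxE lT // add0r eqxx /=; case: eqP => // ij.
      by rewrite ij jT in iT.
    - by rewrite !mxE !eqxx ltr_wpDl.
  by rewrite (pT y) // mulmx0 mxE ltxx.
exists (\sum_(j in T) l j); split=> [|i iT|i iT].
- by rewrite mulmx_suml big1 // => j /lP[].
- rewrite summxE (bigD1 i) //= ltr_wpDr //; last by case: (lP i iT).
  by apply: sumr_ge0 => j /andP[/lP[_ l0 _ _] _]; apply: l0.
- by rewrite summxE big1 // => j /lP[_ _ l0 _]; apply: l0.
Qed.

Lemma coface_pspanning M T : coface M T -> spanning M T -> pspanning M T.
Proof.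
move=> [l [lM lT lT']] sT y My; apply: sT => i iT.
have : (l *m (M *m y)) 0 0 = 0 by rewrite mulmxA lM mul0mx mxE.
rewrite mxE => /eqP; rewrite psumr_eq0 => [/allP/(_ i)|j _].
  by rewrite mem_index_enum => /(_ isT); rewrite mulf_eq0 gt_eqF ?lT // => /eqP.
have [jT|jT] := boolP (j \in T); first by rewrite mulr_ge0 ?My // ltW // lT.
by rewrite lT' // mul0r.
Qed.

Lemma separable_not_coface M T : T != finset.set0 -> separable M T ->
  ~ coface M T.
Proof.
move=> /finset.set0Pn [j jT] [y My] [l [lM lT lT']].
have : (l *m (M *m y)) 0 0 = 0 by rewrite mulmxA lM mul0mx mxE.
rewrite mxE (bigD1 j) //=; apply/eqP; rewrite gt_eqF // ltr_wpDr //.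
  apply: sumr_ge0 => i _; have [iT|iT] := boolP (i \in T).
    by rewrite mulr_ge0 // ltW // ?lT ?My.
  by rewrite lT' // mul0r.
by rewrite mulr_gt0 ?lT ?My.
Qed.

Lemma simplicial_pspanning M T :
  simplicial_config M -> T != finset.set0 -> coface M T -> pspanning M T.
Proof. by move=> sM T0 cT; apply: coface_pspanning => //; apply: sM. Qed.

End Configurations.

(** Farkas for the rows lengthened by a coordinate 1, with target [(0, 1)]: either a convex
    combination of rows in [T] vanishes, or some functional exceeds a positive constant on all of
    them. *)
Lemma gordan (R : realFieldType) p r (M : 'M[R]_(p, r)) (T : {set 'I_p}) :
  separable M T \/
  exists2 T', T' != finset.set0 & T' \subset T /\ coface M T'.
Proof.
pose M1 := row_mx M (const_mx 1 : 'cV[R]_p).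
have M1E (y : 'cV[R]_(r + 1)) i :
    (M1 *m y) i 0 = (M *m usubmx y) i 0 + dsubmx y 0 0.
  rewrite -{1}(vsubmxK y) /M1 mul_row_col mxE; congr (_ + _).
  by rewrite mxE big_ord1 mxE mul1r.
have [[l [lM l0 lT]]|[y [My]]] := farkas_in M1 T (row_mx 0 1).
  right; move: lM; rewrite mul_mx_row => /eq_row_mx [lM l1].
  exists [set i | 0 < l 0 i]%SET.
    apply/finset.set0Pn; have: 0 < (l *m (const_mx 1 : 'cV[R]_p)) 0 0.
      by rewrite l1 mxE ltr01.
    rewrite mxE => l_gt0; apply/existsP; apply: contraTT l_gt0.
    rewrite negb_exists => /forallP l_le0; rewrite -leNgt.
    apply: sumr_le0 => i _; rewrite mxE mulr1.
    by move: (l_le0 i); rewrite inE -leNgt.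
  split; last exists l; first last.
    split=> // i; rewrite inE // lt_def l0 andbT negbK => /eqP //.
  apply/fintype.subsetP => i; rewrite inE; apply: contraTT => /lT ->.
  by rewrite ltxx.
rewrite -{1}(vsubmxK y) mul_row_col mul0mx add0r mul1mx => y_lt0.
left; exists (usubmx y) => i /My; rewrite M1E.
lra.
Qed.

(** * Small perturbations *)

Section Small.
Variable R : realFieldType.

Definition small (P : R -> Prop) :=
  exists2 e0, 0 < e0 & forall e, 0 < e < e0 -> P e.

Lemma small_imp (P Q : R -> Prop) :
  (forall e, 0 < e -> P e -> Q e) -> small P -> small Q.
Proof.
move=> PQ [e0 e0_gt0 Pe]; exists e0 => // e /andP[e1 e2].
by apply: PQ => //; apply: Pe; rewrite e1.
Qed.

Lemma small_and (P Q : R -> Prop) :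
  small P -> small Q -> small (fun e => P e /\ Q e).
Proof.
move=> [a a0 Pa] [b b0 Qb]; exists (Num.min a b); first by rewrite lt_min a0.
by move=> e; rewrite lt_min => /and3P[e0 ea eb]; split; [apply: Pa|apply: Qb];
  rewrite e0.
Qed.

Lemma small_true (P : R -> Prop) : (forall e, P e) -> small P.
Proof. by move=> HP; exists 1. Qed.

Lemma small_all (I : finType) (P : I -> R -> Prop) :
  (forall i, small (P i)) -> small (fun e => forall i, P i e).
Proof.
move=> sP; suff [e0 e0_gt0 Pe] : small (fun e => forall i, i \in enum I ->
  P i e).
  by exists e0 => // e e_in i; apply: Pe; rewrite ?mem_enum.
elim: (enum I) => [|i s IH]; first exact: small_true.
apply: small_imp (small_and (sP i) IH) => e _ [Pi Ps] j.
by rewrite inE => /predU1P[->|/Ps].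
Qed.

Lemma small_affine (a b : R) : 0 < a -> small (fun e => 0 < a + e * b).
Proof.
move=> a0; have b0 : 0 < 1 + `|b| by rewrite ltr_wpDr.
exists (a / (1 + `|b|)); first by rewrite divr_gt0.
move=> e /andP[e0]; rewrite ltr_pdivlMr // => eb.
have: e * `|b| < a by rewrite mulrDr in eb; lra.
have := ler_norm (- b); rewrite normrN -(ler_pM2l e0) mulrN; lra.
Qed.

End Small.

Section Perturbation.
Variables (R : realFieldType) (p r : nat).
Implicit Types (M D : 'M[R]_(p, r)) (T : {set 'I_p}).

(** Summed over [j], the estimates bound the 1-norm of [y] by itself times a factor below 1. *)
Lemma contraction_eq0 (F : 'M[R]_r) (y : 'cV[R]_r) (e : R) : 0 < e ->
  (forall j k, 0 <= F j k) -> 0 < 1 + e * - (\sum_j \sum_k F j k) ->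
  (forall j, `|y j 0| <= e * \sum_k F j k * `|y k 0|) -> y = 0.
Proof.
move=> e0 F0 eF yF; pose N := \sum_j `|y j 0|.
have N0 : 0 <= N by apply: sumr_ge0.
have yN k : `|y k 0| <= N.
  by rewrite /N (bigD1 k) //= lerDl sumr_ge0.
have : N <= e * (\sum_j \sum_k F j k) * N.
  apply: (le_trans (ler_sum _ (fun j _ => yF j))).
  rewrite -mulr_sumr -mulrA ler_pM2l // mulr_suml; apply: ler_sum => j _.
  by rewrite mulr_suml; apply: ler_sum => k _; rewrite ler_wpM2l.
move=> NF; have N_eq0 : N = 0 by nra.
apply/colP => j; rewrite mxE; apply/eqP; by rewrite -normr_le0 -N_eq0 yN.
Qed.

Lemma small_contraction (F : 'M[R]_r) : (forall j k, 0 <= F j k) ->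
  small (fun e => forall y : 'cV[R]_r,
    (forall j, `|y j 0| <= e * \sum_k F j k * `|y k 0|) -> y = 0).
Proof.
move=> F0; apply: small_imp (small_affine (- (\sum_j \sum_k F j k)) ltr01).
by move=> e e0 eF y; apply: contraction_eq0.
Qed.

Lemma mulmx_norm_le (E : 'M[R]_r) (y : 'cV[R]_r) j :
  `|(E *m y) j 0| <= \sum_k `|E j k| * `|y k 0|.
Proof.
rewrite mxE; apply: (le_trans (ler_norm_sum _ _ _)).
by apply: ler_sum => k _; rewrite normrM.
Qed.

(** Each unit vector and its negative are nonnegative combinations of rows in [T] (matrices [K1],
    [K2]). Evaluated on a functional nonnegative on the perturbed rows, they bound each entry of [y]
    from both sides by [e] times a fixed linear form in the absolute values, so [y] vanishes by
    contraction. *)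
Lemma pspanning_perturb M D T : pspanning M T ->
  small (fun e => pspanning (M + e *: D) T).
Proof.
move=> pT.
have ex_row (s : R) j : exists l : 'rV[R]_p, [/\ l *m M = s *: delta_mx 0 j,
    forall i, 0 <= l 0 i & forall i, i \notin T -> l 0 i = 0].
  have [//|[y [My]]] := farkas_in M T (s *: delta_mx 0 j).
  by rewrite (pT y) // mulmx0 mxE ltxx.
have ex_mx (s : R) : exists K : 'M[R]_(r, p), [/\ K *m M = s%:M,
    forall j i, 0 <= K j i & forall j i, i \notin T -> K j i = 0].
  have [l lP] := choice (ex_row s); exists (\matrix_(j, i) l j 0 i).
  split=> [|j i|j i iT]; rewrite ?mxE; last 2 first.
  - by case: (lP j).
  - by case: (lP j) => _ _ ->.
  apply/row_matrixP => j; have [lM _ _] := lP j.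
  rewrite row_mul; have -> : row j (\matrix_(j, i) l j 0 i) = l j.
    by apply/rowP => i; rewrite !mxE.
  by rewrite lM; apply/rowP => k; rewrite !mxE eqxx mulr_natr eq_sym.
have [K1 [KM1 K1_ge0 K1T]] := ex_mx 1.
have [K2 [KM2 K2_ge0 K2T]] := ex_mx (-1).
pose F := map_mx Num.norm (K1 *m D) + map_mx Num.norm (K2 *m D).
have F0 j k : 0 <= F j k by rewrite !mxE addr_ge0.
apply: small_imp (small_contraction F0) => e e0 contr y My; apply: contr => j.
have boundK (K : 'M[R]_(r, p)) s : K *m M = s%:M -> (forall j i, 0 <= K j i) ->
    (forall j i, i \notin T -> K j i = 0) ->
    0 <= s * y j 0 + e * \sum_k `|(K *m D) j k| * `|y k 0|.
  move=> KM K0 KT.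
  have : 0 <= (K *m ((M + e *: D) *m y)) j 0.
    rewrite mxE sumr_ge0 // => i _; have [iT|iT] := boolP (i \in T).
      by rewrite mulr_ge0 ?My.
    by rewrite KT // mul0r.
  rewrite mulmxDl mulmxDr -scalemxAl -scalemxAr !mulmxA KM mul_scalar_mx.
  rewrite [X in 0 <= X]mxE [X in X + _]mxE [X in _ + X]mxE.
  move=> /le_trans; apply; rewrite lerD2l ler_pM2l //.
  by apply: le_trans (mulmx_norm_le _ _ _); apply: ler_norm.
have FE : \sum_k F j k * `|y k 0| = (\sum_k `|(K1 *m D) j k| * `|y k 0|) +
    (\sum_k `|(K2 *m D) j k| * `|y k 0|).
  rewrite -big_split /=; apply: eq_bigr => k _.
  by rewrite -mulrDl !mxE.
have := boundK _ _ KM1 K1_ge0 K1T; have := boundK _ _ KM2 K2_ge0 K2T.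
rewrite FE mulrDr.
set a := e * _; set b := e * _ => Ha Hb.
have a0 : 0 <= a by rewrite mulr_ge0 ?(ltW e0) // sumr_ge0 // => k _;
  rewrite mulr_ge0.
have b0 : 0 <= b by rewrite mulr_ge0 ?(ltW e0) // sumr_ge0 // => k _;
  rewrite mulr_ge0.
by rewrite ler_norml; apply/andP; split; lra.
Qed.

(** The same contraction, with a left inverse [K] of the rows in [T]. *)
Lemma spanning_perturb M D T : spanning M T ->
  small (fun e => spanning (M + e *: D) T).
Proof.
move=> sT; pose d : 'M[R]_p := diag_mx (\row_i (i \in T)%:R).
have dE q (N : 'M[R]_(p, q)) i j : (d *m N) i j = (i \in T)%:R * N i j.
  by rewrite mul_diag_mx !mxE.
have full : row_full (d *m M).
  rewrite /row_full -mxrank_tr -/(row_free _); apply: inj_row_free => v vM.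
  apply: trmx_inj; rewrite trmx0; apply: sT => i iT.
  have /matrixP/(_ i 0) : d *m (M *m v^T) = 0.
    by rewrite mulmxA -[LHS]trmxK trmx_mul trmxK vM trmx0.
  by rewrite dE iT mul1r => ->; rewrite mxE.
pose K := pinvmx (d *m M) *m d.
have KM : K *m M = 1%:M by rewrite /K -mulmxA mulVpmx.
pose F := map_mx Num.norm (K *m D).
have F0 j k : 0 <= F j k by rewrite !mxE.
apply: small_imp (small_contraction F0) => e e0 contr y My; apply: contr => j.
have : K *m ((M + e *: D) *m y) = 0.
  rewrite /K -mulmxA; apply/matrixP => i k; rewrite mxE big1 ?mxE // => l _.
  rewrite !ord1 dE; have [lT|_] := boolP (l \in T); last by rewrite mul0r mulr0.
  by rewrite My // !mulr0.
rewrite mulmxDl mulmxDr -scalemxAl -scalemxAr !mulmxA KM mul1mx.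
move=> /eqP; rewrite addr_eq0 => /eqP yE.
rewrite [in leLHS]yE [X in `|X|]mxE [X in `|- X|]mxE normrN normrM gtr0_norm //.
rewrite ler_pM2l //; apply: (le_trans (mulmx_norm_le _ _ _)).
by apply: ler_sum => k _; rewrite [F _ _]mxE.
Qed.

Lemma separable_perturb M D T : separable M T ->
  small (fun e => separable (M + e *: D) T).
Proof.
move=> [y My].
have : small (fun e => forall i, i \in T -> 0 < (M *m y) i 0 + e * (D *m y) i
  0).
  apply: small_all => i; have [iT|iT] := boolP (i \in T).
    by apply: small_imp (small_affine ((D *m y) i 0) (My i iT)).
  exact: small_true.
apply: small_imp => e e0 pos; exists y => i /pos.
by rewrite mulmxDl -scalemxAl [X in _ -> 0 < X]mxE [X in _ -> 0 < _ + X]mxE.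
Qed.

(* For a simplicial configuration every nonempty index set is either
   positively spanning, or contains no nonempty coface and is hence separable;
   both properties survive a small perturbation. *)
Lemma small_coface_perturb M D : simplicial_config M ->
  small (fun e => [/\ simplicial_config (M + e *: D),
    forall T, coface (M + e *: D) T <-> coface M T
    & forall T, pspanning M T -> pspanning (M + e *: D) T]).
Proof.
move=> sM.
have : small (fun e => forall T : {set 'I_p},
    (pspanning M T -> pspanning (M + e *: D) T) /\
    (separable M T -> separable (M + e *: D) T)).
  apply: small_all => T; apply: small_and.
    have [pT|npT] := pselect (pspanning M T).
      by apply: small_imp (pspanning_perturb D pT).
    exact: small_true.
  have [pT|npT] := pselect (separable M T).
    by apply: small_imp (separable_perturb D pT).
  exact: small_true.
apply: small_imp => e e0 pert.
have dich T : T != finset.set0 -> pspanning M T \/ separable M T.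
  move=> T0; have [?|[T' T'0 [sT cT']]] := gordan M T; first by right.
  by left; apply: pspanningS sT _; apply: simplicial_pspanning.
have cof0 N : coface N finset.set0.
  exists 0; split=> [|i|i _]; first by rewrite mul0mx.
    by rewrite finset.in_set0.
  by rewrite mxE.
have imp T : T != finset.set0 -> coface (M + e *: D) T -> pspanning M T.
  move=> T0 cT; have [//|/(pert T).2 /separable_not_coface] := dich T T0.
  by move=> /(_ T0).
split=> [T T0 cT|T|T]; last exact: (pert T).1.
  by apply: pspanning_spanning; apply: (pert T).1; apply: imp.
have [->|T0] := eqVneq T finset.set0; first by split=> _; apply: cof0.
split=> [/imp|] cT; first exact: pspanning_coface (cT T0).
by apply: pspanning_coface; apply: (pert T).1; apply: simplicial_pspanning.
Qed.

End Perturbation.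

(** * Projections of combinatorial cubes *)

Section InclusionIso.

(** Lets an isomorphism be given by a common parametrization of both families. The parametrizations
    may repeat values: that the induced map is well defined and injective follows from antisymmetry
    of inclusion. *)
Lemma indexed_inclusion_iso (I T U : Type) (D : set I) (A : set (set T))
    (B : set (set U)) (f : I -> set T) (g : I -> set U) :
  (forall F, A F <-> exists2 i, D i & f i = F) ->
  (forall F, B F <-> exists2 i, D i & g i = F) ->
  (forall i j, D i -> D j -> (f i `<=` f j <-> g i `<=` g j)) ->
  inclusion_iso A B.
Proof.
move=> Af Bg fg.
have /choice [h hP] : forall F, exists G, A F ->
  exists i, [/\ D i, f i = F & g i = G].
  move=> F; have [/Af [i Di fi]|nA] := pselect (A F).
    by exists (g i) => _; exists i.
  by exists set0.
exists h; split; last first.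
  move=> F F' /hP [i [Di <- <-]] /hP [j [Dj <- <-]]; exact: fg.
split.
- by move=> F /hP [i [Di _ <-]]; apply/Bg; exists i.
- move=> F F'; rewrite !inE => /hP [i [Di <- <-]] /hP [j [Dj <- <-]] gij.
  by rewrite eqEsubset; split; apply/fg; rewrite ?gij.
- move=> G /Bg [i Di <-]; have AF : A (f i) by apply/Af; exists i.
  exists (f i) => //; have [j [Dj fji <-]] := hP _ AF.
  by rewrite eqEsubset; split; apply/fg; rewrite ?fji.
Qed.

Lemma inclusion_iso_sym (T U : Type) (A : set (set T)) (B : set (set U)) :
  inclusion_iso A B -> inclusion_iso B A.
Proof.
move=> [f [[fAB finj fsurj] fle]].
apply: (@indexed_inclusion_iso _ _ _ A _ _ f id).
- by move=> F; split=> [/fsurj|] [G]; [exists G|move=> /fAB ? <-].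
- by move=> F; split=> [?|[G ? <-]] //; exists F.
- by move=> F G AF AG; rewrite fle.
Qed.

Lemma inclusion_iso_trans (T U W : Type) (A : set (set T)) (B : set (set U))
    (C : set (set W)) :
  inclusion_iso A B -> inclusion_iso B C -> inclusion_iso A C.
Proof.
move=> [f [[fAB finj fsurj] fle]] [g [[gBC ginj gsurj] gle]].
apply: (@indexed_inclusion_iso _ _ _ A _ _ id (g \o f)).
- by move=> F; split=> [?|[G ? <-]] //; exists F.
- move=> F; split=> [/gsurj [G /fsurj [H AH <-] <-]|[G /fAB /gBC /= ? <-//]].
  by exists H.
- move=> F G AF AG /=; rewrite fle // gle //; exact: fAB.
Qed.

Lemma inclusion_iso_refl (T : Type) (A : set (set T)) : inclusion_iso A A.
Proof.
apply: (@indexed_inclusion_iso _ _ _ A _ _ id id) => // F;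
  by split=> [?|[G ? <-]] //; exists F.
Qed.

End InclusionIso.

(** Gordan for the differences of [x] and the rows of [V]: a vanishing positive combination of them,
    rescaled, puts [x] in the hull. *)
Lemma convhull_separation (R : realType) k m (V : 'M[R]_(k, m)) (x : 'rV[R]_m) :
  ~ convhull V x -> exists c : 'cV[R]_m, forall i, (V *m c) i 0 < (x *m c) 0 0.
Proof.
move=> nVx; pose M : 'M[R]_(k, m) := \matrix_i (x - row i V).
have ME (c : 'cV[R]_m) i : (M *m c) i 0 = (x *m c) 0 0 - (V *m c) i 0.
  rewrite !mxE -sumrB; apply: eq_bigr => j _.
  by rewrite !mxE mulrBl.
have [[c Mc]|[T' /finset.set0Pn [j jT] [_ [l [lM lT lT']]]]] :=
  gordan M [set: 'I_k]%SET.
  by exists c => i; rewrite -subr_gt0 -ME Mc // finset.in_setT.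
have l0 i : 0 <= l 0 i.
  by have [iT|/lT' ->//] := boolP (i \in T'); rewrite ltW ?lT.
pose s := \sum_i l 0 i.
have s0 : 0 < s.
  by rewrite /s (bigD1 j) //= ltr_pwDl ?lT // sumr_ge0.
case: nVx; exists (s^-1 *: l); split=> [i||].
- by rewrite mxE mulr_ge0 // invr_ge0 ltW.
- rewrite (eq_bigr (fun i => s^-1 * l 0 i)) => [|i _]; last by rewrite mxE.
  by rewrite -mulr_sumr mulVf ?gt_eqF.
- have : s *: x - l *m V = 0.
    rewrite -lM; apply/rowP => q; rewrite !mxE mulr_suml -sumrB.
    by apply: eq_bigr => i _; rewrite !mxE mulrBr.
  move=> /eqP; rewrite subr_eq0 -scalemxAl => /eqP <-.
  by rewrite scalerA mulVf ?scale1r // gt_eqF.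
Qed.

Section SignVectors.
Variable n : nat.

(* [None] stands for the entry 0, and [Some false], [Some true] for the
   entries +, -. *)
Definition sgnvec := {ffun 'I_n -> option bool}.
Implicit Types (t u : sgnvec) (s : {ffun 'I_n -> bool}).

(** Here [u] is the refinement of [t]. More signs mean more tight inequalities, so the order
    reverses inclusion of faces. *)
Definition refines t u := [forall i, (t i != None) ==> (u i == t i)].
Definition full s : sgnvec := [ffun i => Some (s i)].
(** The sign [false] at zero entries is arbitrary: wherever normals with signs [fill t] are
    combined, the multipliers vanish outside [supp t]. *)
Definition fill t : {ffun 'I_n -> bool} := [ffun i => odflt false (t i)].
Definition supp t := [set i | t i != None]%SET.
Definition flip s i : {ffun 'I_n -> bool} :=
  [ffun j => if j == i then ~~ s j else s j].
Definition zero_sgn : sgnvec := [ffun => None].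

Lemma refinesP t u :
  reflect (forall i a, t i = Some a -> u i = Some a) (refines t u).
Proof.
apply: (iffP forallP) => [h i a ti|h i].
  by have := h i; rewrite ti => /eqP.
by apply/implyP; case ti: (t i) => [a|//] _; rewrite (h i a).
Qed.

Lemma refines_refl t : refines t t.
Proof. exact/refinesP. Qed.

Lemma refines_anti t u : refines t u -> refines u t -> t = u.
Proof.
move=> /refinesP tu /refinesP ut; apply/ffunP => i.
case ti: (t i) => [a|]; first by rewrite (tu _ _ ti).
by case ui: (u i) => [a|//]; rewrite (ut _ _ ui) in ti.
Qed.

Lemma refines_zero t : refines zero_sgn t.
Proof. by apply/refinesP => i a; rewrite ffunE. Qed.

Lemma refines_full t s :
  reflect (forall i a, t i = Some a -> s i = a) (refines t (full s)).
Proof.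
apply: (iffP (refinesP _ _)) => h i a /h; rewrite ffunE; first by case.
by move=> ->.
Qed.

Lemma refines_fill t : refines t (full (fill t)).
Proof. by apply/refines_full => i a ti; rewrite ffunE ti. Qed.

Lemma refines_flip t s i : refines t (full s) -> t i = None ->
  refines t (full (flip s i)).
Proof.
move=> /refines_full ts ti; apply/refines_full => j a tj; rewrite ffunE.
by case: eqP => [ji|_]; [rewrite -ji tj in ti|apply: ts].
Qed.

(** If [t] had a sign where [u] has a zero, then of the two vertices [fill u] and its flip at that
    entry, both refining [u], one would not refine [t]. *)
Lemma refines_by_full t u :
  (forall s, refines u (full s) -> refines t (full s)) -> refines t u.
Proof.
move=> tu; apply/refinesP => i a ti.
have /tu /refines_full /(_ i a ti) := refines_fill u.
case ui: (u i) => [c|]; first by rewrite ffunE ui => <-.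
move=> fi; have /tu /refines_full := refines_flip (refines_fill u) ui.
by move=> /(_ i a ti); rewrite ffunE eqxx fi; case: (a).
Qed.

End SignVectors.
Arguments zero_sgn {n}.

Section Cube.
Variables (R : realType) (n d : nat) (A : bool -> 'M[R]_n) (b : bool -> 'I_n ->
  R).

Definition mixed (s : {ffun 'I_n -> bool}) : 'M[R]_n :=
  \matrix_(i, j) A (s i) i j.

Definition lhs (x : 'rV[R]_n) a i : R := (x *m (A a)^T) 0 i.

Variable v : {ffun 'I_n -> bool} -> 'rV[R]_n.

Definition cubical_system :=
  [/\ forall s, mixed s \in unitmx,
      forall s, solutions A b (v s)
    & forall s a i, (lhs (v s) a i == b a i) = (a == s i)].

Definition cface (t : sgnvec n) : set 'rV[R]_n :=
  [set x | solutions A b x /\ forall i a, t i = Some a -> lhs x a i = b a i].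

Variable L : 'M[R]_(n, d).

Definition pface t : set 'rV[R]_d := [set x *m L | x in cface t].

(* The relative interior of the normal cone of the face [t] meets the
   functionals that factor through [L], that is, [t] survives the
   projection. *)
Definition good t := exists (c : 'cV[R]_d) (m : 'rV[R]_n),
  [/\ (L *m c)^T = m *m mixed (fill t), forall i, i \in supp t -> 0 < m 0 i
    & forall i, i \notin supp t -> m 0 i = 0].

Lemma mixed_eval (c : 'cV[R]_n) (m : 'rV[R]_n) s (x : 'rV[R]_n) :
  c^T = m *m mixed s -> (x *m c) 0 0 = \sum_i m 0 i * lhs x (s i) i.
Proof.
move=> /(congr1 trmx); rewrite trmxK trmx_mul => ->.
rewrite mulmxA mxE; apply: eq_bigr => i _; rewrite mulrC /lhs !mxE;
  congr (_ * _).
by apply: eq_bigr => j _; rewrite !mxE.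
Qed.

Lemma mixed_agree (m : 'rV[R]_n) (s s' : {ffun 'I_n -> bool}) :
  (forall i, m 0 i != 0 -> s i = s' i) -> m *m mixed s = m *m mixed s'.
Proof.
move=> ss'; apply/rowP => j; rewrite !mxE; apply: eq_bigr => i _; rewrite !mxE.
by have [->|/ss' ->//] := eqVneq (m 0 i) 0; rewrite !mul0r.
Qed.

Hypothesis cubeA : cubical_system.
Let v_sol s : solutions A b (v s). Proof. by case: cubeA. Qed.
Let v_tight s a i : (lhs (v s) a i == b a i) = (a == s i).
Proof. by case: cubeA. Qed.

Lemma mixed_decomp (c : 'cV[R]_n) s : exists m, c^T = m *m mixed s.
Proof.
by case: cubeA => unitA _ _; exists (c^T *m invmx (mixed s)); rewrite mulmxKV.
Qed.

Lemma lhs_vertex s i : lhs (v s) (s i) i = b (s i) i.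
Proof. by apply/eqP; rewrite v_tight. Qed.

Lemma lhs_flip s i j : j != i -> lhs (v (flip s i)) (s j) j = b (s j) j.
Proof. by move=> /negPf ji; apply/eqP; rewrite v_tight ffunE ji. Qed.

Lemma lhs_flip_lt s i : lhs (v (flip s i)) (s i) i < b (s i) i.
Proof. by rewrite lt_neqAle v_tight ffunE eqxx v_sol andbT; case: (s i). Qed.

Lemma cface_vertex t s : cface t (v s) <-> refines t (full s).
Proof.
split=> [[_ tight]|/refines_full ts].
  by apply/refines_full => i a /tight /eqP; rewrite v_tight => /eqP.
by split=> // i a /ts <-; apply: lhs_vertex.
Qed.

(* At a vertex maximizing [c], a negative multiplier could be improved by
   moving along the corresponding edge. *)
Lemma best_vertex (c : 'cV[R]_n) t : exists s m,
  [/\ refines t (full s), c^T = m *m mixed s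
    & forall i, t i = None -> 0 <= m 0 i].
Proof.
pose val s := (v s *m c) 0 0.
have [s ts smax] : exists2 s, refines t (full s) &
    forall s', refines t (full s') -> val s' <= val s.
  by case: (@Order.TotalTheory.arg_maxP _ _ _ (fill t) (fun s =>
    refines t (full s)) val (refines_fill t)) => s ts smax; exists s.
have [m cm] := mixed_decomp c s; exists s, m; split=> // i ti.
have := smax _ (refines_flip ts ti); rewrite /val !(mixed_eval _ cm).
rewrite -subr_le0 -sumrB (bigD1 i) //= big1 ?addr0 => [|j ji]; last first.
  by rewrite lhs_flip // lhs_vertex subrr.
rewrite -mulrBr nmulr_lle0 // subr_lt0 lhs_vertex; exact: lhs_flip_lt.
Qed.

Lemma lhs_le x a i : solutions A b x -> lhs x a i <= b a i.
Proof. by move=> /(_ a i). Qed.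

(** The functional is a positive combination of the inequalities in [supp t], so on the cube its
    maximum is attained exactly where all of them are tight. *)
Lemma good_face t : good t -> exists (c : 'cV[R]_d) (e : R),
  (forall x, solutions A b x -> (x *m L *m c) 0 0 <= e) /\
  forall x, solutions A b x -> ((x *m L *m c) 0 0 = e <-> cface t x).
Proof.
move=> [c [m [cm m_gt0 m_eq0]]]; exists c, (\sum_i m 0 i * b (fill t i) i).
have valE x : (x *m L *m c) 0 0 = \sum_i m 0 i * lhs x (fill t i) i.
  by rewrite -mulmxA (mixed_eval _ cm).
have m_ge0 i : 0 <= m 0 i.
  by have [/m_gt0/ltW|/m_eq0 ->] := boolP (i \in supp t).
have le_term x i : solutions A b x ->
    m 0 i * lhs x (fill t i) i <= m 0 i * b (fill t i) i.
  by move=> xC; rewrite ler_wpM2l // lhs_le.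
split=> x xC; rewrite valE; first by apply: ler_sum => i _; apply: le_term.
split=> [/eqP|[_ tight]].
  rewrite eq_sym -subr_eq0 -sumrB psumr_eq0 => [/allP eq0|i _]; last first.
    by rewrite subr_ge0 le_term.
  split=> // i a ti; have := eq0 i (mem_index_enum i).
  rewrite -mulrBr mulf_eq0 gt_eqF ?m_gt0 ?inE ?ti //= subr_eq0 ffunE ti /=.
  by move=> /eqP.
apply: eq_bigr => i _; have [iS|/m_eq0 ->] := boolP (i \in supp t).
  move: iS; rewrite inE; case ti: (t i) => [a|//] _.
  by rewrite ffunE ti /= tight.
by rewrite !mul0r.
Qed.

(** The functional exposing [t'] factors through [L], so a point of the cube that projects into
    [pface t'] already lies in [cface t']. Testing this on vertices recovers the refinement. *)
Lemma pface_subset t t' : good t' -> (pface t `<=` pface t' <-> refines t' t).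
Proof.
move=> /good_face [c [e [_ ce]]]; split=> [tt'|/refinesP tt'].
  apply: refines_by_full => s ts; apply/cface_vertex.
  have [sol tight] : cface t (v s) by apply/cface_vertex.
  have [|x xt' xv] := tt' (v s *m L); first by exists (v s).
  by apply/(ce _ sol); rewrite -xv; apply/(ce x) => //; case: xt'.
move=> _ [x [sol tight] <-]; exists x => //; split=> // i a /tt'.
exact: tight.
Qed.

Lemma pface_nonempty t : pface t !=set0.
Proof.
by exists (v (fill t) *m L), (v (fill t)) => //;
  apply/cface_vertex/refines_fill.
Qed.

Lemma good_pface_inj t t' : good t -> good t' -> pface t = pface t' -> t = t'.
Proof.
by move=> gt gt' e; apply: refines_anti; apply/pface_subset => //; rewrite e.
Qed.

Lemma zero_good : good zero_sgn.
Proof.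
exists 0, 0; split=> [|i|i _]; rewrite ?mulmx0 ?mul0mx ?trmx0 //.
  by rewrite inE ffunE.
by rewrite mxE.
Qed.

Lemma pface_zero : pface zero_sgn = [set x *m L | x in solutions A b].
Proof.
rewrite eqEsubset; split=> _ [x xC <-]; exists x => //; first by case: xC.
by split=> // i a; rewrite ffunE.
Qed.

Lemma face_pface t : good t -> forall F, face (pface t) F <->
  F = set0 \/ exists2 t', refines t t' /\ good t' & F = pface t'.
Proof.
move=> gt F; split; last first.
  move=> [->|[t' [tt' gt'] ->]].
    exists 0, 1; split=> [y _|]; first by rewrite mulmx0 mxE ler01.
    apply/esym; rewrite -subset0 => y [_].
    by rewrite mulmx0 mxE => /esym/eqP; rewrite oner_eq0.
  have [c [e [le_e eq_e]]] := good_face gt'.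
  have sub : pface t' `<=` pface t by apply/pface_subset.
  exists c, e; split=> [_ [x [xC _] <-]|]; first exact: le_e.
  rewrite eqEsubset; split=> [y yt'|_ [[x xt <-]]].
    split; first exact: sub.
    by case: yt' => x xt' <-; apply/eq_e => //; case: xt'.
  by move=> /eq_e xt'; exists x => //; apply: xt'; case: xt.
move=> [c [e [le_e ->]]].
have [s [m [ts cm m_ge0]]] := best_vertex (L *m c) t.
pose M := \sum_i m 0 i * b (s i) i.
have valE x : (x *m L *m c) 0 0 = \sum_i m 0 i * lhs x (s i) i.
  by rewrite -mulmxA (mixed_eval _ cm).
have vs_max : (v s *m L *m c) 0 0 = M.
  by rewrite valE; apply: eq_bigr => i _; rewrite lhs_vertex.
(* The maximizers of [c] in [cface t] form the face in which the inequalities with positive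
   multiplier at the best vertex [s] become tight as well. *)
pose t' : sgnvec n := [ffun i => if t i is Some a then Some a
  else if 0 < m 0 i then Some (s i) else None].
have tt' : refines t t' by apply/refinesP => i a; rewrite ffunE => ->.
have t's : refines t' (full s).
  apply/refines_full => i a; rewrite ffunE; case ti: (t i) => [a'|].
    by case=> <-; move/refines_full: ts; apply.
  by case: ifP => // _ [].
have gap x : cface t x -> M - (x *m L *m c) 0 0 =
    \sum_(i | t i == None) m 0 i * (b (s i) i - lhs x (s i) i).
  move=> [xC tight]; rewrite valE -sumrB [RHS]big_mkcond /=.
  apply: eq_bigr => i _; rewrite -mulrBr; case ti: (t i) => [a|//] /=.
  by move/refines_full: ts => /(_ i a ti) ->; rewrite tight // subrr mulr0.
have cface_t' x : cface t x -> ((x *m L *m c) 0 0 = M <-> cface t' x).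
  move=> xt; have [xC tight] := xt; split=> [xM|[_ tight']].
    split=> // i a; rewrite ffunE; case ti: (t i) => [a'|].
      by case=> <-; apply: tight.
    case: ifP => // mi [<-]; move: (gap _ xt); rewrite xM subrr => /esym/eqP.
    rewrite psumr_eq0 => [/allP/(_ i (mem_index_enum i))|j /eqP tj].
      by rewrite ti mulf_eq0 gt_eqF //= subr_eq0 => /eqP.
    by rewrite mulr_ge0 ?m_ge0 // subr_ge0 lhs_le.
  apply/eqP; rewrite eq_sym -subr_eq0 gap // big1 // => i /eqP ti.
  have [mi|mi] := ltP 0 (m 0 i).
    by rewrite (tight' i (s i)) ?subrr ?mulr0 // ffunE ti mi.
  by rewrite (le_anti (introT andP (conj mi (m_ge0 i ti)))) mul0r.
(* On [supp t] the multipliers [m] may be negative; a small multiple of them is added to the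
   positive multipliers of [t]. *)
have good_t' : good t'.
  have [c0 [m0 [cm0 m0_gt0 m0_eq0]]] := gt.
  have [eps eps_gt0 posH] : exists2 eps, 0 < eps &
      forall i, i \in supp t -> 0 < m0 0 i + eps * m 0 i.
    have [e0 e0_gt0 H] : small (fun e => forall i, i \in supp t ->
        0 < m0 0 i + e * m 0 i).
      apply: small_all => i; have [iS|iS] := boolP (i \in supp t).
        by apply: small_imp (small_affine (m 0 i) (m0_gt0 i iS)).
      exact: small_true.
    exists (e0 / 2); first by rewrite divr_gt0.
    by apply: H; rewrite divr_gt0 //= ltr_pdivrMr // ltr_pMr // ltrDl.
  exists (c0 + eps *: c), (m0 + eps *: m).
  have suppE i : i \in supp t' = (i \in supp t) || (0 < m 0 i).
    rewrite !inE ffunE; by case: (t i) => //=; case: ifP.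
  have agree (w : 'rV[R]_n) :
      (forall i, w 0 i != 0 -> i \in supp t') ->
      w *m mixed s = w *m mixed (fill t').
    move=> wS; apply: mixed_agree => i /wS; rewrite inE.
    case t'i: (t' i) => [a|//] _; rewrite [fill _ _]ffunE t'i.
    by move/refines_full: t's; apply.
  split=> [|i|i]; rewrite ?suppE.
  - rewrite mulmxDr -scalemxAr linearD linearZ /= cm0 cm -agree; last first.
      move=> i; rewrite suppE !mxE; apply: contraR; rewrite negb_or -leNgt.
      case/andP=> iS mi; rewrite m0_eq0 // add0r mulf_eq0 (gt_eqF eps_gt0) /=.
      have ti : t i = None by move: iS; rewrite inE negbK => /eqP.
      by rewrite eq_le mi m_ge0.
    rewrite mulmxDl -scalemxAl; congr (_ + _).
    apply: mixed_agree => i; have [|/m0_eq0 ->] := boolP (i \in supp t).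
      rewrite inE ffunE; case ti: (t i) => [a|//] _ _ /=; apply/esym.
      by move/refines_full: ts; apply.
    by rewrite eqxx.
  - rewrite !mxE; have [/posH //|iS /= mi] := boolP (i \in supp t).
    by rewrite m0_eq0 // add0r mulr_gt0.
  - rewrite negb_or -leNgt => /andP[iS mi]; rewrite !mxE m0_eq0 // add0r.
    have ti : t i = None by move: iS; rewrite inE negbK => /eqP.
    by rewrite (le_anti (introT andP (conj mi (m_ge0 i ti)))) mulr0.
have [e_M|] := eqVneq M e.
  right; exists t' => //; rewrite -e_M eqEsubset; split=> [_ [[x xt <-]]|].
    by move=> /(cface_t' x xt) xt'; exists x.
  move=> _ [x xt' <-].
  have xt : cface t x by case: xt' => xC xt'; split=> // i a ti; apply: xt';
    rewrite ffunE ti.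
  by split; [exists x|apply/cface_t'].
(* The remaining case: the bound [e] lies strictly above the maximum [M] and cuts out the empty
   face. *)
have : M <= e by rewrite -vs_max; apply: le_e; exists (v s) => //;
  apply/cface_vertex.
move=> M_le M_ne; left; rewrite -subset0 => _ [[x xt <-]] xe.
have : 0 <= M - (x *m L *m c) 0 0.
  rewrite gap // sumr_ge0 // => i /eqP ti.
  by rewrite mulr_ge0 ?m_ge0 // subr_ge0 lhs_le //; case: xt.
by rewrite xe subr_ge0 => e_M; move: M_ne; rewrite eq_le M_le e_M.
Qed.

Lemma solutions_hull x : solutions A b x -> forall c : 'cV[R]_n,
  exists s, (x *m c) 0 0 <= (v s *m c) 0 0.
Proof.
move=> xC c; have [s [m [_ cm m_ge0]]] := best_vertex c zero_sgn; exists s.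
rewrite !(mixed_eval _ cm); apply: ler_sum => i _; rewrite lhs_vertex.
by rewrite ler_wpM2l ?lhs_le // m_ge0 // ffunE.
Qed.

(** Every linear functional is bounded on the solutions by its value at some [v s]; by separation
    the solutions are the hull of the vertices. *)
Lemma pface_zero_convhull : exists V : 'M[R]_(#|{ffun 'I_n -> bool}|, d),
  pface zero_sgn = convhull V.
Proof.
pose W : 'M[R]_(#|{ffun 'I_n -> bool}|, n) := \matrix_k v (enum_val k).
exists (W *m L); rewrite pface_zero eqEsubset; split=> [_ [x xC <-]|].
  have [[w [w0 w1 ->]]|/convhull_separation [c cW]] := pselect (convhull W x).
    by exists w; rewrite mulmxA.
  have [s] := solutions_hull xC c; rewrite leNgt => /negP[].
  have := cW (enum_rank s);
    suff -> : (W *m c) (enum_rank s) 0 = (v s *m c) 0 0 by [].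
  by rewrite !mxE; apply: eq_bigr => j _; rewrite !mxE enum_rankK.
move=> _ [w [w0 w1 ->]]; exists (w *m W); last by rewrite mulmxA.
move=> a i; have -> : (w *m W *m (A a)^T) 0 i = \sum_k w 0 k * lhs
  (v (enum_val k)) a i.
  rewrite -mulmxA mxE; apply: eq_bigr => k _; congr (_ * _).
  by rewrite /lhs !mxE; apply: eq_bigr => j _; rewrite !mxE.
rewrite -[leRHS]mul1r -w1 mulr_suml; apply: ler_sum => k _.
by rewrite ler_wpM2l // lhs_le.
Qed.

Lemma pface_polytope : polytope (pface zero_sgn).
Proof. by have [V ->] := pface_zero_convhull; exists _, V. Qed.

End Cube.

(** * Affine dimension of projected faces *)

Section AffineDimension.
Variable R : realType.

Lemma affdim_eq m (S : set 'rV[R]_m) (k : nat) :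
  (exists V : 'M[R]_(k, m), affinely_independent V /\ forall i, S (row i V)) ->
  (forall j (V : 'M[R]_(j, m)), affinely_independent V ->
     (forall i, S (row i V)) -> (j <= k)%N) ->
  affdim S = k%:Z - 1.
Proof.
move=> exV maxk; rewrite /affdim; congr (Posz _ - 1).
have km : (k < m.+2)%N.
  have [V [+ _]] := exV; rewrite /affinely_independent /row_free => /eqP rk.
  have := rank_leq_col (row_mx V (const_mx 1 : 'cV[R]_k)).
  by rewrite rk addn1 ltnS.
apply/eqP; rewrite eqn_leq; apply/andP; split; last first.
  by apply: (@leq_bigmax_cond _ _ _ (Ordinal km)); apply/asboolP.
by apply/bigmax_leqP => j /asboolP [V [/maxk h1 /h1]].
Qed.

Lemma affdim_set0 m : affdim (set0 : set 'rV[R]_m) = -1.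
Proof.
rewrite (@affdim_eq _ _ 0) //.
  exists 0; split=> [|[]//].
  by rewrite /affinely_independent /row_free eqn_leq rank_leq_row.
by move=> [|j] V _ // /(_ ord0).
Qed.

Lemma affinely_independentP k m (V : 'M[R]_(k, m)) :
  reflect (forall w : 'rV[R]_k, w *m V = 0 -> \sum_i w 0 i = 0 -> w = 0)
    (affinely_independent V).
Proof.
have sumE (w : 'rV[R]_k) : w *m (const_mx 1 : 'cV[R]_k) = (\sum_i w 0 i)%:M.
  rewrite [LHS]mx11_scalar mxE; congr (_%:M); apply: eq_bigr => i _.
  by rewrite mxE mulr1.
apply: (iffP idP) => [ind w wV w1|ind].
  apply: (row_free_inj ind); rewrite mul0mx mul_mx_row wV sumE w1.
  by rewrite -scalemx1 scale0r row_mx0.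
apply: inj_row_free => w; rewrite mul_mx_row => /eqP.
rewrite row_mx_eq0 sumE => /andP[/eqP wV /eqP/matrixP/(_ 0 0)].
by rewrite !mxE => w1; apply: ind.
Qed.

End AffineDimension.

Section CubeDimension.
Variables (R : realType) (n d : nat) (A : bool -> 'M[R]_n) (b : bool -> 'I_n ->
  R).
Variable v : {ffun 'I_n -> bool} -> 'rV[R]_n.
Variable L : 'M[R]_(n, d).
Hypothesis cubeA : cubical_system A b v.

Lemma lhs_mul k (w : 'rV[R]_k) (X : 'M[R]_(k, n)) a i :
  lhs A (w *m X) a i = \sum_j w 0 j * lhs A (row j X) a i.
Proof.
rewrite /lhs -mulmxA mxE; apply: eq_bigr => j _; congr (_ * _).
by rewrite !mxE; apply: eq_bigr => l _; rewrite !mxE.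
Qed.

Lemma lhs_eq0 (x : 'rV[R]_n) (s : {ffun 'I_n -> bool}) :
  (forall i, lhs A x (s i) i = 0) -> x = 0.
Proof.
move=> x0; have [u _ _] := cubeA.
have : x *m (mixed A s)^T = 0.
  apply/rowP => i; rewrite [RHS]mxE -[RHS](x0 i) /lhs !mxE.
  by apply: eq_bigr => j _; rewrite !mxE.
move=> /(congr1 (mulmx^~ (invmx (mixed A s)^T))).
by rewrite mul0mx mulmxK // unitmx_tr.
Qed.

(** The hypothesis says that no nonzero direction of the face [t] is projected to 0. A vertex with
    its neighbours along the zero entries of [t] gives the lower bound. *)
Lemma affdim_pface (t : sgnvec n) :
  (forall x, x *m L = 0 -> (forall i a, t i = Some a -> lhs A x a i = 0) ->
    x = 0) ->
  affdim (pface A b L t) = #|~: supp t|%:Z.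
Proof.
move=> inj; set Z := (~: supp t)%SET.
have tZ i : i \in Z -> t i = None.
  by rewrite finset.in_setC inE negbK => /eqP.
have -> : #|Z|%:Z = #|Z|.+1%:Z - 1 by rewrite -addn1 PoszD addrK.
apply: affdim_eq.
  pose s := fill t.
  pose X : 'M[R]_(#|Z|.+1, n) := \matrix_k
    (if unlift ord0 k is Some j then v (flip s (enum_val j)) else v s).
  have X0 : row ord0 X = v s by rewrite rowK unlift_none.
  have XS j : row (lift ord0 j) X = v (flip s (enum_val j)).
    by rewrite rowK liftK.
  have Xface k : cface A b t (row k X).
    case: (unliftP ord0 k) => [j|] ->; rewrite ?X0 ?XS;
      apply/(cface_vertex cubeA).
      by apply: refines_flip (refines_fill _) _; apply/tZ/enum_valP.
    exact: refines_fill.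
  exists (X *m L); split=> [|k]; last first.
    by exists (row k X) => //; rewrite row_mul.
  apply/affinely_independentP => w; rewrite mulmxA => wXL w1.
  have wX : w *m X = 0.
    apply: inj => // i a ti; rewrite lhs_mul.
    rewrite (eq_bigr (fun k => w 0 k * b a i)) => [|k _].
      by rewrite -mulr_suml w1 mul0r.
    by have [_ ->] := Xface k.
  have wS j : w 0 (lift ord0 j) = 0.
    pose i := enum_val j.
    have : \sum_k w 0 k * (lhs A (row k X) (s i) i - b (s i) i) = 0.
      rewrite (eq_bigr (fun k => w 0 k * lhs A (row k X) (s i) i -
        w 0 k * b (s i) i)) => [|k _]; last by rewrite mulrBr.
      rewrite sumrB -lhs_mul wX -mulr_suml w1 mul0r subr0.
      by rewrite /lhs mul0mx mxE.
    rewrite big_ord_recl X0 (lhs_vertex cubeA) subrr mulr0 add0r (bigD1 j) //=.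
    rewrite big1 ?addr0 => [/eqP|j' j'j].
      rewrite XS mulf_eq0 subr_eq0 (lt_eqF (lhs_flip_lt cubeA _ _)) orbF.
      by move=> /eqP.
    by rewrite XS (lhs_flip cubeA) ?subrr ?mulr0 // (inj_eq enum_val_inj)
      eq_sym.
  apply/rowP => k; rewrite mxE; case: (unliftP ord0 k) => [j|] -> //.
  by move: w1; rewrite big_ord_recl big1 ?addr0.
move=> j V /affinely_independentP ind Vt.
have /choice [x xP] : forall k, exists x, cface A b t x /\ x *m L = row k V.
  by move=> k; have [x xt xV] := Vt k; exists x.
pose X := \matrix_k x k; pose s := fill t.
have VX : V = X *m L.
  by apply/row_matrixP => k; rewrite row_mul rowK; case: (xP k).
(* A point of the face is determined by the left-hand sides with labels in [Z], so independence
   passes to [Y], whose number of columns bounds [j]. *)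
pose Y : 'M[R]_(j, #|Z|) :=
  \matrix_(k, l) lhs A (x k) (s (enum_val l)) (enum_val l).
have : affinely_independent Y.
  apply/affinely_independentP => w wY w1; apply: ind => //; rewrite VX mulmxA.
  suff -> : w *m X = 0 by rewrite mul0mx.
  apply: (lhs_eq0 (s := s)) => i; rewrite lhs_mul.
  have [iZ|iZ] := boolP (i \in Z).
    have /rowP/(_ (enum_rank_in iZ i)) := wY; rewrite !mxE => wYi.
    rewrite -[RHS]wYi; apply: eq_bigr => k _.
    by rewrite rowK mxE enum_rankK_in.
  have ti : t i = Some (s i).
    move: iZ; rewrite finset.in_setC inE negbK ffunE.
    by case: (t i).
  rewrite (eq_bigr (fun k => w 0 k * b (s i) i)) => [|k _].
    by rewrite -mulr_suml w1 mul0r.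
  by rewrite rowK; case: (xP k) => [[_ ->]].
rewrite /affinely_independent /row_free => /eqP rk.
by have := rank_leq_col (row_mx Y (const_mx 1 : 'cV[R]_j)); rewrite rk addn1.
Qed.

(** An affine functional vanishing on all projected vertices does not change along edges, which
    kills its multipliers one by one; so the projected vertices span affinely. *)
Lemma affdim_pface_zero : (forall c : 'cV[R]_d, L *m c = 0 -> c = 0) ->
  affdim (pface A b L zero_sgn) = d%:Z.
Proof.
move=> Linj; have -> : d%:Z = (d + 1)%N%:Z - 1 by rewrite PoszD addrK.
apply: affdim_eq; last first.
  by move=> j V; rewrite /affinely_independent /row_free => /eqP rk _;
    rewrite -rk rank_leq_col.
have [u _ _] := cubeA.
pose W : 'M[R]_(#|{ffun 'I_n -> bool}|, n) := \matrix_k v (enum_val k).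
pose Y := row_mx (W *m L) (const_mx 1 : 'cV[R]_#|{ffun 'I_n -> bool}|).
have fullY : row_full Y.
  rewrite /row_full -mxrank_tr -/(row_free _); apply: inj_row_free => z zY.
  pose c := usubmx z^T; pose e := dsubmx z^T 0 0.
  have zE s : (v s *m (L *m c)) 0 0 + e = 0.
    have /matrixP/(_ (enum_rank s) 0) : Y *m z^T = 0.
      by rewrite -[LHS]trmxK trmx_mul trmxK zY trmx0.
    rewrite -{1}(vsubmxK z^T) mul_row_col mxE [RHS]mxE => <-; congr (_ + _).
      rewrite -mulmxA !mxE; apply: eq_bigr => i _.
      by congr (_ * _); rewrite mxE enum_rankK.
    by rewrite mxE big_ord1 mxE mul1r.
  have Lc : L *m c = 0.
    pose s : {ffun 'I_n -> bool} := [ffun=> false].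
    have [m cm] := mixed_decomp cubeA (L *m c) s.
    have m0 : m = 0.
      apply/rowP => i; rewrite mxE.
      have /eqP := etrans (zE (flip s i)) (esym (zE s)).
      rewrite (inj_eq (addIr e)) !(mixed_eval _ cm) -subr_eq0 -sumrB (bigD1 i)
        //=.
      rewrite big1 ?addr0 => [|j ji]; last first.
        by rewrite (lhs_flip cubeA) // (lhs_vertex cubeA) subrr.
      rewrite -mulrBr mulf_eq0 (lhs_vertex cubeA) subr_eq0.
      by rewrite (lt_eqF (lhs_flip_lt cubeA _ _)) orbF => /eqP.
    by apply: trmx_inj; rewrite cm m0 mul0mx trmx0.
  apply: trmx_inj; rewrite trmx0 -(vsubmxK z^T) -/c (Linj _ Lc).
  have -> : dsubmx z^T = 0.
    have := zE [ffun=> false]; rewrite Lc mulmx0 mxE add0r => e0.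
    by rewrite [LHS]mx11_scalar -/e e0 -scalemx1 scale0r.
  by rewrite col_mx0.
exists (rowsub (fullrankfun fullY) (W *m L)); split=> [|k].
  rewrite /affinely_independent.
  have -> : row_mx (rowsub (fullrankfun fullY) (W *m L)) (const_mx 1) =
      rowsub (fullrankfun fullY) Y.
    apply/matrixP => i j; rewrite !mxE; case: splitP => j' _; rewrite ?mxE //.
  exact: fullrowsub_free.
rewrite row_rowsub row_mul rowK;
  exists (v (enum_val (fullrankfun fullY k))) => //.
exact/(cface_vertex cubeA)/refines_zero.
Qed.

End CubeDimension.

(** * The standard cube as a cubical system *)

Section StandardCube.
Variables (R : realType) (n : nat).

Definition stdA (a : bool) : 'M[R]_n := ((-1) ^+ a)%:M.
Definition stdb (a : bool) (i : 'I_n) : R := (~~ a)%:R.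
Definition stdv (s : {ffun 'I_n -> bool}) : 'rV[R]_n := \row_i (~~ s i)%:R.

Lemma std_lhs (x : 'rV[R]_n) a i : lhs stdA x a i = (-1) ^+ a * x 0 i.
Proof. by rewrite /lhs /stdA tr_scalar_mx mul_mx_scalar mxE. Qed.

Lemma std_cubical : cubical_system stdA stdb stdv.
Proof.
split=> [s|s a i|s a i].
- suff e : mixed stdA s *m mixed stdA s = 1%:M by case: (mulmx1_unit e).
  have -> : mixed stdA s = diag_mx (\row_i (-1) ^+ s i).
    by apply/matrixP => i j; rewrite !mxE; case: eqP => [->|].
  rewrite mulmx_diag; apply/matrixP => i j; rewrite !mxE -signr_addb addbb.
  by [].
- rewrite -/(lhs stdA _ a i) std_lhs mxE /stdb.
  by case: a (s i) => [] [] /=;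
    rewrite ?expr1 ?expr0 ?mulr0 ?mulr1 ?mul1r ?oppr_le0.
- rewrite std_lhs mxE /stdb.
  case: a (s i) => [] [] /=;
    rewrite ?expr1 ?expr0 ?mulr0 ?mulr1 ?mul1r ?eqxx //.
    by rewrite oppr_eq0 oner_eq0.
  by rewrite eq_sym oner_eq0.
Qed.

Lemma std_solutions : solutions stdA stdb = @cube R n.
Proof.
have sol (x : 'rV[R]_n) a i : (x *m (stdA a)^T) 0 i <= stdb a i <->
    (if a then 0 <= x 0 i else x 0 i <= 1).
  rewrite -/(lhs stdA x a i) std_lhs /stdb.
  by case: a; rewrite /= ?expr1 ?expr0 ?mul1r ?mulN1r ?oppr_le0.
rewrite eqEsubset; split=> x xC.
  by move=> i; have /sol /= -> := xC true i; have /sol := xC false i.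
by move=> a i; apply/sol; have /andP[] := xC i; case: a.
Qed.

Definition std_face := pface stdA stdb (1%:M : 'M[R]_n).

Lemma std_good t : good stdA (1%:M : 'M[R]_n) t.
Proof.
pose m : 'rV[R]_n := \row_i (i \in supp t)%:R.
exists (m *m mixed stdA (fill t))^T, m; split=> [|i iS|i iS].
- by rewrite mul1mx trmxK.
- by rewrite mxE iS.
- by rewrite mxE (negPf iS).
Qed.

Lemma face_cube F : face (@cube R n) F <->
  F = set0 \/ exists t, F = std_face t.
Proof.
have -> : @cube R n = std_face zero_sgn.
  rewrite /std_face pface_zero std_solutions.
  by rewrite eqEsubset; split=> [x xC|_ [x xC <-]]; [exists x|];
    rewrite ?mulmx1.
rewrite (face_pface std_cubical (std_good _)).
split=> -[->|]; [by left| |by left|].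
  by move=> [t _ ->]; right; exists t.
move=> [t ->]; right; exists t => //.
by split; [exact: refines_zero|exact: std_good].
Qed.

Lemma std_face_subset t t' : std_face t `<=` std_face t' <-> refines t' t.
Proof. exact/(pface_subset std_cubical)/std_good. Qed.

Lemma std_face_nonempty t : std_face t !=set0.
Proof. exact: (pface_nonempty _ std_cubical). Qed.

Lemma affdim_std_face t : affdim (std_face t) = #|~: supp t|%:Z.
Proof. by apply: (affdim_pface std_cubical) => x; rewrite mulmx1. Qed.

End StandardCube.

Section CubeFaces.
Variables (R : realType) (n d : nat) (A : bool -> 'M[R]_n) (b : bool -> 'I_n ->
  R).
Variable v : {ffun 'I_n -> bool} -> 'rV[R]_n.
Variable L : 'M[R]_(n, d).
Hypothesis cubeA : cubical_system A b v.

Definition oface T (f : sgnvec n -> set T) (o : option (sgnvec n)) : set T :=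
  if o is Some t then f t else set0.

(** The nonempty faces below [t] are all its refinements, and these are the sign vectors on the zero
    entries of [t]. The index [None] stands for the empty face. *)
Lemma comb_cube_pface t :
  (forall t', refines t t' -> good A L t') -> comb_cube (pface A b L t).
Proof.
move=> gt; set Z := (~: supp t)%SET; exists #|Z|.
have tZ i : i \in Z -> t i = None by rewrite finset.in_setC inE negbK => /eqP.
pose restr (u : sgnvec n) : sgnvec #|Z| := [ffun j => u (enum_val j)].
have restr_refines u u' : refines t u -> refines t u' ->
    refines (restr u) (restr u') = refines u u'.
  move=> /refinesP tu /refinesP tu'; apply/refinesP/refinesP => h i a;
    last first.
    by rewrite !ffunE; apply: h.
  case ti: (t i) => [c|]; first by rewrite (tu _ _ ti) (tu' _ _ ti).
  have iZ : i \in Z by rewrite finset.in_setC inE ti.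
  by have := h (enum_rank_in iZ i) a; rewrite !ffunE enum_rankK_in.
apply: (@indexed_inclusion_iso _ _ _
  [set o | if o is Some u then refines t u else true] _ _
  (oface (pface A b L))
  (fun o => if o is Some u then std_face (restr u) else set0)).
- move=> F; rewrite (face_pface cubeA (gt _ (refines_refl t))); split.
    by move=> [->|[u [tu gu] ->]]; [exists None|exists (Some u)].
  move=> [[u|] /= tu <-]; last by left.
  by right; exists u => //; split=> //; apply: gt.
- move=> F; rewrite face_cube; split; last first.
    by move=> [[u|] /= tu <-]; [right; exists (restr u)|left].
  move=> [->|[w ->]]; first by exists None.
  pose u : sgnvec n := [ffun i => if t i is Some a then Some a else
    if i \in Z =P true is ReflectT iZ then w (enum_rank_in iZ i) else None].
  exists (Some u) => /=; first by apply/refinesP => i a ti; rewrite ffunE ti.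
  congr std_face; apply/ffunP => j; rewrite !ffunE tZ ?enum_valP //.
  case: eqP => [iZ|]; last by rewrite enum_valP.
  by rewrite enum_valK_in.
- move=> [u|] [u'|] /= tu tu'.
  + rewrite (pface_subset cubeA _ (gt _ tu')) std_face_subset.
    by rewrite restr_refines.
  + split=> H; exfalso.
      by have [x /H] := pface_nonempty L cubeA u.
    by have [x /H] := std_face_nonempty R (restr u).
  + by split=> _; apply: sub0set.
  + by split=> _; apply: sub0set.
Qed.

(** Injectivity of [L] can be expected on proper faces only. The bounds on [k] keep [zero_sgn], the
    whole polytope, out of both skeleta, so dimension is the number of zeros throughout. *)
Lemma skeleton_pface k :
  (forall t, good A L t -> t != zero_sgn ->
     forall x, x *m L = 0 -> (forall i a, t i = Some a -> lhs A x a i = 0) ->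
       x = 0) ->
  -1 <= k -> k < affdim (pface A b L zero_sgn) -> k < n%:Z ->
  (forall t : sgnvec n, #|~: supp t|%:Z <= k -> good A L t) ->
  inclusion_iso (skeleton k (pface A b L zero_sgn)) (skeleton k (@cube R n)).
Proof.
move=> inj k_ge kP kn gk.
have dimP t : good A L t -> t != zero_sgn ->
    affdim (pface A b L t) = #|~: supp t|%:Z.
  by move=> gt t0; apply: (affdim_pface cubeA); apply: inj.
have nz (t : sgnvec n) : #|~: supp t|%:Z <= k -> t != zero_sgn.
  apply: contraTneq => ->; rewrite -ltNge.
  suff -> : (~: supp (@zero_sgn n))%SET = [set:
    'I_n]%SET by rewrite finset.cardsT card_ord.
  by apply/setP => i; rewrite finset.in_setC inE ffunE finset.in_setT.
apply: (@indexed_inclusion_iso _ _ _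
  [set o | if o is Some t then #|~: supp t|%:Z <= k else true] _ _
  (oface (pface A b L)) (oface (@std_face R n))).
- move=> F; split=> [[/(face_pface cubeA (zero_good A L))]|].
    move=> [-> _|[t [_ gt] ->] dimt]; first by exists None.
    have t0 : t != zero_sgn.
      by apply/eqP => t0; move: dimt; rewrite t0 leNgt kP.
    by exists (Some t); first by rewrite (dimP t gt t0) in dimt.
  move=> [[t|] /= tk <-]; split.
  + apply/(face_pface cubeA (zero_good A L)); right; exists t => //.
    by split; [apply: refines_zero|apply: gk].
  + by rewrite dimP ?nz //; apply: gk.
  + by apply/(face_pface cubeA (zero_good A L)); left.
  + by rewrite affdim_set0.
- move=> F; split=> [[/face_cube]|].
    move=> [-> _|[t ->]]; first by exists None.
    by rewrite affdim_std_face => tk; exists (Some t).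
  move=> [[t|] /= tk <-]; split.
  + by apply/face_cube; right; exists t.
  + by rewrite affdim_std_face.
  + by apply/face_cube; left.
  + by rewrite affdim_set0.
- move=> [u|] [u'|] /= tu tu'.
  + by rewrite (pface_subset cubeA _ (gk _ tu')) std_face_subset.
  + split=> H; exfalso.
      by have [x /H] := pface_nonempty L cubeA u.
    by have [x /H] := std_face_nonempty R u.
  + by split=> _; apply: sub0set.
  + by split=> _; apply: sub0set.
Qed.

End CubeFaces.

(** * Automorphisms of the graph of the cube *)

Section SignedPermutation.
Variables (n : nat) (K K' : sgnvec n -> Prop) (g : sgnvec n -> sgnvec n).

Definition edge (s : {ffun 'I_n -> bool}) i : sgnvec n :=
  [ffun j => if j == i then None else Some (s j)].

Hypothesis K_full : forall s, K (full s).
Hypothesis K_edge : forall s i, K (edge s i).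
Hypothesis K'_full : forall s, K' (full s).
Hypothesis gK : forall t, K t -> K' (g t).
Hypothesis g_surj : forall t', K' t' -> exists2 t, K t & g t = t'.
Hypothesis g_refines : forall t u, K t -> K u ->
  refines (g t) (g u) = refines t u.

Lemma full_inj : injective (@full n).
Proof.
by move=> s s' /ffunP e; apply/ffunP => i; have := e i; rewrite !ffunE => -[].
Qed.

Lemma refines_fullE (s : {ffun 'I_n -> bool}) u : refines (full s) u ->
  u = full s.
Proof.
by move=> /refinesP su; apply/ffunP => i; rewrite (su i (s i)) ?ffunE.
Qed.

Lemma flipK (s : {ffun 'I_n -> bool}) i : flip (flip s i) i = s.
Proof. by apply/ffunP => j; rewrite !ffunE; case: eqP => // _;
  rewrite negbK. Qed.

Lemma flip_neq (s : {ffun 'I_n -> bool}) i : flip s i != s.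
Proof.
by apply/eqP => /ffunP/(_ i); rewrite ffunE eqxx; case: (s i).
Qed.

Let phi s := fill (g (full s)).

Let g_inj t u : K t -> K u -> g t = g u -> t = u.
Proof.
move=> Kt Ku e; apply: refines_anti; rewrite -g_refines // e;
  exact: refines_refl.
Qed.

Let g_full s : g (full s) = full (phi s).
Proof.
have [u Ku gu] := g_surj (K'_full (phi s)).
have /refines_fullE us : refines (full s) u.
  by rewrite -g_refines // gu refines_fill.
by rewrite -gu us.
Qed.

Let phi_inj : injective phi.
Proof.
move=> s s' e; apply: full_inj; apply: g_inj => //.
by rewrite !g_full e.
Qed.

Let phi_surj s' : exists s, phi s = s'.
Proof. by have [f _ fK] := injF_bij phi_inj; exists (f s'). Qed.

Let g_refines_full t s : K t -> refines (g t) (full (phi s)) = refines t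
  (full s).
Proof. by move=> Kt; rewrite -g_full g_refines. Qed.

(* The edge joining [s] to [flip s i] has no other vertices, so neither has
   its image, and the image is an edge. *)
Let phi_adj s i : exists j, phi (flip s i) = flip (phi s) j.
Proof.
have e_full r : refines (edge s i) (full r) -> r = s \/ r = flip s i.
  move=> /refines_full er.
  have rE j : j != i -> r j = s j by move=> /negPf ji; apply: er;
    rewrite ffunE ji.
  have [ri|ri] := eqVneq (r i) (s i); [left|right]; apply/ffunP => j.
    by have [->|/rE] := eqVneq j i.
  rewrite ffunE; case: eqP => [->|/eqP /rE //].
  by move: ri; case: (r i) (s i) => [] [].
have es : refines (edge s i) (full s).
  by apply/refines_full => j a; rewrite ffunE; case: eqP => // _ [].
have ei : edge s i i = None by rewrite ffunE eqxx.
have es' := refines_flip es ei.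
have [j] : exists j, phi (flip s i) j != phi s j.
  apply/existsP; rewrite -negb_forall;
    apply: contra (flip_neq s i) => /forallP e.
  by apply/eqP/phi_inj/ffunP => j; apply/eqP.
move=> ne; have gj : g (edge s i) j = None.
  case gj: (g (edge s i) j) => [a|//]; move: ne.
  have := es; have := es'; rewrite -g_refines_full // => /refines_full h'.
  by rewrite -g_refines_full // => /refines_full h;
    rewrite (h _ _ gj) (h' _ _ gj) eqxx.
have [r rE] := phi_surj (flip (phi s) j); exists j.
have /e_full [rs|<- //] : refines (edge s i) (full r).
  by rewrite -g_refines_full // rE; apply: refines_flip => //;
    rewrite g_refines_full.
by have := flip_neq (phi s) j; rewrite -rE rs eqxx.
Qed.

Definition signed_perm (pi : {perm 'I_n}) (z : {ffun 'I_n -> bool})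
    (t : sgnvec n) : sgnvec n :=
  [ffun j => omap (addb (z j)) (t ((pi^-1)%g j))].

(** [z] is the image of the all-[false] vertex and [pi] records where its edges go; the other
    vertices follow by induction on the number of [true] entries. *)
Lemma hypercube_automorphism : exists (pi : {perm 'I_n}) (z : {ffun 'I_n ->
  bool}),
  forall s, phi s = [ffun j => z j (+) s ((pi^-1)%g j)].
Proof.
pose s0 : {ffun 'I_n -> bool} := [ffun=> false]; pose z := phi s0.
have [p pP] := choice (phi_adj s0).
have p_inj : injective p.
  move=> i j pij; have : flip s0 i = flip s0 j by apply: phi_inj;
    rewrite !pP pij.
  by move=> /ffunP/(_ i); rewrite !ffunE eqxx; case: eqP.
pose pi := perm p_inj; exists pi, z.
pose act (s : {ffun 'I_n -> bool}) : {ffun 'I_n -> bool} :=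
  [ffun j => z j (+) s ((pi^-1)%g j)].
have piE i : pi i = p i by rewrite permE.
have act_flip s i : act (flip s i) = flip (act s) (p i).
  apply/ffunP => j; rewrite !ffunE -piE.
  have -> : ((pi^-1)%g j == i) = (j == pi i).
    by apply/eqP/eqP => [<-|->]; rewrite ?permKV ?permK.
  by case: eqP; rewrite // addbN.
have act0 : act s0 = phi s0 by apply/ffunP => j; rewrite !ffunE addbF.
suff H m (s : {ffun 'I_n -> bool}) : (#|[set i | s i]%SET| < m)%N ->
  phi s = act s.
  by move=> s; apply: (H _.+1); apply: ltnSn.
elim: m s => // m IH s; rewrite ltnS => sm.
have flip_card i : s i -> phi (flip s i) = act (flip s i).
  move=> si; apply: IH; apply: (leq_trans _ sm).
  apply: proper_card; apply/properP; split.
    by apply/fintype.subsetP => j; rewrite !inE ffunE; case: eqP => [->|].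
  by exists i; rewrite !inE // ffunE eqxx si.
have [/eqP|] := eqVneq #|[set i | s i]%SET| 0%N.
  rewrite finset.cards_eq0 => /eqP /setP s_eq0.
  have -> : s = s0; last by rewrite act0.
  by apply/ffunP => i; have := s_eq0 i; rewrite !inE ffunE.
rewrite -lt0n card_gt0 => /finset.set0Pn [i]; rewrite inE => si.
have [/forallP all_i|/forallPn [k]] := boolP [forall k, s k ==> (k == i)].
  have -> : s = flip s0 i.
    apply/ffunP => k; rewrite !ffunE; have := all_i k.
    by case: eqP => [->|] //=; case: (s k).
  by rewrite pP act_flip act0.
rewrite negb_imply => /andP[sk ki].
(* [phi s] is a common neighbour of the known images of [flip s i] and [flip s k]. There are two:
   one is the image of [s] flipped at both, excluded by injectivity, the other is [act s]. *)
have [a ea] := phi_adj (flip s i) i; have [c ec] := phi_adj (flip s k) k.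
rewrite flipK flip_card // act_flip in ea.
rewrite flipK flip_card // act_flip in ec.
have ski : flip s i k by rewrite ffunE (negPf ki).
have a_pk : a != p k.
  apply/eqP => ak; have : phi s = phi (flip (flip s i) k).
    rewrite ea IH ?act_flip ?ak //.
    apply: (leq_trans _ sm).
    apply: proper_card; apply/properP; split.
      apply/fintype.subsetP => j; rewrite !inE !ffunE.
      by case: eqP => [->|_] //; case: eqP => [->|].
    by exists i; rewrite !inE // !ffunE eqxx si eq_sym (negPf ki).
  move=> /phi_inj /ffunP/(_ i); rewrite !ffunE eqxx eq_sym (negPf ki).
  by case: (s i).
have pik : p i != p k by rewrite (inj_eq p_inj) eq_sym.
have [a_pi|a_pi] := eqVneq a (p i); first by rewrite ea a_pi flipK.
have /ffunP := etrans (esym ea) ec; move: (act s) => X e.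
have := e (p i); have := e a; rewrite !ffunE !eqxx.
rewrite (negPf a_pi) (negPf a_pk) (negPf pik) [p i == a]eq_sym (negPf a_pi).
case: (eqVneq a c) => [<-|_]; last by case: (X a).
by rewrite [p i == a]eq_sym (negPf a_pi); case: (X (p i)).
Qed.

Lemma refines_signed_perm pi z t (s : {ffun 'I_n -> bool}) :
  refines (signed_perm pi z t) (full [ffun j => z j (+) s ((pi^-1)%g j)])
    = refines t (full s).
Proof.
apply/refines_full/refines_full => h i a; last first.
  rewrite !ffunE; case ti: (t _) => [c|//] [<-].
  by rewrite (h _ _ ti).
move=> ti; have := h (pi i) (z (pi i) (+) a); rewrite !ffunE permK ti.
by move=> /(_ erefl) /addbI.
Qed.

Lemma signed_perm_inj pi z : injective (signed_perm pi z).
Proof.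
move=> t u /ffunP e; apply/ffunP => i; have := e (pi i); rewrite !ffunE permK.
by case: (t i) (u i) => [a|] [c|] //= [/addbI ->].
Qed.

(** A sign vector is determined by the full vectors refining it, so the signed permutation of
    vertices describes [g] on all of [K]. *)
Lemma sgnvec_iso_signed_perm : exists pi z, forall t, K t <->
  K' (signed_perm pi z t).
Proof.
have [pi [z phiE]] := hypercube_automorphism; exists pi, z.
have gE t : K t -> g t = signed_perm pi z t.
  move=> Kt; apply: refines_anti; apply: refines_by_full => s';
    have [s <-] := phi_surj s';
      by rewrite g_refines_full // phiE refines_signed_perm.
move=> t; split=> [Kt|]; first by rewrite -gE //; apply: gK.
by move=> /g_surj [u Ku]; rewrite gE // => /signed_perm_inj <-.
Qed.

End SignedPermutation.

(* A minimal coface containing [i0] is a circuit: if reversing its vector at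
   [i0] gave a coface too, then adding the two dependencies would eliminate
   [i0], and subtracting the result would shrink the coface. *)
Lemma coface_reverse (R : realFieldType) p r (M M' : 'M[R]_(p, r)) i0
    (T0 : {set 'I_p}) :
  row i0 M' = - row i0 M -> (forall i, i != i0 -> row i M' = row i M) ->
  row i0 M != 0 -> i0 \in T0 -> coface M T0 ->
  exists T : {set 'I_p}, [/\ T \subset T0, i0 \in T,
    coface M T & ~ coface M' T].
Proof.
move=> M'i0 M'i Mi0 i0T0 cT0.
pose P (T : {set 'I_p}) := [&& T \subset T0, i0 \in T & `[< coface M T >]].
have PT0 : P T0 by rewrite /P i0T0 subxx; apply/asboolP.
case: (@arg_minnP _ T0 P (fun T => #|T|) PT0) =>
  T /and3P[TT0 i0T /asboolP cT] Tmin.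
exists T; split=> // cT'.
have [l [lM l_gt0 l_eq0]] := cT; have [l' [lM' l'_gt0 l'_eq0]] := cT'.
have l0 := l_gt0 _ i0T; have l'0 := l'_gt0 _ i0T.
have split_mul (w : 'rV[R]_p) (N : 'M[R]_(p, r)) :
    w *m N = w 0 i0 *: row i0 N + \sum_(i | i != i0) w 0 i *: row i N.
  by rewrite mulmx_sum_row (bigD1 i0).
pose mu : 'rV[R]_p := \row_i (if i == i0 then 0 else l' 0 i0 * l 0 i + l 0 i0 *
  l' 0 i).
have muM : mu *m M = 0.
  move: lM lM'; rewrite !split_mul M'i0 => /eqP; rewrite addr_eq0 => /eqP e1.
  rewrite scalerN => /eqP; rewrite addrC subr_eq0 => /eqP e2.
  rewrite mxE eqxx scale0r add0r.
  rewrite (eq_bigr (fun i => l' 0 i0 *: (l 0 i *: row i M) +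
      l 0 i0 *: (l' 0 i *: row i M'))) => [|i ii0]; last first.
    by rewrite mxE (negPf ii0) M'i // scalerDl !scalerA.
  rewrite big_split /= -!scaler_sumr e2 -[X in _ *: X + _]opprK -e1.
  by rewrite scalerN !scalerA mulrC addNr.
have mu_gt0 i : i \in T -> i != i0 -> 0 < mu 0 i.
  by move=> iT ii0; rewrite mxE (negPf ii0) addr_gt0 // mulr_gt0 ?l_gt0 ?l'_gt0.
have mu_eq0 i : i \notin T -> mu 0 i = 0.
  by move=> iT; rewrite mxE (l_eq0 _ iT) (l'_eq0 _ iT) !mulr0 addr0 if_same.
have [j jP] : exists j, (j \in T) && (j != i0).
  case: (pickP [pred j | (j \in T) && (j != i0)]) => [j|Tsub];
    first by exists j.
  move: lM; rewrite split_mul big1 ?addr0 => [/eqP|i ii0].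
    by rewrite scaler_eq0 (negPf Mi0) orbF gt_eqF.
  have iT : i \notin T by move: (Tsub i); rewrite /= ii0 andbT => ->.
  by rewrite l_eq0 ?scale0r.
(* The least ratio is the largest multiple of [mu] that [l] can lose while staying nonnegative. Its
   index [k] leaves the support, and [i0] stays because [mu] is 0 there. *)
pose ratio i := l 0 i / mu 0 i.
case: (@Order.TotalTheory.arg_minP _ _ _ j (fun i => (i \in T) &&
  (i != i0)) ratio jP)
  => k /andP[kT ki0] kmin.
have muk := mu_gt0 _ kT ki0.
pose l2 := l - ratio k *: mu.
have l2E i : l2 0 i = l 0 i - ratio k * mu 0 i.
  by rewrite /l2 mxE [X in _ + X]mxE [X in _ - X]mxE.
have mu0 : mu 0 i0 = 0 by rewrite mxE eqxx.
have l2k : l2 0 k = 0 by rewrite l2E /ratio divfK ?gt_eqF ?subrr.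
have l2_eq0 i : i \notin T -> l2 0 i = 0.
  by move=> iT; rewrite l2E mu_eq0 // l_eq0 // mulr0 subr0.
have l2_ge0 i : 0 <= l2 0 i.
  have [iT|/l2_eq0 -> //] := boolP (i \in T).
  have [->|ii0] := eqVneq i i0; first by rewrite l2E mu0 mulr0 subr0 ltW.
  rewrite l2E subr_ge0 -ler_pdivlMr ?mu_gt0 //.
  by apply: kmin; rewrite iT.
pose T2 := [set i | 0 < l2 0 i]%SET.
have T2T : T2 \subset T.
  apply/fintype.subsetP => i; rewrite inE; apply: contraTT => iT.
  by rewrite l2_eq0 ?ltxx.
have PT2 : P T2.
  apply/and3P; split; first exact: fintype.subset_trans T2T TT0.
    by rewrite inE l2E mu0 mulr0 subr0.
  apply/asboolP; exists l2; split=> [|i|i].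
  - by rewrite mulmxBl -scalemxAl muM lM scaler0 subr0.
  - by rewrite inE.
  - rewrite inE -leNgt => l2i; apply/eqP.
    by rewrite eq_le l2i l2_ge0.
have := Tmin _ PT2; rewrite leqNgt => /negP[]; apply: proper_card.
by apply/properP; split=> //; exists k; rewrite // inE l2k ltxx.
Qed.

Section CofaceTransfer.
Variables (R : realFieldType) (p r : nat).

(** Label [ord0] has no row in the Gale transform; label [lift ord0 j] belongs to row [j]. *)
Definition label_supp (t : sgnvec p.+1) : {set 'I_p} :=
  [set j | t (lift ord0 j) != None].

Definition sign_blind (K : sgnvec p.+1 -> Prop) (G : 'M[R]_(p, r)) :=
  forall t : sgnvec p.+1, t ord0 = None -> (K t <-> coface G (label_supp t)).

Definition reverse0 (t : sgnvec p.+1) : sgnvec p.+1 :=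
  [ffun i => if i == ord0 then omap negb (t i) else t i].

Lemma sign_blind_transfer (K K' : sgnvec p.+1 -> Prop) (G G' : 'M[R]_(p, r))
    (pi : {perm 'I_p.+1}) z :
  sign_blind K G -> sign_blind K' G' ->
  (forall k, k != ord0 -> exists t : sgnvec p.+1, [/\ t k = None,
    K' t & ~ K' (reverse0 t)]) ->
  (forall t, K t <-> K' (signed_perm pi z t)) ->
  exists2 h : 'I_p -> 'I_p, injective h &
    forall T, coface G T <-> coface G' (h @: T)%SET.
Proof.
move=> bK bK' distinguish KK'.
have pi0 : pi ord0 = ord0.
  (* A vector vanishing at [pi ord0] and its reversal pull back to vectors that vanish at [ord0] and
     have the same support, which [K] cannot distinguish. *)
  apply/eqP/negPn/negP => /distinguish [t' [t'k Kt' nKt']].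
  pose inv (u : sgnvec p.+1) : sgnvec p.+1 := [ffun i =>
    omap (addb (z (pi i))) (u (pi i))].
  have invK u : signed_perm pi z (inv u) = u.
    apply/ffunP => j; rewrite !ffunE permKV; case: (u j) => //= a.
    by rewrite addbA addbb.
  apply: nKt'; rewrite -[reverse0 _]invK; apply/KK'.
  have inv0 (u : sgnvec p.+1) : u (pi ord0) = None ->
    inv u ord0 = None by rewrite ffunE => ->.
  have r0 : reverse0 t' (pi ord0) = None by rewrite ffunE t'k if_same.
  apply/bK; first exact: inv0.
  suff -> : label_supp (inv (reverse0 t')) = label_supp (inv t').
    by apply/bK; [exact: inv0|apply/KK'; rewrite invK].
  apply/setP => j; rewrite !inE !ffunE.
  by case: ifP => _; case: (t' _).
have hP j : exists i, pi (lift ord0 j) = lift ord0 i.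
  case: (unliftP ord0 (pi (lift ord0 j))) => [i ->|]; first by exists i.
  by rewrite -{2}pi0 => /perm_inj /eqP; rewrite eq_sym (negPf (neq_lift _ _)).
have [h hE] := choice hP; exists h.
  move=> i j hij; apply: (@lift_inj _ ord0); apply: (@perm_inj _ pi).
  by rewrite !hE hij.
move=> T; pose t : sgnvec p.+1 :=
  [ffun i => if unlift ord0 i is Some j then
    (if j \in T then Some false else None) else None].
have t0 : t ord0 = None by rewrite ffunE unlift_none.
have tT : label_supp t = T.
  by apply/setP => j; rewrite inE ffunE liftK; case: (j \in T).
have piV0 : (pi^-1)%g ord0 = ord0 by rewrite -[X in _ X = _]pi0 permK.
have tpi0 : signed_perm pi z t ord0 = None by rewrite ffunE piV0 t0.
rewrite -[in X in X <-> _]tT -(bK _ t0) KK' (bK' _ tpi0).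
suff -> : label_supp (signed_perm pi z t) = (h @: T)%SET by [].
apply/setP => j; rewrite inE ffunE; apply/idP/imsetP => [|[i iT ->]];
  last first.
  by rewrite -hE permK ffunE liftK iT.
case: (unliftP ord0 ((pi^-1)%g (lift ord0 j))) => [i|] e; last by rewrite e t0.
rewrite e ffunE liftK; case: ifP => // iT _; exists i => //.
by apply: (@lift_inj _ ord0); rewrite -hE -e permKV.
Qed.

Lemma reverse0_distinguishes (K : sgnvec p.+1 -> Prop)
    (B : {ffun 'I_p.+1 -> bool} -> 'M[R]_(p.+1, r)) :
  (forall t, K t <-> coface (B (fill t)) (supp t)) ->
  (forall s, row ord0 (B s) != 0) ->
  (forall s, row ord0 (B (flip s ord0)) = - row ord0 (B s)) ->
  (forall (s s' : {ffun 'I_p.+1 -> bool}) i, s i = s' i ->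
    row i (B s) = row i (B s')) ->
  (forall s k, K (edge s k)) ->
  forall k, k != ord0 -> exists t : sgnvec p.+1, [/\ t k = None,
    K t & ~ K (reverse0 t)].
Proof.
move=> KB B0 Bflip Bloc Kedge k k0;
  pose s : {ffun 'I_p.+1 -> bool} := [ffun=> false].
have Bset (t : sgnvec p.+1) (t' : {ffun 'I_p.+1 ->
  bool}) (T : {set 'I_p.+1}) : (forall i, i \in T -> fill t i = t' i) ->
    coface (B (fill t)) T -> coface (B t') T.
  move=> tt' [l [lB l_gt0 l_eq0]]; exists l; split=> //;
    rewrite -lB !mulmx_sum_row.
  apply: eq_bigr => i _; have [iT|/l_eq0 ->] := boolP (i \in T).
    by rewrite (Bloc _ _ _ (tt' i iT)).
  by rewrite !scale0r.
(* The surviving edge in direction [k] supplies a coface that contains [ord0] and avoids [k], from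
   which a circuit is extracted. *)
have cT0 : coface (B s) (~: [set k])%SET.
  have /KB := Kedge s k.
  have -> : supp (edge s k) = (~: [set k])%SET.
    by apply/setP => i; rewrite finset.in_setC1 inE ffunE; case: (i == k).
  apply: Bset => i; rewrite finset.in_setC1 => /negPf ik.
  by rewrite [fill _ _]ffunE [edge _ _ _]ffunE ik.
have i0T : ord0 \in (~: [set k])%SET by rewrite finset.in_setC1 eq_sym.
have [|T [TT0 i0T' cT ncT]] := coface_reverse (Bflip s) _ (B0 s) i0T cT0.
  by move=> i ii0; apply: Bloc; rewrite ffunE (negPf ii0).
pose t : sgnvec p.+1 := [ffun i => if i \in T then Some (s i) else None].
have tT : supp t = T by apply/setP => i; rewrite inE ffunE; case: (i \in T).
have rtT : supp (reverse0 t) = T.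
  apply/setP => i; rewrite inE !ffunE.
  by case: (i == ord0); case: (i \in T).
exists t; split.
- rewrite ffunE; case: ifP => // kT.
  by have /fintype.subsetP/(_ k kT) := TT0; rewrite finset.in_setC1 eqxx.
- apply/KB; rewrite tT; have -> : fill t = s; last exact: cT.
  by apply/ffunP => i; rewrite !ffunE; case: ifP.
- move/KB; rewrite rtT; apply: contra_not ncT; apply: Bset => i iT.
  by rewrite !ffunE iT; case: (i == ord0).
Qed.

End CofaceTransfer.

Section PolytopeIso.
Variables (R : realType) (n d : nat).
Variables (A A' : bool -> 'M[R]_n) (b b' : bool -> 'I_n -> R).
Variables (v v' : {ffun 'I_n -> bool} -> 'rV[R]_n) (L L' : 'M[R]_(n, d)).
Hypotheses (cubeA : cubical_system A b v) (cubeA' : cubical_system A' b' v').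

Lemma comb_iso_signed_perm :
  (forall s, good A L (full s)) -> (forall s i, good A L (edge s i)) ->
  (forall s, good A' L' (full s)) ->
  comb_iso (pface A b L zero_sgn) (pface A' b' L' zero_sgn) ->
  exists pi z, forall t, good A L t <-> good A' L' (signed_perm pi z t).
Proof.
move=> gfull gedge gfull' [f [[fAB finj fsurj] fle]].
have faceP t : good A L t -> face (pface A b L zero_sgn) (pface A b L t).
  move=> gt; apply/(face_pface cubeA (zero_good A L)); right; exists t => //.
  by split=> //; apply: refines_zero.
have face0 : face (pface A b L zero_sgn) set0.
  by apply/(face_pface cubeA (zero_good A L)); left.
have f0 : f set0 = set0.
  have [|F FP fF] := fsurj set0.
    by apply/(face_pface cubeA' (zero_good A' L')); left.
  rewrite -subset0 -[X in _ `<=` X]fF;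
    exact: (fle _ _ face0 FP).1 (@sub0set _ F).
have /choice [g gP] : forall t, exists t', good A L t ->
    good A' L' t' /\ f (pface A b L t) = pface A' b' L' t'.
  move=> t; have [gt|ngt] := pselect (good A L t); last by exists t.
  have := fAB _ (faceP _ gt); move/(face_pface cubeA' (zero_good A' L')).
  move=> [ft0|[t' [_ gt'] ft']]; last by exists t'.
  have e : pface A b L t = set0.
    by apply: finj; [apply/mem_set/faceP|apply/mem_set|rewrite f0 ft0].
  by have [x] := pface_nonempty L cubeA t; rewrite e.
apply: (sgnvec_iso_signed_perm (g := g)) => //.
- by move=> t /gP[].
- move=> t' gt'; have [|F] := fsurj (pface A' b' L' t').
    apply/(face_pface cubeA' (zero_good A' L')); right; exists t' => //.
    by split=> //; apply: refines_zero.
  move=> /(face_pface cubeA (zero_good A L)) [->|[t [_ gt] ->]] e.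
    by have [x] := pface_nonempty L' cubeA' t'; rewrite -e f0.
  exists t => //; have [ggt ft] := gP t gt.
  by apply: (good_pface_inj cubeA' ggt gt'); rewrite -ft.
- move=> t u gt gu; have [ggt ft] := gP t gt; have [ggu fu] := gP u gu.
  apply/idP/idP => /[dup] H.
    move/(pface_subset cubeA' (g u) ggt); rewrite -ft -fu.
    by move/(fle _ _ (faceP _ gu) (faceP _ gt))/(pface_subset cubeA u gt).
  move/(pface_subset cubeA u gt)/(fle _ _ (faceP _ gu) (faceP _ gt)).
  by rewrite ft fu => /(pface_subset cubeA' (g u) ggt).
Qed.

End PolytopeIso.

(** * The deformed cube *)

Section LabelNormals.
Variables (R : realType) (p r : nat).
Implicit Types (G : 'M[R]_(p, r)) (s : {ffun 'I_p.+1 -> bool}).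

(* The truncations to the first [r] coordinates of the normal vectors of the
   deformed cube, with signs [s]. *)
Definition label_normals G (eps : R) s : 'M[R]_(p.+1, r) :=
  \matrix_(i, k) ((if unlift ord0 i is Some j then G j k else 0)
    + (-1) ^+ s i * eps * ((i : nat) == k)%:R).

(** Row [j] of [G] belongs to label index [j.+1], whence the shifted diagonal; from [j.+1 = r] on,
    the sign term is cut off by the truncation. *)
Definition sign_shift s : 'M[R]_(p, r) :=
  \matrix_(j, k) ((-1) ^+ s (lift ord0 j) * (j.+1 == k)%:R).

Lemma label_normals_lift G eps s :
  row' ord0 (label_normals G eps s) = G + eps *: sign_shift s.
Proof.
by apply/matrixP => j k; rewrite !mxE liftK /= mulrA [eps * _]mulrC.
Qed.

Lemma coface_lift (M : 'M[R]_(p.+1, r)) (T : {set 'I_p}) :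
  coface M (lift ord0 @: T)%SET <-> coface (row' ord0 M) T.
Proof.
have mulE (l : 'rV[R]_p.+1) : l 0 ord0 = 0 ->
    l *m M = (\row_j l 0 (lift ord0 j)) *m row' ord0 M.
  move=> l0; apply/rowP => k; rewrite !mxE big_ord_recl l0 mul0r add0r.
  by apply: eq_bigr => j _; rewrite !mxE.
have ord0_notin : ord0 \notin (lift ord0 @: T)%SET.
  by apply/imsetP => -[j _ /eqP]; rewrite (negPf (neq_lift _ _)).
split=> -[l [lM l_gt0 l_eq0]].
  exists (\row_j l 0 (lift ord0 j)); split=> [|j jT|j jT].
  - by rewrite -mulE // l_eq0.
  - by rewrite mxE l_gt0 // imset_f.
  - by rewrite mxE l_eq0 // (mem_imset _ _ (@lift_inj _ ord0)).
exists (\row_i if unlift ord0 i is Some j then l 0 j else 0); split.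
- rewrite mulE ?mxE ?unlift_none // -lM; congr (_ *m _).
  by apply/rowP => j; rewrite !mxE liftK.
- by move=> _ /imsetP[j jT ->]; rewrite mxE liftK l_gt0.
- move=> i; rewrite mxE; case: (unliftP ord0 i) => [j|] -> //.
  by rewrite (mem_imset _ _ (@lift_inj _ ord0)) => /l_eq0.
Qed.

Lemma pspanning_lift (M : 'M[R]_(p.+1, r)) (T : {set 'I_p}) :
  pspanning (row' ord0 M) T -> pspanning M (lift ord0 @: T)%SET.
Proof.
move=> pT y My; apply: pT => j jT.
have := My (lift ord0 j) (imset_f _ jT); rewrite !mxE.
by under [in X in _ -> X]eq_bigr => k _ do rewrite !mxE.
Qed.

Definition small_enough G eps := forall s,
  [/\ simplicial_config (G + eps *: sign_shift s),
      forall T, coface (G + eps *: sign_shift s) T <-> coface G T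
    & forall T, pspanning G T -> pspanning (G + eps *: sign_shift s) T].

Lemma small_enough_small G : simplicial_config G -> small (small_enough G).
Proof.
move=> sG; apply: (@small_all _ {ffun 'I_p.+1 -> bool}) => s.
exact: small_coface_perturb.
Qed.

Definition sign_good G eps (t : sgnvec p.+1) :=
  coface (label_normals G eps (fill t)) (supp t).

Lemma label_normals_local G eps (s s' : {ffun 'I_p.+1 -> bool}) i :
  s i = s' i -> row i (label_normals G eps s) = row i (label_normals G eps s').
Proof. by move=> ss'; apply/rowP => k; rewrite !mxE ss'. Qed.

Lemma sign_good_blind G eps : small_enough G eps ->
  sign_blind (sign_good G eps) G.
Proof.
move=> sG t t0; have [_ cG _] := sG (fill t); rewrite -cG -label_normals_lift.
rewrite -coface_lift /sign_good;
  suff -> : supp t = (lift ord0 @: label_supp t)%SET by [].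
apply/setP => i; rewrite inE; case: (unliftP ord0 i) => [j|] ->.
  by rewrite (mem_imset _ _ (@lift_inj _ ord0)) inE.
rewrite t0; apply/esym/imsetP => -[j _ /eqP].
by rewrite (negPf (neq_lift _ _)).
Qed.

(** Positive spanning, unlike being a coface, is monotone in the index set: [ord0] and further
    labels may be added with any signs. *)
Lemma sign_good_of_pspanning G eps (t : sgnvec p.+1) (T : {set 'I_p}) :
  small_enough G eps -> pspanning G T ->
  (forall j, j \in T -> t (lift ord0 j) != None) -> sign_good G eps t.
Proof.
move=> sG pT tT; have [_ _ pG] := sG (fill t).
apply/pspanning_coface/(@pspanningS _ _ _ _ (lift ord0 @: T)%SET); last first.
  by apply: pspanning_lift; rewrite label_normals_lift; apply: pG.
by apply/fintype.subsetP => _ /imsetP[j jT ->]; rewrite inE tT.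
Qed.

(** An edge omits at most one row of [G]. If its direction is [ord0] it omits none, and an arbitrary
    row [j0] may be dropped. *)
Lemma sign_good_edge G eps : (0 < p)%N -> small_enough G eps ->
  (forall j, pspanning G (~: [set j])%SET) -> forall s i,
    sign_good G eps (edge s i).
Proof.
move=> p0 sG vG s i; pose j0 : 'I_p := Ordinal p0.
pose j := if unlift ord0 i is Some j then j else j0.
apply: (sign_good_of_pspanning sG (vG j)) => k;
  rewrite finset.in_setC1 ffunE => kj.
by case: (eqVneq (lift ord0 k) i) => // ki; move: kj; rewrite /j -ki liftK eqxx.
Qed.

Lemma sign_good_full G eps : (0 < p)%N -> small_enough G eps ->
  (forall j, pspanning G (~: [set j])%SET) -> forall s,
    sign_good G eps (full s).
Proof.
move=> p0 sG vG s; apply: (sign_good_of_pspanning sG (vG (Ordinal p0))) => k _.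
by rewrite ffunE.
Qed.

Lemma sign_good_distinguishes G eps : (0 < r)%N -> (0 < p)%N -> eps != 0 ->
  small_enough G eps -> (forall j, pspanning G (~: [set j])%SET) ->
  forall k, k != ord0 -> exists t : sgnvec p.+1,
    [/\ t k = None, sign_good G eps t & ~ sign_good G eps (reverse0 t)].
Proof.
move=> r0 p0 eps0 sG vG;
  apply: (@reverse0_distinguishes _ _ _ _ (label_normals G eps)).
- by [].
- move=> s; apply/eqP => /rowP/(_ (Ordinal r0)); rewrite !mxE unlift_none add0r.
  by apply/eqP; rewrite eqxx mulr1 mulf_neq0 // signr_eq0.
- move=> s; apply/rowP => k; rewrite !mxE unlift_none !add0r ffunE eqxx signrN.
  by rewrite !mulNr.
- exact: label_normals_local.
- exact: sign_good_edge.
Qed.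

End LabelNormals.

Section TriangularSystem.
Variables (R : realType) (n : nat) (N : 'M[R]_n) (eps : R) (A : bool ->
  'M[R]_n).
Hypothesis N_lower : forall i k : 'I_n, (i <= k)%N -> N i k = 0.
Hypothesis AE : forall a, A a = N + ((-1) ^+ a * eps)%:M.

Lemma mixed_triangular s : mixed A s = N + diag_mx (\row_i ((-1) ^+ s i * eps)).
Proof.
apply/matrixP => i j; rewrite mxE AE mxE [RHS]mxE; congr (_ + _); rewrite !mxE.
by [].
Qed.

Lemma mixed_triangular_unit s : eps != 0 -> mixed A s \in unitmx.
Proof.
move=> eps0; have trig : is_trig_mx (mixed A s).
  apply/is_trig_mxP => i k ik.
  rewrite mixed_triangular mxE N_lower ?(ltnW ik) // add0r !mxE.
  by rewrite -(inj_eq val_inj) /= (ltn_eqF ik) mulr0n.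
rewrite unitmxE (det_trig trig) unitfE; apply/prodf_neq0 => i _.
rewrite mixed_triangular mxE N_lower // add0r !mxE eqxx mulr1n.
by rewrite mulf_neq0 // signr_eq0.
Qed.

(* With right-hand sides [K ^ i] growing fast enough, the two facets with
   label [i] stay disjoint over the polytope cut out by the previous labels. *)
Lemma triangular_cubical : 0 < eps -> exists b v, cubical_system A b v.
Proof.
(* [C] bounds every row sum of absolute values in [N], and [K] solves [2 * C = (K - 1) * eps], just
   enough for the estimate [rho_lt] below. *)
move=> eps_gt0; pose C : R := \sum_i \sum_k `|N i k|;
  pose K : R := 1 + 2 * C / eps.
have C_ge0 : 0 <= C by do 2!apply: sumr_ge0 => ? _.
have K_ge1 : 1 <= K by rewrite lerDl mulr_ge0 ?invr_ge0 ?(ltW eps_gt0)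
  ?mulr_ge0.
have K_gt0 : 0 < K by apply: lt_le_trans K_ge1.
pose b (a : bool) (i : 'I_n) := K ^+ i.
pose v s := (\row_i K ^+ i) *m invmx (mixed A s)^T.
have unitA s : mixed A s \in unitmx by rewrite mixed_triangular_unit ?gt_eqF.
pose rho (x : 'rV[R]_n) i := \sum_k N i k * x 0 k.
have lhsE x a i : lhs A x a i = rho x i + (-1) ^+ a * eps * x 0 i.
  rewrite /lhs AE linearD /= mulmxDr tr_scalar_mx mul_mx_scalar mxE
    [X in _ + X]mxE.
  by congr (_ + _); rewrite mxE; apply: eq_bigr => k _; rewrite mxE mulrC.
have tightE s i : rho (v s) i + (-1) ^+ s i * eps * v s 0 i = K ^+ i.
  rewrite -lhsE; have : v s *m (mixed A s)^T = \row_i K ^+ i.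
    by rewrite mulmxKV // unitmx_tr.
  move=> /rowP/(_ i); rewrite [RHS]mxE => <-; rewrite /lhs !mxE.
  by apply: eq_bigr => k _; rewrite !mxE.
have rho_lt s i : `|rho (v s) i| < K ^+ i.
  have [m] := ubnP (i : nat); elim: m i => // m IH i im.
  (* Only coordinates [k < i] enter [rho _ i]. By tightness and induction, [eps] times such a
     coordinate is at most [2 * K ^+ k] in absolute value. *)
  have step (k : 'I_n) : (k < i)%N -> eps * `|v s 0 k| * K <= 2 * K ^+ i.
    move=> ki; have -> : eps * `|v s 0 k| = `|K ^+ k - rho (v s) k|.
      rewrite -(tightE s k) addrC addKr !normrM normr_sign mul1r.
      by rewrite (gtr0_norm eps_gt0).
    apply: (@le_trans _ _ (2 * K ^+ k * K)).
      rewrite ler_pM2r // (le_trans (ler_normB _ _)) // mulr_natl mulr2n lerD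
        //.
        by rewrite ger0_norm // exprn_ge0 // ltW.
      by apply: ltW; apply: IH; apply: (leq_trans ki); rewrite -ltnS.
    by rewrite -mulrA -exprSr ler_pM2l // ler_weXn2l.
  have bound : eps * `|rho (v s) i| * K <= 2 * C * K ^+ i.
    apply: (@le_trans _ _ (\sum_k `|N i k| * (2 * K ^+ i))).
      apply: (@le_trans _ _ (\sum_k `|N i k| * (eps * `|v s 0 k| * K))).
        rewrite mulrAC -ler_pdivlMl ?mulr_gt0 // mulr_sumr.
        apply: (le_trans (ler_norm_sum _ _ _)); apply: ler_sum => k _.
        rewrite normrM mulrCA ler_wpM2l // mulrAC mulKf //.
        by rewrite gt_eqF // mulr_gt0.
      apply: ler_sum => k _; have [ki|ik] := ltnP k i.
        by rewrite ler_wpM2l ?step.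
      by rewrite N_lower // normr0 !mul0r.
    rewrite -mulr_suml mulrCA -mulrA ler_pM2l // ler_wpM2r ?exprn_ge0
      ?(ltW K_gt0) //.
    by rewrite /C [leRHS](bigD1 i) //= lerDl; do 2!apply: sumr_ge0 => ? _.
  have KE : 2 * C = (K - 1) * eps by rewrite /K addrC addKr divfK ?gt_eqF.
  have Ki : 0 < K ^+ i by apply: exprn_gt0.
  rewrite -(ltr_pM2l eps_gt0) -(ltr_pM2r K_gt0); apply: (le_lt_trans bound).
  have -> : 2 * C * K ^+ i = eps * K ^+ i * (K - 1) by rewrite KE; ring.
  by rewrite ltr_pM2l ?mulr_gt0 // gtrBl.
exists b, v; split=> // [s a i|s a i].
  (* The inequality opposite to the tight one takes the value [2 * rho - K ^+ i], which is below
     [K ^+ i]. *)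
  rewrite -/(lhs A (v s) a i) lhsE /b; have := tightE s i; have := rho_lt s i.
  rewrite ltr_norml => /andP[_]; set rr := rho _ _; set xx := v s 0 i.
  by case: a (s i) => [] []; rewrite /= ?expr1 ?expr0 ?mulN1r ?mulNr ?mul1r;
    lra.
rewrite lhsE /b; have := tightE s i; have := rho_lt s i.
rewrite ltr_norml => /andP[_]; set rr := rho _ _; set xx := v s 0 i.
case: a (s i) => [] []; rewrite /= ?expr1 ?expr0 ?mulN1r ?mulNr ?mul1r => h1 h2.
- by rewrite h2 eqxx.
- by apply/negbTE; rewrite lt_eqF //; lra.
- by apply/negbTE; rewrite lt_eqF //; lra.
- by rewrite h2 eqxx.
Qed.

End TriangularSystem.

Section DeformedCube.
Variables (R : realType) (p d : nat).
Hypothesis d_le : (d <= p.+1)%N.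
Local Notation n := p.+1.
Local Notation r := (p.+1 - d)%N.
Variables (G : 'M[R]_(p, r)) (eps : R).
Hypothesis normG : normalized G.

Definition proj_mx_last : 'M[R]_(n, d) :=
  \matrix_(i < n, j < d) ((i : nat) == (r + j)%N)%:R.

Let A := cube_normals (n := n) (d := d) G eps.

Let N : 'M[R]_(n, r) := \matrix_(i, k) (if unlift ord0 i is Some j then G j k
  else 0).

Let AE a : A a = N *m (pid_mx r : 'M[R]_(r, n)) + ((-1) ^+ a * eps)%:M.
Proof.
rewrite /A /cube_normals; congr (_ *m _ + _); apply/matrixP => i k;
  rewrite !mxE.
case: (unliftP ord0 i) => [j|] ->.
  rewrite (bigD1 j) //= mxE eqxx mul1r big1 ?addr0 // => l lj.
  by rewrite mxE /= /bump /= add1n eqSS eq_sym (inj_eq val_inj) (negPf lj)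
    mul0r.
by rewrite big1 // => l _; rewrite mxE mul0r.
Qed.

(** Entry [(i, k)] is the entry [(i - 1, k)] of [G] for [0 < i] and [k < r]. If [i <= k], it lies in
    the identity block above the diagonal. *)
Let NE : forall i k : 'I_n, (i <= k)%N -> (N *m (pid_mx r : 'M[R]_(r,
  n))) i k = 0.
Proof.
move=> i k ik; rewrite mxE big1 // => l _; rewrite !mxE.
case: (unliftP ord0 i) ik => [j|] -> ik; last by rewrite mul0r.
case: eqP => [lk|]; rewrite ?mulr0 //=.
have jl : (j < l)%N by rewrite lk; exact: ik.
by rewrite (normG l (ltn_trans jl (ltn_ord l))) (ltn_eqF jl) mul0r.
Qed.

Let pidK : (pid_mx r : 'M[R]_(r, n)) *m (pid_mx r : 'M[R]_(n, r)) = 1%:M.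
Proof. by rewrite mul_pid_mx minnn (minn_idPr (leq_subr _ _)) pid_mx_1. Qed.

Lemma mixed_trunc s :
  mixed A s *m (pid_mx r : 'M[R]_(n, r)) = label_normals G eps s.
Proof.
rewrite (mixed_triangular AE) mulmxDl -mulmxA pidK mulmx1; apply/matrixP => i k.
rewrite mxE mul_diag_mx !mxE; congr (_ + _ * _%:R).
by case: eqP => // ->; rewrite ltn_ord.
Qed.

Lemma mixed_normals_unit s : eps != 0 -> mixed A s \in unitmx.
Proof. exact: mixed_triangular_unit NE AE s. Qed.

Lemma normals_cubical : 0 < eps -> exists b v, cubical_system A b v.
Proof. exact: triangular_cubical NE AE. Qed.

Lemma proj_mx_lastP (u : 'rV[R]_n) :
  (exists c : 'cV[R]_d, (proj_mx_last *m c)^T = u) <->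
  u *m (pid_mx r : 'M[R]_(n, r)) = 0.
Proof.
have pidE (w : 'rV[R]_n) k (kn : (k < n)%N) (kr : (k < r)%N) :
    (w *m (pid_mx r : 'M[R]_(n, r))) 0 (Ordinal kr) = w 0 (Ordinal kn).
  rewrite mxE (bigD1 (Ordinal kn)) //= mxE eqxx kr mulr1 big1 ?addr0 // => i ik.
  rewrite mxE /= (_ : (i : nat) == k = false) ?mulr0 //.
  by apply: contraNF ik => /eqP ik; apply/eqP/val_inj.
split=> [[c <-]|u0].
  apply/rowP => k; have kn : (k < n)%N := leq_trans (ltn_ord k) (leq_subr _ _).
  have -> : k = Ordinal (ltn_ord k) by apply: val_inj.
  rewrite (pidE _ _ kn) !mxE big1 // => j _; rewrite mxE /=.
  by rewrite (ltn_eqF (leq_trans (ltn_ord k) (leq_addr _ _))) mul0r.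
exists (\col_j u 0 (inord (r + j))); apply/rowP => i; rewrite !mxE.
have [ir|ri] := ltnP i r.
  rewrite big1 => [|j _]; last first.
    by rewrite mxE (ltn_eqF (leq_trans ir (leq_addr _ _))) mul0r.
  have := congr1 (fun w : 'rV[R]_r => w 0 (Ordinal ir)) u0.
  rewrite (pidE _ _ (ltn_ord i)) mxE => <-; congr (u 0 _); exact: val_inj.
have jd : (i - r < d)%N.
  by rewrite ltn_subLR // subnK // ltn_ord.
rewrite (bigD1 (Ordinal jd)) //= !mxE /= subnKC // eqxx mul1r big1 => [|j jj].
  by rewrite addr0 inord_val.
rewrite !mxE; case: eqP => [ij|]; last by rewrite mul0r.
by case/eqP: jj; apply/val_inj; rewrite /= ij addKn.
Qed.

Lemma good_sign_good t : good A proj_mx_last t <-> sign_good G eps t.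
Proof.
split=> [[c [m [cm m_gt0 m_eq0]]]|[l [lM l_gt0 l_eq0]]].
  exists m; split=> //; rewrite -mixed_trunc mulmxA.
  by apply/proj_mx_lastP; exists c.
have [|c cl] := (proj_mx_lastP (l *m mixed A (fill t))).2.
  by rewrite -mulmxA mixed_trunc.
by exists c, l.
Qed.

Lemma cube_system_cubical b : eps != 0 -> cube_system A b ->
  exists v, cubical_system A b v.
Proof.
move=> eps0 [_ tights].
have /choice [v vP] : forall s : {ffun 'I_n -> bool}, exists v,
    vertices (solutions A b) v /\ tight A b v = [set l | l.1 = s l.2].
  move=> s; have : range (fun sigma : 'I_n -> bool => [set l | l.1 = sigma l.2])
      [set l | l.1 = s l.2] by exists s.
  by rewrite -tights => -[v v_vert tv]; exists v.
exists v; split=> [s|s|s a i]; first exact: mixed_normals_unit.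
  have [[c [t [_ e]]] _] := vP s.
  by have : [set v s] (v s) by []; rewrite e => -[].
have [_ e] := vP s; have : tight A b (v s) (a, i) <-> a = s i by rewrite e.
by move=> [h1 h2]; apply/eqP/eqP.
Qed.

Lemma proj_last_pface b :
  (@proj_last R n d) @` solutions A b = pface A b proj_mx_last zero_sgn.
Proof. by rewrite pface_zero. Qed.

End DeformedCube.

Section CofacesOfNCP.
Variables (R : realType) (p d : nat).
Hypotheses (d_le : (d <= p.+1)%N) (p_gt0 : (0 < p)%N).
Local Notation r := (p.+1 - d)%N.

Lemma NCP_iso_cofaces (G G' : 'M[R]_(p, r)) eps eps' b b' v v' :
  normalized G -> normalized G' ->
  (forall j, pspanning G (~: [set j])%SET) ->
  (forall j, pspanning G' (~: [set j])%SET) ->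
  eps != 0 -> eps' != 0 -> small_enough G eps -> small_enough G' eps' ->
  let A := cube_normals (n := p.+1) (d := d) G eps in
  let A' := cube_normals (n := p.+1) (d := d) G' eps' in
  cubical_system A b v -> cubical_system A' b' v' ->
  comb_iso (pface A b (proj_mx_last R p d) zero_sgn)
           (pface A' b' (proj_mx_last R p d) zero_sgn) ->
  exists2 h : 'I_p -> 'I_p, injective h &
    forall T, coface G T <-> coface G' (h @: T)%SET.
Proof.
move=> nG nG' vG vG' eps0 eps0' sG sG' A A' cA cA' iso.
(* For [n = d] the truncated normals live in dimension 0 and cannot single out label [ord0], but
   every index set is a coface. *)
have [r0|r_gt0] := posnP r.
  have all_coface (M : 'M[R]_(p, r)) T : coface M T.
    apply: pspanning_coface => y _; apply/colP => k.
    by have := ltn_ord k; rewrite {2}r0.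
  by exists id => // T; split=> _; apply: all_coface.
have [|||pi [z KK']] := comb_iso_signed_perm cA cA' _ _ _ iso.
- by move=> s; apply/good_sign_good => //; apply: sign_good_full.
- by move=> s i; apply/good_sign_good => //; apply: sign_good_edge.
- by move=> s; apply/good_sign_good => //; apply: sign_good_full.
apply: (@sign_blind_transfer _ _ _ (sign_good G eps) (sign_good G' eps') _ _ pi
  z).
- exact: sign_good_blind.
- exact: sign_good_blind.
- exact: sign_good_distinguishes.
- by move=> t; rewrite -!good_sign_good.
Qed.

End CofacesOfNCP.

(** * Gale duality *)

Lemma card_setT_ord k : ([set: 'I_k] #= `I_k)%card.
Proof.
have <- : [set val i | i in [set: 'I_k]] = `I_k.
  rewrite eqEsubset; split=> [_ [i _ <-]|i ik]; first exact: ltn_ord.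
  by exists (Ordinal ik).
by rewrite card_eq_sym; apply: inj_card_eq => i j _ _ /val_inj.
Qed.

Section GaleDuality.
Variables (R : realType) (p m r : nat).
Implicit Types (V : 'M[R]_(p, m)) (G : 'M[R]_(p, r)) (T : {set 'I_p}).

(* The vectors orthogonal to the columns of [G] are the slack vectors of the
   affine functionals on the rows of [V]. *)
Definition gale_dual V G :=
  (forall l : 'rV[R]_p, l *m G = 0 <->
     exists (c : 'cV[R]_m) (t : R), forall i, l 0 i = t - (V *m c) i 0) /\
  (forall y : 'cV[R]_r, G *m y = 0 -> y = 0).

Lemma gale_transform_dual V G : gale_transform V G -> gale_dual V G.
Proof.
move=> [free GE]; set K := row_mx V (const_mx 1 : 'cV[R]_p) in GE.
have KE (c : 'cV[R]_m) (t : 'cV[R]_1) i :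
    (K *m col_mx c t) i 0 = (V *m c) i 0 + t 0 0.
  rewrite mul_row_col mxE; congr (_ + _).
  by rewrite mxE big_ord1 mxE mul1r.
split=> [l|y Gy]; last first.
  apply: trmx_inj; apply: (row_free_inj free).
  by rewrite -trmx_mul Gy !trmx0 mul0mx.
have GK : G^T *m K = 0 by apply/sub_kermxP; rewrite GE.
split=> [lG|[c [t lE]]].
  have : (l <= K^T)%MS.
    (* Double orthogonal complement: whatever is orthogonal to the columns of [K] is spanned by the
       columns of [G], hence orthogonal to [l]. *)
    rewrite submxE; have : ((cokermx K^T)^T <= G^T)%MS.
      rewrite GE; apply/sub_kermxP.
      by rewrite -[LHS]trmxK trmx_mul trmxK mulmx_coker trmx0.
    case/submxP => X /(congr1 trmx); rewrite trmxK trmx_mul trmxK => ->.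
    by rewrite mulmxA lG mul0mx.
  case/submxP => D lE; exists (- usubmx D^T), (dsubmx D^T 0 0) => i.
  have -> : l 0 i = (K *m D^T) i 0.
    by rewrite lE -[X in X *m K^T]trmxK -trmx_mul mxE.
  by rewrite -{1}(vsubmxK D^T) KE mulmxN [X in _ - X]mxE opprK addrC.
have -> : l = (K *m col_mx (- c) t%:M)^T.
  by apply/rowP => i; rewrite mxE KE lE mulmxN !mxE eqxx mulr1n addrC.
by apply: trmx_inj; rewrite trmx_mul trmxK mulmxA GK mul0mx trmx0.
Qed.

Definition hull_face V (T : {set 'I_p}) : set 'rV[R]_m :=
  [set x | exists w : 'rV[R]_p, [/\ forall i, 0 <= w 0 i, \sum_i w 0 i = 1,
     forall i, i \in T -> w 0 i = 0 & x = w *m V]].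

Lemma row_hull_face V T i : i \notin T -> hull_face V T (row i V).
Proof.
move=> iT; exists (delta_mx 0 i); split=> [j||j jT|].
- by rewrite mxE ler0n.
- rewrite (bigD1 i) //= mxE !eqxx big1 ?addr0 // => j ji.
  by rewrite mxE (negPf ji).
- by rewrite mxE eqxx /=; case: eqP => // ji; rewrite -ji jT in iT.
- by rewrite rowE.
Qed.

Lemma row_convhull V i : convhull V (row i V).
Proof.
have := @row_hull_face V finset.set0 i; rewrite finset.in_set0 => /(_ isT).
by move=> [w [? ? _ ?]]; exists w.
Qed.

Lemma slack_mul V (l w : 'rV[R]_p) (c : 'cV[R]_m) t :
  (forall i, l 0 i = t - (V *m c) i 0) -> \sum_i w 0 i = 1 ->
  t - (w *m V *m c) 0 0 = \sum_i w 0 i * l 0 i.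
Proof.
move=> lE w1; rewrite -{1}[t]mul1r -w1 mulr_suml -mulmxA mxE -sumrB.
by apply: eq_bigr => i _; rewrite lE mulrBr.
Qed.

(** The weights of a positive dependency of [G] are the slacks of a supporting functional, zero
    exactly at the rows of [V] on the face. *)
Lemma face_hull V G F : gale_dual V G ->
  face (convhull V) F <-> exists2 T : {set 'I_p},
    coface G T & hull_face V T = F.
Proof.
move=> [dual _].
have hullE (l : 'rV[R]_p) (c : 'cV[R]_m) t (T : {set 'I_p}) :
    (forall i, l 0 i = t - (V *m c) i 0) ->
    (forall i, i \in T -> 0 < l 0 i) -> (forall i, i \notin T -> l 0 i = 0) ->
    (forall x, convhull V x -> (x *m c) 0 0 <= t) /\
    hull_face V T = [set x | convhull V x /\ (x *m c) 0 0 = t].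
  move=> lE l_gt0 l_eq0; have l0 i : 0 <= l 0 i.
    by have [/l_gt0/ltW|/l_eq0 ->] := boolP (i \in T).
  split=> [x [w [w0 w1 ->]]|].
    rewrite -subr_ge0 (slack_mul lE w1) sumr_ge0 // => i _.
    by rewrite mulr_ge0.
  rewrite eqEsubset; split=> [x [w [w0 w1 wT ->]]|x [[w [w0 w1 ->]] /eqP]].
    split; first by exists w.
    apply/eqP; rewrite eq_sym -subr_eq0 (slack_mul lE w1) big1 // => i _.
    by have [/wT ->|/l_eq0 ->] := boolP (i \in T); rewrite ?mul0r ?mulr0.
  rewrite eq_sym -subr_eq0 (slack_mul lE w1) psumr_eq0 => [/allP wl|i _].
    exists w; split=> // i iT; have := wl i (mem_index_enum i).
    by rewrite mulf_eq0 [X in _ || X]gt_eqF ?l_gt0 ?orbF // => /eqP.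
  by rewrite mulr_ge0.
split=> [[c [t [le_t ->]]]|[T [l [lG l_gt0 l_eq0]] <-]]; last first.
  have [c [t lE]] := (dual l).1 lG.
  by have [? ?] := hullE l c t T lE l_gt0 l_eq0; exists c, t.
pose l : 'rV[R]_p := \row_i (t - (V *m c) i 0).
have lE i : l 0 i = t - (V *m c) i 0 by rewrite mxE.
have l0 i : 0 <= l 0 i.
  rewrite lE subr_ge0; have := le_t _ (row_convhull V i).
  by rewrite -row_mul mxE.
pose T := [set i | 0 < l 0 i]%SET.
have lT i : i \in T -> 0 < l 0 i by rewrite inE.
have lT' i : i \notin T -> l 0 i = 0.
  by rewrite inE -leNgt => li; apply/eqP; rewrite eq_le li l0.
exists T; first by exists l; split=> //; apply/dual; exists c, t.
by have [] := hullE l c t T lE lT lT'.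
Qed.

Lemma hull_face_row V G T i : gale_dual V G -> coface G T ->
  hull_face V T (row i V) -> i \notin T.
Proof.
move=> [dual _] [l [/dual [c [t lE]] l_gt0 l_eq0]] [w [w0 w1 wT Vi]].
apply/negP => iT; have := slack_mul lE w1; rewrite -Vi -row_mul mxE -lE.
rewrite big1 => [li|j _]; first by have := l_gt0 i iT; rewrite li ltxx.
by have [/wT ->|/l_eq0 ->] := boolP (j \in T); rewrite ?mul0r ?mulr0.
Qed.

Lemma hull_face_subset V G T T' : gale_dual V G -> coface G T' ->
  hull_face V T `<=` hull_face V T' <-> T' \subset T.
Proof.
move=> dual cT'; split=> [sub|/fintype.subsetP sub x [w [w0 w1 wT ->]]].
  apply/fintype.subsetP => i; apply: contraTT => iT.
  by apply: (hull_face_row dual cT'); apply: sub; apply: row_hull_face.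
by exists w; split=> // i /sub /wT.
Qed.

Lemma hull_face_neq0 V T : hull_face V T !=set0 -> ~: T != finset.set0.
Proof.
move=> [_ [w [_ w1 wT _]]]; apply/eqP => /setP T0.
move: w1; rewrite big1 => [/esym/eqP|i _]; first by rewrite oner_eq0.
by apply: wT; have := T0 i; rewrite finset.in_setC finset.in_set0 => /negbFE.
Qed.

Lemma coface_vertex V G i : gale_dual V G -> ordered_vertices V ->
  coface G (~: [set i])%SET.
Proof.
move=> dual [inj verts].
have : vertices (convhull V) (row i V) by rewrite verts; exists i.
move=> /(face_hull _ dual) [T cT hT]; suff <- : T = (~: [set i])%SET by [].
have sub j : j \notin T -> j = i.
  by move=> /(row_hull_face V); rewrite hT => /inj.
have : ~: T != finset.set0 by apply: (@hull_face_neq0 V); rewrite hT;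
  exists (row i V).
case/finset.set0Pn => j; rewrite finset.in_setC => jT.
apply/setP => k; rewrite finset.in_setC1; apply/idP/idP => [kT|].
  by apply: contraTneq kT => ->; rewrite -(sub j).
by apply: contraNT => /sub ->.
Qed.

Lemma coface_neighborly V G (F : {set 'I_p}) : gale_dual V G ->
  ordered_vertices V ->
  neighborly (convhull V) -> (#|F| <= m./2)%N -> coface G (~: F)%SET.
Proof.
move=> dual [inj verts] [_ neigh] Fm.
pose S := [set row i V | i in [set` F]].
have [||F' F'face F'S] := neigh S; first by move=> _ [i _ <-]; rewrite verts;
  exists i.
  have -> : S = [set row (enum_val k) V | k in [set: 'I_#|F|]].
    rewrite eqEsubset; split=> _ [i iF <-]; last by exists (enum_val i) => //;
      apply: enum_valP.
    by exists (enum_rank_in iF i) => //; rewrite enum_rankK_in.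
  apply: card_le_trans (card_image_le _ _) _.
  by rewrite (card_le_eql (card_setT_ord _)) card_le_II.
move: F'face => /(face_hull _ dual) [T cT hT].
suff <- : T = (~: F)%SET by [].
apply/setP => i; rewrite finset.in_setC; apply/idP/idP => [iT|].
  apply: contraTN iT => iF; apply: (hull_face_row dual cT); rewrite hT.
  have : vertices F' (row i V) by rewrite F'S; exists i.
  move=> [c [t [_ e]]]; have : [set row i V] (row i V) by [].
  by rewrite e => -[].
(* A vertex of the polytope that lies on [F'] is a vertex of [F'], exposed by the same functional;
   hence its index is in [F]. *)
apply: contraNT => iT; have F'i : F' (row i V) by rewrite -hT;
  apply: row_hull_face.
have F'sub : F' `<=` convhull V by rewrite -hT => x [w [? ? _ ?]]; exists w.
have : vertices (convhull V) (row i V) by rewrite verts; exists i.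
move=> [c [t [le_t e]]].
have : vertices F' (row i V).
  exists c, t; split=> [x /F'sub /le_t //|].
  rewrite eqEsubset; split=> [x ->|x [F'x xt]].
    by split=> //; have : [set row i V] (row i V) by []; rewrite e => -[].
  by rewrite e; split=> //; apply: F'sub.
by rewrite F'S => -[j /= jF /inj <-].
Qed.

End GaleDuality.

Lemma subset_between (T : finType) (A B : {set T}) k :
  A \subset B -> (#|A| <= k <= #|B|)%N ->
  exists2 I : {set T}, A \subset I /\ I \subset B & #|I| = k.
Proof.
move=> AB /andP[Ak kB].
have /card_geqP [s [s_uniq s_size sBA]] : (k - #|A| <= #|B :\: A|)%N.
  by rewrite cardsDS // leq_sub2r.
have sI x : x \in s -> (x \notin A) && (x \in B) by move=> /sBA;
  rewrite finset.in_setD.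
exists (A :|: [set x in s])%SET; first split.
- exact: finset.subsetUl.
- rewrite finset.subUset AB; apply/fintype.subsetP => x; rewrite inE => /sI.
  by case/andP.
- rewrite cardsU (_ : _ :&: _ = finset.set0)%SET ?cards0 ?subn0; last first.
    apply/setP => x; rewrite !inE; apply/negP => /andP[xA /sI].
    by rewrite xA.
  by rewrite cardsE (card_uniqP s_uniq) s_size subnKC.
Qed.

Lemma spanning_free (R : realFieldType) p q (M : 'M[R]_(p, q)) (I :
  {set 'I_p}) :
  #|I| = q -> spanning M I ->
  forall w : 'rV[R]_p, (forall i, i \notin I -> w 0 i = 0) -> w *m M = 0 ->
    w = 0.
Proof.
move=> Iq sI w wI wM; pose N := rowsub (enum_val : 'I_#|I| -> 'I_p) M.
have free : row_free N.
  suff : row_full N by rewrite /row_full /row_free => /eqP ->; rewrite Iq.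
  rewrite /row_full -mxrank_tr -/(row_free _); apply: inj_row_free => y yN.
  apply: trmx_inj; rewrite trmx0; apply: sI => i iI.
  have /matrixP/(_ (enum_rank_in iI i) 0) : N *m y^T = 0.
    by rewrite -[LHS]trmxK trmx_mul trmxK yN trmx0.
  rewrite [RHS]mxE => <-; rewrite !mxE; apply: eq_bigr => j _.
  by rewrite !mxE enum_rankK_in.
have w0 : \row_k w 0 (enum_val k) = 0 :> 'rV[R]_#|I|.
  apply: (row_free_inj free); rewrite mul0mx -wM; apply/rowP => j; rewrite !mxE.
  rewrite [RHS](bigID (mem I)) /= [X in _ = _ + X]big1 ?addr0 => [|i iI].
    rewrite [RHS]big_enum_val /=; apply: eq_bigr => k _.
    by rewrite !mxE.
  by rewrite wI // mul0r.
apply/rowP => i; rewrite mxE; have [iI|/wI //] := boolP (i \in I).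
have /rowP/(_ (enum_rank_in iI i)) := w0.
by rewrite !mxE enum_rankK_in.
Qed.

Section PrimalConfigurations.
Variables (R : realType) (p m r : nat).
Implicit Types (V : 'M[R]_(p, m)) (G : 'M[R]_(p, r)) (T : {set 'I_p}).

Lemma comb_iso_hull V V' G G' (h : 'I_p -> 'I_p) :
  gale_dual V G -> gale_dual V' G' -> injective h ->
  (forall T, coface G T <-> coface G' (h @: T)%SET) ->
  comb_iso (convhull V) (convhull V').
Proof.
move=> dual dual' h_inj hT.
apply: (@indexed_inclusion_iso _ _ _ [set T | coface G T] _ _
  (hull_face V) (fun T => hull_face V' (h @: T)%SET)).
- by move=> F; apply: face_hull.
- move=> F; split=> [/(face_hull _ dual') [T cT <-]|[T cT <-]]; last first.
    by apply/(face_hull _ dual'); exists (h @: T)%SET => //; apply/hT.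
  have [g hK gK] := injF_bij h_inj.
  have e : (h @: (g @: T) = T)%SET.
    by rewrite -imset_comp (eq_imset _ (g := id)) ?imset_id // => i; apply: gK.
  by exists (g @: T)%SET; rewrite /= ?e //; apply/hT; rewrite e.
- move=> T T' cT cT'; rewrite (hull_face_subset _ dual cT').
  rewrite (hull_face_subset _ dual' ((hT T').1 cT')).
  split=> [|/fintype.subsetP sub]; first exact: imsetS.
  apply/fintype.subsetP => i iT; have := sub _ (imset_f h iT).
  by rewrite (mem_imset _ _ h_inj).
Qed.

Lemma gale_dual_dependency V G (y : 'cV[R]_r) : gale_dual V G ->
  (G *m y)^T *m V = 0 /\ \sum_i (G *m y)^T 0 i = 0.
Proof.
move=> [dual _].
(* [G *m y] is orthogonal to all slack vectors; those of the coordinate functionals and of the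
   constant 1 give the two equations. *)
have dep (c : 'cV[R]_m) t : \sum_i (t - (V *m c) i 0) * (G *m y) i 0 = 0.
  have lG : (\row_i (t - (V *m c) i 0)) *m G = 0.
    by apply/dual; exists c, t => i; rewrite mxE.
  transitivity (((\row_i (t - (V *m c) i 0)) *m (G *m y)) 0 0).
    by rewrite [RHS]mxE; apply: eq_bigr => i _; rewrite [X in _ = X * _]mxE.
  by rewrite mulmxA lG mul0mx mxE.
split.
  apply/rowP => j;
    rewrite [RHS]mxE -[RHS]oppr0 -(dep (delta_mx j 0) 0) mxE -sumrN.
  apply: eq_bigr => i _; rewrite mxE -colE [col _ _ _ _]mxE sub0r mulNr opprK.
  by rewrite mulrC.
rewrite -[RHS](dep 0 1); apply: eq_bigr => i _.
by rewrite mulmx0 [(0 : 'cV__) _ _]mxE subr0 mul1r mxE.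
Qed.

(* If [G *m y] vanishes on [T], then it is an affine dependency of the rows of
   [V] outside [T]. *)
Lemma gale_dual_spanning V G T : gale_dual V G ->
  (forall w : 'rV[R]_p, (forall i, i \in T -> w 0 i = 0) -> w *m V = 0 ->
     \sum_i w 0 i = 0 -> w = 0) ->
  spanning G T.
Proof.
move=> dual ind y Gy; apply: dual.2; apply: trmx_inj; rewrite trmx0.
have [zV z1] := gale_dual_dependency y dual; apply: ind => // i iT.
by rewrite mxE Gy.
Qed.

(** The slack functional of a nonempty coface vanishes on all rows outside [T], so these are at most
    [m]. Completed to [m.+1] rows, which lie on no hyperplane, they are affinely independent. *)
Lemma general_position_simplicial V G : (m < p)%N -> gale_dual V G ->
  general_position V -> simplicial_config G.
Proof.
move=> mp dual gp T T0 cT.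
have Tm : (#|~: T| <= m)%N.
  rewrite leqNgt; apply/negP => mT.
  have [I IT Im] : exists2 I : {set 'I_p}, I \subset ~: T & #|I| = m.+1.
    have [|I [_ IT] Im] := @subset_between _ finset.set0 (~:
      T)%SET m.+1 (finset.sub0set _).
      by rewrite finset.cards0.
    by exists I.
  have [l [/dual.1 [c [t lE]] l_gt0 l_eq0]] := cT.
  apply: (gp I Im); exists c, t; split=> [|i iI]; last first.
    have := fintype.subsetP IT i iI; rewrite finset.in_setC => /l_eq0.
    by rewrite lE => /eqP; rewrite subr_eq0 => /eqP.
  (* A constant slack cannot be positive on [T] and zero on [I]. *)
  apply/eqP => c0; have [j jT] := finset.set0Pn _ T0.
  have t0 : 0 < t by have := l_gt0 j jT; rewrite lE c0 mulmx0 mxE subr0.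
  have [i iI] : exists i, i \in I by apply/finset.set0Pn; rewrite -card_gt0 Im.
  have := fintype.subsetP IT i iI; rewrite finset.in_setC => /l_eq0.
  by rewrite lE c0 mulmx0 mxE subr0 => t_eq0; rewrite t_eq0 ltxx in t0.
have [I TI Im] : exists2 I : {set 'I_p}, ~: T \subset I & #|I| = m.+1.
  have [|I [TI _] Im] := @subset_between _ (~: T)%SET [set:
    'I_p]%SET m.+1 (finset.subsetT _).
    by rewrite finset.cardsT card_ord mp (leq_trans Tm).
  by exists I.
apply: (gale_dual_spanning dual) => w wT wV w1.
apply: (@spanning_free _ _ _ (row_mx V (const_mx 1 : 'cV[R]_p)) I).
- by rewrite Im addn1.
- move=> y Ky; have KE i : (row_mx V (const_mx 1 : 'cV[R]_p) *m y) i 0 =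
      (V *m usubmx y) i 0 + dsubmx y 0 0.
    rewrite -{1}(vsubmxK y) mul_row_col mxE; congr (_ + _).
    by rewrite mxE big_ord1 mxE mul1r.
  have c0 : usubmx y = 0.
    apply/eqP/negPn/negP => c0; apply: (gp I Im).
    exists (usubmx y), (- dsubmx y 0 0); split=> // i iI.
    by apply/eqP; rewrite -addr_eq0 -KE Ky.
  have [i iI] : exists i, i \in I by apply/finset.set0Pn; rewrite -card_gt0 Im.
  have := Ky i iI; rewrite KE c0 mulmx0 [(0 : 'cV__) _ _]mxE add0r => t0.
  rewrite -(vsubmxK y) c0; have -> : dsubmx y = 0; last by rewrite col_mx0.
  by apply/matrixP => a c; rewrite !ord1 t0 mxE.
- move=> i iI; apply: wT; apply: contraNT iI => iT.
  by apply: (fintype.subsetP TI); rewrite finset.in_setC.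
- rewrite mul_mx_row wV; have -> : w *m (const_mx 1 : 'cV[R]_p) = 0;
  last by rewrite row_mx0.
  apply/matrixP => a c; rewrite !ord1 !mxE -[RHS]w1; apply: eq_bigr => i _.
  by rewrite mxE mulr1.
Qed.

Lemma supporting_row k (U : 'M[R]_(k, m)) (x : 'rV[R]_m) (c : 'cV[R]_m) t :
  convhull U x -> (forall j, (row j U *m c) 0 0 <= t) -> (x *m c) 0 0 = t ->
  (forall j, (row j U *m c) 0 0 = t -> row j U = x) -> exists j, row j U = x.
Proof.
move=> [w [w0 w1 xE]] le_t xt uniq_t.
have [j wj] : exists j, 0 < w 0 j.
  apply/existsP; apply: contraPT w1; rewrite negb_exists => /forallP wle.
  rewrite big1 => [/esym/eqP|i _]; first by rewrite oner_eq0.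
  by apply/eqP; rewrite eq_le w0 andbT leNgt.
exists j; apply: uniq_t; apply/eqP; rewrite eq_sym -subr_eq0.
have : \sum_i w 0 i * (t - (row i U *m c) 0 0) = 0.
  rewrite -[RHS](subrr t) -{3}xt xE -{2}[t]mul1r -w1 mulr_suml -mulmxA mxE
    -sumrB.
  apply: eq_bigr => i _; rewrite mulrBr; congr (_ - _ * _).
  by rewrite -row_mul mxE.
move=> /eqP; rewrite psumr_eq0 => [/allP/(_ j (mem_index_enum j))|i _].
  by rewrite mulf_eq0 gt_eqF.
by rewrite mulr_ge0 // subr_ge0.
Qed.

(** The rows outside [T] are vertices lying on a simplex face, hence distinct generators of that
    simplex. An affine dependency of them becomes one of the generators [U] and is trivial. *)
Lemma simplicial_simplicial_config V G : gale_dual V G -> ordered_vertices V ->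
  simplicial (convhull V) -> simplicial_config G.
Proof.
move=> dual [inj verts] simp T T0 cT; apply: (gale_dual_spanning dual).
move=> w wT wV w1; apply/rowP => i; rewrite mxE.
have [/wT //|iT] := boolP (i \in T).
have Fface : face (convhull V) (hull_face V T) by apply/(face_hull _ dual);
  exists T.
have [k [U [Uind UE]]] : simplex (hull_face V T).
  apply: simp; split=> //; first by exists (row i V); apply: row_hull_face.
  move=> FE; have [j jT] := finset.set0Pn _ T0.
  by have := row_convhull V j; rewrite -FE => /(hull_face_row dual cT);
    rewrite jT.
have Fsub : hull_face V T `<=` convhull V by move=> x [u [? ? _ ?]]; exists u.
have /choice [f fP] : forall j, exists l : option 'I_k,
    j \notin T -> omap (fun l => row l U) l = Some (row j V).
  move=> j; have [jT|jT] := boolP (j \in T); first by exists None.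
  have : vertices (convhull V) (row j V) by rewrite verts; exists j.
  move=> [c [t [le_t e]]].
  have [l lE] : exists l, row l U = row j V.
    have UF l : hull_face V T (row l U) by rewrite UE; apply: row_convhull.
    apply: (@supporting_row _ U (row j V) c t).
    - by rewrite -UE; apply: row_hull_face.
    - by move=> l; apply/le_t/Fsub.
    - by have : [set row j V] (row j V) by []; rewrite e => -[].
    - move=> l lt; have : [set row j V] (row l U) by rewrite e; split=> //;
      apply: Fsub.
      by [].
  by exists (Some l) => _; rewrite /= lE.
have f_inj j j' : j \notin T -> j' \notin T -> f j = f j' -> j = j'.
  move=> jT j'T fjj'; apply: inj; apply: Some_inj.
  by rewrite -(fP j jT) -(fP j' j'T) fjj'.
pose w' : 'rV[R]_k := \row_l \sum_(j | (j \notin T) && (f j == Some l)) w 0 j.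
have sumE (F : 'I_k -> R) : \sum_l w' 0 l * F l =
    \sum_(j | j \notin T) w 0 j * (if f j is Some l then F l else 0).
  under eq_bigr => l _ do rewrite mxE mulr_suml.
  rewrite (exchange_big_dep (fun j => j \notin T)) /= => [|l j _ /andP[]//].
  apply: eq_bigr => j jT; case fj: (f j) => [l0|]; last first.
    by have := fP j jT; rewrite fj.
  rewrite (big_pred1 l0) // => l.
  by rewrite jT /= (inj_eq Some_inj) eq_sym.
have wsum (F : 'I_p -> R) : \sum_j w 0 j * F j = \sum_(j | j \notin T) w 0 j * F
  j.
  rewrite (bigID (fun j => j \notin T)) /= [X in _ + X]big1 ?addr0 // => j.
  by rewrite negbK => /wT ->; rewrite mul0r.
have w'0 : w' = 0.
  apply: (affinely_independentP _ Uind).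
    apply/rowP => q;
      rewrite mxE sumE -[RHS](congr1 (fun u : 'rV_m => u 0 q) wV).
    rewrite mxE wsum; apply: eq_bigr => j jT; congr (_ * _).
    have := fP j jT; case: (f j) => [l [] /rowP/(_ q)|//].
    by rewrite !mxE.
  under eq_bigr => l _ do rewrite -[w' 0 l]mulr1.
  rewrite sumE -[RHS]w1; under [RHS]eq_bigr => j _ do rewrite -[w 0 j]mulr1.
  rewrite wsum; apply: eq_bigr => j jT; congr (_ * _).
  by have := fP j jT; case: (f j).
case fi: (f i) => [l|]; last by have := fP i iT; rewrite fi.
have /rowP/(_ l) := w'0; rewrite !mxE (big_pred1 i) // => j.
apply/andP/eqP => [[jT /eqP fj]|->]; last by rewrite iT fi eqxx.
by apply: f_inj => //; rewrite fj.
Qed.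

End PrimalConfigurations.

(** * Vertex matrices and existence of Gale transforms *)

Section VertexMatrix.
Variable R : realType.

Lemma convhull_row' k m (V : 'M[R]_(k.+1, m)) i :
  convhull (row' i V : 'M[R]_(k, m)) (row i V) ->
    convhull V = convhull (row' i V : 'M[R]_(k, m)).
Proof.
move=> [u [u0 u1 Vi]].
have mulE (w : 'rV[R]_k.+1) :
    w *m V = w 0 i *: row i V + (\row_l w 0 (lift i l)) *m (row' i V : 'M[R]_(k,
      m)).
  apply/rowP => q; rewrite !mxE (bigD1_ord i) //=; congr (_ + _).
  by apply: eq_bigr => l _; rewrite !mxE.
rewrite eqEsubset; split=> _ [w [w0 w1 ->]].
  exists (w 0 i *: u + \row_l w 0 (lift i l)); split=> [l||].
  - by rewrite !mxE addr_ge0 // mulr_ge0.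
  - under eq_bigr => l _ do rewrite !mxE.
    by rewrite big_split /= -mulr_sumr u1 mulr1 -w1 [RHS](bigD1_ord i).
  - by rewrite mulE {1}Vi mulmxDl -scalemxAl.
exists (\row_j if unlift i j is Some l then w 0 l else 0); split=> [j||].
- by rewrite mxE; case: unlift.
- rewrite (bigD1_ord i) //= mxE unlift_none add0r -w1.
  by apply: eq_bigr => l _; rewrite mxE liftK.
- rewrite mulE mxE unlift_none scale0r add0r; congr (_ *m _).
  by apply/rowP => l; rewrite !mxE liftK.
Qed.

(** In a generating list of minimal length no point lies in the hull of the others, so each is
    separated from them and exposed as a vertex. *)
Lemma polytope_ordered_vertices m (P : set 'rV[R]_m) : polytope P ->
  exists k (V : 'M[R]_(k, m)), P = convhull V /\ ordered_vertices V.
Proof.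
move=> polyP; pose H k := `[< exists V : 'M[R]_(k, m), P = convhull V >].
have exH : exists k, H k by have [k HV] := polyP; exists k; apply/asboolP.
case: (ex_minnP exH) => k /asboolP [V PV] kmin; exists k, V; split=> //.
have expose i : exists c : 'cV[R]_m, forall j, j != i ->
    (row j V *m c) 0 0 < (row i V *m c) 0 0.
  case: k V PV kmin i => [|k] V PV kmin i; first by case: i.
  have [ih|/convhull_separation [c Hc]] :=
      pselect (convhull (row' i V : 'M[R]_(k, m)) (row i V)); last first.
    exists c => j ji; case: (unliftP i j) ji => [l|] ->; last by rewrite eqxx.
    move=> _; suff -> : (row (lift i l) V *m c) 0 0 = (row' i V *m c) l 0 by
      exact: Hc.
    by rewrite -row_mul mxE; rewrite !mxE; apply: eq_bigr => q _; rewrite !mxE.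
  have : H k by apply/asboolP; exists (row' i V); rewrite PV (convhull_row' ih).
  by move=> /kmin; rewrite ltnn.
have valE (w : 'rV[R]_k) i (c : 'cV[R]_m) : \sum_j w 0 j = 1 ->
    (row i V *m c) 0 0 - (w *m V *m c) 0 0 =
    \sum_j w 0 j * ((row i V *m c) 0 0 - (row j V *m c) 0 0).
  move=> w1; rewrite -{1}[(row i V *m c) 0 0]mul1r -w1 mulr_suml -mulmxA
    [X in _ - X]mxE -sumrB.
  apply: eq_bigr => j _; rewrite mulrBr; congr (_ - _ * _).
  by rewrite -row_mul [RHS]mxE.
have vert i : vertices (convhull V) (row i V).
  have [c Hc] := expose i; exists c, ((row i V *m c) 0 0).
  have gap j : 0 <= (row i V *m c) 0 0 - (row j V *m c) 0 0.
    by rewrite subr_ge0; have [->//|/Hc/ltW] := eqVneq j i.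
  split=> [x [w [w0 w1 ->]]|].
    by rewrite -subr_ge0 valE // sumr_ge0 // => j _; rewrite mulr_ge0.
  rewrite eqEsubset; split=> [_ ->|_ [[w [w0 w1 ->]] /eqP]].
    by split=> //; apply: row_convhull.
  rewrite eq_sym -subr_eq0 valE // psumr_eq0 => [/allP wj|j _];
    last by rewrite mulr_ge0.
  have wj0 j : j != i -> w 0 j = 0.
    move=> ji; have := wj j (mem_index_enum j).
    by rewrite mulf_eq0 [X in _ || X]gt_eqF ?orbF ?subr_gt0 ?Hc // => /eqP.
  have wi : w 0 i = 1 by rewrite -w1 (bigD1 i) //= big1 ?addr0.
  rewrite mulmx_sum_row (bigD1 i) //= wi scale1r big1 ?addr0 // => j /wj0 ->.
  by rewrite scale0r.
split=> [i j ij|].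
  apply/eqP/negPn/negP => ne; have [c /(_ i ne)] := expose j.
  by rewrite /= in ij *; rewrite ij ltxx.
rewrite eqEsubset; split=> [x [c [t [le_t e]]]|_ [i _ <-]]; last exact: vert.
have : [set x] x by []; rewrite e => -[xV xt].
have [|j|j jt] := supporting_row xV _ xt.
- by move=> j; apply/le_t/row_convhull.
- move=> jt; have : [set x] (row j V) by rewrite e; split=> //;
  apply: row_convhull.
  by [].
- by exists j.
Qed.

Lemma vertices_card k m (V : 'M[R]_(k, m)) l : ordered_vertices V ->
  (vertices (convhull V) #= `I_l)%card -> k = l.
Proof.
move=> [inj ->] card_l; apply/card_eq_II.
rewrite card_eq_sym -(card_eql card_l).
have rk : (range (fun i => row i V) #= [set: 'I_k])%card.
  by apply: inj_card_eq => i j _ _ /inj.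
by rewrite (card_eql rk) card_setT_ord.
Qed.

(** Full dimension gives [m.+1] affinely independent points in the hull; being combinations of the
    rows of [V], they force [(V, 1)] to have rank [m.+1]. *)
Lemma gale_transform_exists p m (V : 'M[R]_(p, m)) :
  affdim (convhull V) = m%:Z ->
  exists G : 'M[R]_(p, (p - m.+1)%N), gale_transform V G.
Proof.
move=> dimV; set K := row_mx V (const_mx 1 : 'cV[R]_p).
have rK : \rank K = m.+1.
  apply/eqP; rewrite eqn_leq -{1}(addn1 m) rank_leq_col /=.
  have [W [Wind WV]] : exists W : 'M[R]_(m.+1, m),
      affinely_independent W /\ forall i, convhull V (row i W).
    apply: contrapT => nW; move: dimV; rewrite /affdim => /eqP.
    rewrite subr_eq -PoszD => /eqP [] dimV.
    suff : (\max_(k < m.+2 | `[< exists W : 'M[R]_(k, m),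
        affinely_independent W /\ forall i, convhull V (row i W) >]) k <= m)%N.
      by rewrite dimV addn1 ltnn.
    apply/bigmax_leqP => k /asboolP kW;
      rewrite -ltnS ltn_neqAle -ltnS ltn_ord andbT.
    by apply/eqP => km; apply: nW; rewrite -km.
  have /choice [w wP] := WV.
  have -> : m.+1 = \rank (row_mx W (const_mx 1 :
    'cV[R]_m.+1)) by rewrite (eqP Wind).
  suff -> : row_mx W (const_mx 1 : 'cV[R]_m.+1) = (\matrix_i w i) *m K.
    exact: mxrankM_maxr.
  apply/row_matrixP => i; have [_ w1 Wi] := wP i.
  rewrite row_row_mx Wi row_mul rowK mul_mx_row; congr row_mx.
  apply/matrixP => a b; rewrite !ord1 !mxE -[LHS]w1.
  by apply: eq_bigr => j _; rewrite mxE mulr1.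
have rk : \rank (kermx K) = (p - m.+1)%N by rewrite mxrank_ker rK.
have : exists B : 'M[R]_(\rank (kermx K), p), row_free B /\ (B :=: kermx K)%MS.
  by exists (row_base (kermx K)); rewrite row_base_free; split=> //;
    apply: eq_row_base.
rewrite rk => -[B [Bfree BK]]; exists B^T.
by rewrite /gale_transform trmxK.
Qed.

End VertexMatrix.

(** * Generic configurations *)

Section GenericPerturbation.
Variables (R : realFieldType) (p r : nat).
Implicit Types (M G : 'M[R]_(p, r)) (T : {set 'I_p}).

Lemma generic_simplicial M : (r <= p)%N -> generic M -> simplicial_config M.
Proof.
move=> rp gM T T0 [l [lM l_gt0 l_eq0]].
have [rT|Tr] := leqP r #|T|; first exact: gM.
have [|I [TI _] Ir] := @subset_between _ T [set: 'I_p]%SET r (finset.subsetT _).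
  by rewrite finset.cardsT card_ord rp ltnW.
have l0 : l = 0.
  apply: (spanning_free Ir _ _ lM); first by apply: gM; rewrite Ir.
  by move=> i iI; apply: l_eq0; apply: contra iI; apply: (fintype.subsetP TI).
by have [j jT] := finset.set0Pn _ T0; have := l_gt0 j jT; rewrite l0 mxE ltxx.
Qed.

Definition power_matrix : 'M[R]_(p, r) := \matrix_(i, k) (i : nat)%:R ^+ k.

(** A Vandermonde matrix: a functional vanishing on [r] rows is a polynomial of size at most [r]
    with [r] distinct roots. *)
Lemma power_matrix_generic : generic power_matrix.
Proof.
move=> T rT y Wy;
  pose q : {poly R} := \poly_(k < r) (if insub k is Some j then y j 0 else 0).
have qE (k : 'I_r) : q`_k = y k 0 by rewrite coef_poly ltn_ord valK.
suff q0 : q = 0 by apply/colP => k; rewrite mxE -qE q0 coef0.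
apply/eqP/negPn/negP => q0.
pose rs := [seq (val i)%:R : R | i : 'I_p <- enum T].
have : (size rs < size q)%N.
  apply: max_poly_roots => //; last first.
    rewrite map_inj_uniq ?enum_uniq // => i j /eqP.
    by rewrite eqr_nat => /eqP/val_inj.
  apply/allP => x /mapP[i]; rewrite mem_enum => iT ->.
  apply/eqP; rewrite -[RHS](Wy i iT).
  rewrite (@horner_coef_wide _ r) ?size_poly // mxE.
  by apply: eq_bigr => k _; rewrite qE mxE mulrC.
by rewrite size_map -cardE ltnNge (leq_trans (size_poly _ _)).
Qed.

Lemma nonroot_small (q : {poly R}) e0 : 0 < e0 -> q != 0 ->
  exists2 e, 0 < e < e0 & q.[e] != 0.
Proof.
move=> e0_gt0 q0; pose f k : R := e0 / k.+2%:R.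
have f_in k : 0 < f k < e0.
  by rewrite divr_gt0 //= ltr_pdivrMr // ltr_pMr // ltr1n.
have [/hasP [_ /mapP[k _ ->] qk]|] :=
    boolP (has (fun e => q.[e] != 0) [seq f k | k <- iota 0 (size q)]).
  by exists (f k).
rewrite -all_predC => /allP all_root.
have : (size [seq f k | k <- iota 0 (size q)] < size q)%N.
  apply: max_poly_roots => //.
    by apply/allP => e /all_root /=; rewrite negbK.
  rewrite map_inj_uniq ?iota_uniq // => i j /(mulfI (lt0r_neq0 e0_gt0))
    /invr_inj /eqP.
  by rewrite eqr_nat => /eqP [].
by rewrite size_map size_iota ltnn.
Qed.

(** On the rows in [T], [M + e *: W] is singular only if [- e] is an eigenvalue of the inverse of
    [W] times [M], that is, a root of a characteristic polynomial. *)
Lemma spanning_pencil M W T : #|T| = r -> spanning W T ->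
  exists2 q : {poly R}, q != 0 &
    forall e, q.[e] != 0 -> spanning (M + e *: W) T.
Proof.
move=> Tr sW; pose sub (N : 'M[R]_(p, r)) : 'M[R]_r :=
  rowsub (fun k : 'I_r => enum_val (cast_ord (esym Tr) k)) N.
have subE N (y : 'cV[R]_r) : spanning N T -> sub N *m y = 0 -> y = 0.
  move=> sN Ny; apply: sN => i iT.
  have /matrixP/(_ (cast_ord Tr (enum_rank_in iT i)) 0) := Ny.
  rewrite [RHS]mxE => <-; rewrite !mxE; apply: eq_bigr => j _.
  by rewrite !mxE cast_ordK enum_rankK_in.
have unit_of N : (forall y : 'cV[R]_r, N *m y = 0 -> y = 0) -> N \in unitmx.
  move=> Ninj; rewrite -unitmx_tr -row_free_unit; apply: inj_row_free => y yN.
  apply: trmx_inj; rewrite trmx0; apply: Ninj.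
  by rewrite -[LHS]trmxK trmx_mul trmxK yN trmx0.
have uW : sub W \in unitmx by apply: unit_of => y; apply: subE.
pose Q := (invmx (sub W) *m sub M)^T.
exists (char_poly Q \Po (- 'X)).
  rewrite -size_poly_gt0 size_comp_poly2 ?size_polyN ?size_polyX //.
  by rewrite size_char_poly.
move=> e; rewrite horner_comp hornerN hornerX => qe y My.
apply/eqP/negPn/negP => y0; move: qe; apply/negP; rewrite negbK.
rewrite -/(root _ _) -eigenvalue_root_char; apply/eigenvalueP; exists y^T.
  rewrite -trmx_mul -mulmxA.
  have : sub (M + e *: W) *m y = 0.
    apply/colP => k;
      rewrite [RHS]mxE -[RHS](My _ (enum_valP (cast_ord (esym Tr) k))).
    by rewrite !mxE; apply: eq_bigr => j _; rewrite !mxE.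
  have -> : sub (M + e *: W) = sub M + e *: sub W by apply/matrixP => i j;
    rewrite !mxE.
  rewrite mulmxDl -scalemxAl => /eqP; rewrite addr_eq0 => /eqP ->.
  by rewrite -scaleNr -scalemxAr mulKmx // linearZ.
by apply: contra_neq y0 => e0; apply: trmx_inj; rewrite e0 trmx0.
Qed.

Lemma generic_perturbation M : simplicial_config M -> (r <= p)%N ->
  exists G, generic G /\ forall T, coface G T <-> coface M T.
Proof.
move=> sM rp.
have [e0 e0_gt0 He0] := small_coface_perturb power_matrix sM.
have /choice [q qP] : forall T, exists q : {poly R}, q != 0 /\ (#|T| = r ->
    forall e, q.[e] != 0 -> spanning (M + e *: power_matrix) T).
  move=> T; have [Tr|Tr] := eqVneq #|T| r; last first.
    by exists 1; rewrite oner_neq0; split=> // /eqP; rewrite (negPf Tr).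
  have [|q q0 Hq] := spanning_pencil M Tr (W := power_matrix).
    by apply: power_matrix_generic; rewrite Tr.
  by exists q.
(* A small [e] that is no root of the product makes every [r] rows a basis, while [e < e0] keeps the
   cofaces. *)
have [|e e_in qe] := @nonroot_small (\prod_T q T) e0 e0_gt0.
  by apply/prodf_neq0 => T _; case: (qP T).
exists (M + e *: power_matrix); split; last by case: (He0 e e_in).
move=> T rT; have [|I [_ IT] Ir] := @subset_between _ finset.set0 T r
  (finset.sub0set _).
  by rewrite finset.cards0.
have sI : spanning (M + e *: power_matrix) I.
  apply: (qP I).2 => //; move: qe; rewrite horner_prod => /prodf_neq0; exact.
by move=> y Ty; apply: sI => i iI; apply: Ty; apply: (fintype.subsetP IT).
Qed.

End GenericPerturbation.

(** Genericity makes the top block invertible. Multiplying by its inverse on the right keeps all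
    linear dependencies of the rows, hence all cofaces. *)
Lemma normalize_generic (R : realType) p r (M : 'M[R]_(p, r)) : (r <= p)%N ->
  generic M ->
  exists G : 'M[R]_(p, r), [/\ normalized G, generic G & forall T : {set 'I_p},
    coface G T <-> coface M T].
Proof.
move=> rp gM; pose M0 : 'M[R]_r := rowsub (widen_ord rp) M.
have uM0 : M0 \in unitmx.
  rewrite -unitmx_tr -row_free_unit; apply: inj_row_free => y yM.
  apply: trmx_inj; rewrite trmx0.
  apply: (gM [set widen_ord rp k | k : 'I_r]%SET) => [|_ /imsetP[k _ ->]].
    rewrite card_imset ?card_ord // => i j /(congr1 val) /= ij; exact: val_inj.
  have /matrixP/(_ k 0) : M0 *m y^T = 0 by rewrite -[LHS]trmxK trmx_mul trmxK yM
    trmx0.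
  rewrite [RHS]mxE => <-; rewrite !mxE; apply: eq_bigr => j _.
  by rewrite !mxE.
exists (M *m invmx M0); split.
- move=> i j ir;
  have <- : ((1%:M : 'M[R]_r) (Ordinal ir) j) = ((i :
  nat) == j)%:R by rewrite mxE.
  rewrite -(mulmxV uM0) !mxE; apply: eq_bigr => k _; rewrite !mxE;
    congr (M _ _ * _).
  exact: val_inj.
- move=> T rT y Ty; have : invmx M0 *m y = 0.
    by apply: (gM T rT) => i iT; rewrite mulmxA Ty.
  by move=> /(congr1 (mulmx M0)); rewrite mulmx0 mulmxA mulmxV // mul1mx.
- move=> T; split=> -[l [lM l_gt0 l_eq0]]; exists l; split=> //.
    by rewrite -[M](mulmxKV uM0) mulmxA lM mul0mx.
  by rewrite mulmxA lM mul0mx.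
Qed.

Section GenericLabels.
Variables (R : realType) (p r : nat) (G : 'M[R]_(p, r)).
Hypotheses (rp : (r <= p)%N) (normG : normalized G) (genG : generic G).

Lemma normalized_row (y : 'cV[R]_r) (j : 'I_p) (jr : (j < r)%N) :
  (G *m y) j 0 = y (Ordinal jr) 0.
Proof.
rewrite mxE (bigD1 (Ordinal jr)) //= normG // eqxx mul1r big1 ?addr0 // => k kj.
rewrite normG // (_ : (j : nat) == k = false) ?mul0r //.
by apply: contraNF kj => /eqP jk; apply/eqP/val_inj.
Qed.

Definition masked_shift (s : {ffun 'I_p.+1 -> bool}) (J : {set 'I_p}) :
  'M[R]_(p, r) :=
  \matrix_(j, k) (if j \in J then sign_shift R r s j k else 0).

Lemma label_normals_row0 eps s (y : 'cV[R]_r) (r0 : (0 < r)%N) :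
  (label_normals G eps s *m y) ord0 0 = (-1) ^+ s ord0 * eps * y (Ordinal r0) 0.
Proof.
rewrite mxE (bigD1 (Ordinal r0)) //= big1 ?addr0 => [|k k0].
  by rewrite mxE unlift_none add0r eqxx mulr1.
rewrite mxE unlift_none add0r (_ : (_ : nat) == _ = false) ?mulr0 ?mul0r //.
by apply: contraNF k0 => /eqP k0; apply/eqP/val_inj.
Qed.

Lemma label_normals_row_lift eps s (y : 'cV[R]_r) j :
  (label_normals G eps s *m y) (lift ord0 j) 0 = ((G + eps *:
    sign_shift R r s) *m y) j 0.
Proof.
rewrite -label_normals_lift !mxE; apply: eq_bigr => k _.
by rewrite !mxE.
Qed.

(* If [S] contains exactly the initial labels [0, .., m - 1], then the vectors
   of these labels span the first [m] unit vectors, which are the rows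
   [0, .., m - 1] of [G]; the other vectors with labels in [S] are
   perturbations of further rows of [G]. *)
Lemma small_generic_labels :
  small (fun eps => forall s, generic (label_normals G eps s)).
Proof.
have : small (fun eps => forall s (J T : {set 'I_p}), (r <= #|T|)%N ->
    spanning (G + eps *: masked_shift s J) T).
  apply: (@small_all _ {ffun 'I_p.+1 -> bool}) => s.
  apply: small_all => J; apply: small_all => T.
  have [rT|Tr] := boolP (r <= #|T|)%N; last exact: small_true.
  by apply: small_imp (spanning_perturb (masked_shift s J) (genG rT)).
apply: small_imp => eps eps0 span s S rS y Sy.
(* [m] is the least label missing from [S], or [p.+1] if none is missing. *)
have [m [mS mn]] : exists m : nat,
    (forall i : 'I_p.+1, (i < m)%N -> i \in S) /\ (forall i : 'I_p.+1,
      i = m :> nat -> i \notin S).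
  have [/forallP allS|/forallPn [i0 i0S]] := boolP [forall i : 'I_p.+1,
    i \in S].
    exists p.+1; split=> // i im; have := ltn_ord i; by rewrite im ltnn.
  case: (@arg_minnP _ i0 (fun i => i \notin S) val i0S) => i iS imin.
  exists i; split=> [k ki|k /val_inj -> //].
  by apply/negPn/negP => /imin; rewrite leqNgt ki.
have y_eq0 k (kr : (k < r)%N) : (k < m)%N -> y (Ordinal kr) 0 = 0.
  elim: k kr => [|k IH] kr km.
    have := Sy ord0 (mS ord0 km); rewrite (label_normals_row0 _ _ _ kr) => /eqP.
    by rewrite !mulf_eq0 signr_eq0 gt_eqF //= => /eqP.
  have kp : (k < p)%N by apply: leq_trans rp; apply: ltnW.
  have := Sy (lift ord0 (Ordinal kp)) (mS (lift ord0 (Ordinal kp)) km).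
  rewrite label_normals_row_lift mulmxDl mxE
    (@normalized_row y (Ordinal kp) (ltnW kr)).
  rewrite (IH (ltnW kr) (ltnW km)) add0r -scalemxAl mxE mxE (bigD1 (Ordinal kr))
    //=.
  rewrite big1 ?addr0 => [|l lk]; last first.
    rewrite mxE (_ : _.+1 == _ = false) ?mulr0 ?mul0r //.
    by apply: contraNF lk => /eqP lk; apply/eqP/val_inj.
  rewrite mxE eqxx mulr1 => /eqP.
  by rewrite !mulf_eq0 signr_eq0 gt_eqF //= => /eqP.
have [rm|mr] := leqP r m.
  by apply/colP => -[k kr]; rewrite mxE y_eq0 // (leq_trans kr rm).
(* Row [j < m] of the identity block stands in for label [j], row [j >= m] for label [j.+1]. Only
   the label [m], absent from [S], is skipped, so [T] is large enough; the mask leaves the rows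
   below [m] unperturbed. *)
pose f (j : 'I_p) : 'I_p.+1 := if (j < m)%N then widen_ord (leqnSn p) j else
  lift ord0 j.
pose T := [set j | f j \in S]%SET.
have rT : (r <= #|T|)%N.
  apply: (leq_trans rS); apply: leq_trans (leq_imset_card f _).
  apply: subset_leq_card; apply/fintype.subsetP => i iS.
  have [im|mi|im] := ltngtP i m; last by rewrite (negPf (mn i im)) in iS.
    have ip : (i < p)%N by apply: leq_trans rp; apply: ltn_trans mr.
    have fi : f (Ordinal ip) = i by apply: val_inj; rewrite /f /= im.
    by rewrite -fi imset_f // inE fi.
  case: (unliftP ord0 i) mi iS => [j|] -> // mj jS.
  have fj : f j = lift ord0 j by rewrite /f ltnNge -ltnS mj.
  by rewrite -fj imset_f // inE fj.
apply: (span s [set j : 'I_p | (m <= j)%N]%SET T rT) => j; rewrite inE /f.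
case: ltnP => jm jS.
  have jr := ltn_trans jm mr.
  rewrite mulmxDl mxE (normalized_row _ jr) y_eq0 // add0r -scalemxAl mxE mxE.
  by rewrite big1 ?mulr0 // => k _; rewrite mxE inE leqNgt jm mul0r.
rewrite -[RHS](Sy _ jS) label_normals_row_lift !mulmxDl !mxE; congr (_ + _).
by apply: eq_bigr => k _; rewrite !mxE inE jm.
Qed.

End GenericLabels.

(** * Neighborly cubical polytopes *)

(** Two Gale transforms differ by a matrix factor on the right, and the identity blocks force this
    factor to be 1. *)
Lemma normalized_gale_unique (R : realType) p m r (V : 'M[R]_(p, m))
    (G G' : 'M[R]_(p, r)) : (r <= p)%N ->
  gale_transform V G -> normalized G -> gale_transform V G' -> normalized G' ->
  G = G'.
Proof.
move=> rp [_ GV] nG [_ GV'] nG'.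
have top (M : 'M[R]_(p, r)) : normalized M -> rowsub (widen_ord rp) M = 1%:M.
  by move=> nM; apply/matrixP => i j; rewrite mxE nM ?mxE //=.
have /submxP [X GX] : (G^T <= G'^T)%MS by rewrite GV GV'.
have {}GX : G = G' *m X^T by rewrite -[G]trmxK GX trmx_mul trmxK.
have : rowsub (widen_ord rp) G = rowsub (widen_ord rp) G' *m X^T.
  by rewrite {1}GX; apply/matrixP => i j; rewrite !mxE; apply: eq_bigr => k _;
    rewrite !mxE.
by rewrite !top // mul1mx GX => <-; rewrite mulmx1.
Qed.

Section NeighborlyCubical.
Variables (R : realType) (p d : nat).
Hypotheses (d_ge2 : (2 <= d)%N) (d_le : (d <= p.+1)%N).
Local Notation n := p.+1.
Local Notation r := (p.+1 - d)%N.
Local Notation L := (proj_mx_last R p d).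

Let rp : (r <= p)%N. Proof. lia. Qed.
Let p_gt0 : (0 < p)%N. Proof. lia. Qed.

Lemma proj_mx_last_inj (c : 'cV[R]_d) : L *m c = 0 -> c = 0.
Proof.
move=> Lc; apply/colP => j; have rj : (r + j < n)%N by have := ltn_ord j; lia.
have /matrixP/(_ (Ordinal rj) 0) := Lc; rewrite !mxE => <-.
rewrite (bigD1 j) //= mxE eqxx mul1r big1 ?addr0 // => k kj.
by rewrite mxE /= eqn_add2l eq_sym (inj_eq val_inj) (negPf kj) mul0r.
Qed.

Lemma proj_mx_last_ker (x : 'rV[R]_n) : x *m L = 0 ->
  x^T = (pid_mx r : 'M[R]_(n, r)) *m (x *m (pid_mx r : 'M[R]_(n, r)))^T.
Proof.
move=> xL; rewrite trmx_mul tr_pid_mx mulmxA mul_pid_mx minnn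
  (minn_idPr (leqnn _)).
apply/colP => i; rewrite [RHS]mxE (bigD1 i) //= big1 ?addr0 => [|k ki];
  last first.
  by rewrite mxE eq_sym (inj_eq val_inj) (negPf ki) mul0r.
rewrite !mxE eqxx /=; case: ltnP => ir; first by rewrite mul1r.
have id : (i - r < d)%N by have := ltn_ord i; lia.
rewrite mul0r; have /rowP/(_ (Ordinal id)) := xL; rewrite !mxE => <-.
rewrite (bigD1 i) //= mxE subnKC // eqxx mulr1 big1 ?addr0 // => k ki.
by rewrite mxE /= subnKC // (inj_eq val_inj) (negPf ki) mulr0.
Qed.

Variables (G : 'M[R]_(p, r)) (eps : R).
Hypotheses (small_eps : small_enough G eps) (simpG : simplicial_config G).

Local Notation A := (cube_normals (n := p.+1) (d := d) G eps).

Section Generic.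
Hypothesis genB : forall s, generic (label_normals G eps s).
Hypothesis neighG : forall F : {set 'I_p}, (#|F| <= (d - 2)./2)%N ->
  coface G (~: F)%SET.

Lemma sign_good_pspanning t : sign_good G eps t -> t != zero_sgn ->
  pspanning (label_normals G eps (fill t)) (supp t).
Proof.
move=> gt t0; apply: simplicial_pspanning gt.
  exact: generic_simplicial (leqW rp) (@genB _).
apply: contraNN t0 => /eqP/setP t0; apply/eqP/ffunP => i; rewrite ffunE.
by have := t0 i; rewrite inE finset.in_set0 => /negbFE/eqP.
Qed.

(** A refinement keeps the signed normals of [t] and adds others, and positive spanning is monotone.
    This is what makes proper faces cubes. *)
Lemma sign_good_refines t t' : sign_good G eps t -> t != zero_sgn ->
  refines t t' -> sign_good G eps t'.
Proof.
move=> gt t0 /refinesP tt'; apply/pspanning_coface.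
have sub : supp t \subset supp t'.
  apply/fintype.subsetP => i; rewrite !inE; case ti: (t i) => [a|//] _.
  by rewrite (tt' _ _ ti).
apply: (pspanningS sub) => y Ty; apply: (sign_good_pspanning gt t0) => i iS.
have := Ty i iS; congr (0 <= _).
move: iS; rewrite inE; case ti: (t i) => [a|//] _.
have /rowP e : row i (label_normals G eps (fill t')) = row i
  (label_normals G eps (fill t)).
  by apply: label_normals_local; rewrite !ffunE ti (tt' _ _ ti).
by rewrite !mxE; apply: eq_bigr => k _; have := e k; rewrite !mxE => ->.
Qed.

(** Uses neighborliness of [Q]: zeros at few labels omit few vertices, whose complement is a
    nonempty coface and hence positively spanning. *)
Lemma sign_good_few_zeros (t : sgnvec p.+1) : (#|~: supp t| <= (d - 2)./2)%N ->
  sign_good G eps t.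
Proof.
move=> tz; pose F := (~: label_supp t)%SET.
have Fz : (#|F| <= (d - 2)./2)%N.
  apply: leq_trans tz; rewrite -(card_imset _ (@lift_inj _ ord0)).
  apply: subset_leq_card; apply/fintype.subsetP => _ /imsetP[j jF ->].
  by move: jF; rewrite !finset.in_setC !inE.
apply: (sign_good_of_pspanning (T := ~: F) small_eps); last first.
  by move=> j; rewrite finset.setCK inE.
apply: simplicial_pspanning => //; last exact: neighG.
rewrite -card_gt0; have := cardsC F; rewrite card_ord;
  move: Fz p_gt0 d_le d_ge2.
by move: #|F| #|_| => a c; lia.
Qed.

Lemma NCP_neighborly_cubical b v : cubical_system A b v ->
  neighborly_cubical n (pface A b L zero_sgn).
Proof.
move=> cubeA.
have dimP : affdim (pface A b L zero_sgn) = d%:Z.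
  exact: affdim_pface_zero cubeA proj_mx_last_inj.
split; first by split; [exact: pface_polytope cubeA|].
  move=> F [/(face_pface cubeA (zero_good _ _)) [->|[t [_ gt] ->]] F0 FP].
    by case: F0.
  have t0 : t != zero_sgn by apply/eqP => t0; apply: FP; rewrite t0.
  apply: (comb_cube_pface cubeA) => t' tt'; apply/good_sign_good => //.
  by apply: sign_good_refines tt' => //; apply/good_sign_good.
apply: (skeleton_pface cubeA).
- move=> t /(good_sign_good d_le) gt t0 x xL tight.
  (* Only the first [r] coordinates of [x] can be nonzero, and the tight normals annihilate [x]; so
     its truncation is orthogonal to a spanning set. *)
  have [B0] : x *m (pid_mx r : 'M[R]_(n, r)) = 0.
    apply: trmx_inj; rewrite trmx0.
    apply: (pspanning_spanning (sign_good_pspanning gt t0)) => i.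
    rewrite inE; case ti: (t i) => [a|//] _.
    rewrite -mixed_trunc // -mulmxA -proj_mx_last_ker // -[RHS](tight i a ti)
      /lhs.
    by rewrite !mxE; apply: eq_bigr => k _; rewrite !mxE ffunE ti mulrC.
  by apply: trmx_inj; rewrite proj_mx_last_ker // B0 trmx0 mulmx0 trmx0.
- by lia.
- by rewrite dimP; lia.
- by lia.
- move=> t tz; apply/good_sign_good => //; apply: sign_good_few_zeros.
  by lia.
Qed.

End Generic.
End NeighborlyCubical.

Section Realization.
Variables (R : realType) (p d : nat).
Hypotheses (d_ge2 : (2 <= d)%N) (d_le : (d <= p.+1)%N).
Local Notation r := (p.+1 - d)%N.

(** [G0] is dual to [Q], while [G] builds the cube; only their cofaces have to agree. *)
Definition realizes (Q : set 'rV[R]_(d - 2)) (P : set 'rV[R]_d) :=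
  exists (V : 'M[R]_(p, (d - 2)%N)) (G0 G : 'M[R]_(p, r)) (eps : R) b v,
  [/\ Q = convhull V /\ gale_dual V G0, forall T, coface G T <-> coface G0 T,
      normalized G /\ (forall j, pspanning G (~: [set j])%SET),
      0 < eps /\ small_enough G eps
    & let A := cube_normals (n := p.+1) (d := d) G eps in
      cubical_system A b v /\ P = pface A b (proj_mx_last R p d) zero_sgn].

Lemma realizes_iso Q Q' P P' : realizes Q P -> realizes Q' P' ->
  comb_iso P P' -> comb_iso Q Q'.
Proof.
move=> [V [G0 [G [eps [b [v [[-> dual] cG [nG vG] [e0 sG] [cA ->]]]]]]]].
move=> [V' [G0' [G' [eps' [b' [v' [[-> dual'] cG' [nG' vG'] [e0' sG']
  [cA' ->]]]]]]]] iso.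
have [|||h h_inj hT] := NCP_iso_cofaces d_le _ nG nG' vG vG' _ _ sG sG' cA cA'
  iso.
- by lia.
- by rewrite gt_eqF.
- by rewrite gt_eqF.
apply: (comb_iso_hull dual dual' h_inj) => T.
by rewrite -cG -cG'; apply: hT.
Qed.

Lemma vertex_pspanning (V : 'M[R]_(p, (d - 2)%N)) (G : 'M[R]_(p, r)) :
  gale_dual V G -> ordered_vertices V -> simplicial_config G ->
  forall j, pspanning G (~: [set j])%SET.
Proof.
move=> dual ov sG j; have [r0|r_gt0] := posnP r.
  by move=> y _; apply/colP => k; have := ltn_ord k; rewrite {2}r0.
apply: simplicial_pspanning => //; last exact: coface_vertex ov.
by rewrite -card_gt0 cardsC1 card_ord; lia.
Qed.

Lemma NCP_realizes (V : 'M[R]_(p, (d - 2)%N)) :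
  exists2 e0 : R, 0 < e0 & ordered_vertices V -> general_position V ->
    forall eps P, 0 < eps < e0 -> NCP (n := p.+1) V eps P ->
      realizes (convhull V) P.
Proof.
(* The bound is chosen before the hypotheses on [V] are available, so the cases without a normalized
   transform or without general position get the value 1. *)
have [[G [GV nG]]|noG] :=
    pselect (exists G : 'M[R]_(p, r), gale_transform V G /\ normalized G);
      last first.
  exists 1 => // _ _ eps P _ [G [b [GV nG _ _]]].
  by case: noG; exists G.
have dual := gale_transform_dual GV.
have [gp|ngp] := pselect (general_position V); last by exists 1.
have sG : simplicial_config G.
  by apply: general_position_simplicial dual gp; lia.
have [e0 e0_gt0 He0] := small_enough_small sG.
exists e0 => // ov _ eps P eps_in [G' [b [GV' nG' cs ->]]].
have GG' : G' = G.
  by apply: (normalized_gale_unique _ GV' nG' GV nG); lia.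
move: cs; rewrite GG' => cs; have /andP[eps_gt0 _] := eps_in.
have [v cv] := cube_system_cubical nG (lt0r_neq0 eps_gt0) cs.
exists V, G, G, eps, b, v; split=> //; first by split=> //;
  apply: vertex_pspanning ov _.
  by split=> //; apply: He0.
by split=> //; rewrite proj_last_pface.
Qed.

Lemma simplicial_realizes (Q : set 'rV[R]_(d - 2)) :
  neighborly Q -> simplicial Q -> (vertices Q #= `I_p)%card ->
  exists2 P : set 'rV[R]_d, realizes Q P & neighborly_cubical p.+1 P.
Proof.
move=> nQ sQ cQ; have [[polyQ dimQ] _] := nQ.
have [k [V [QV ov]]] := polytope_ordered_vertices polyQ.
have kp : k = p by apply: (vertices_card ov); rewrite -QV.
move: V QV ov; rewrite kp => V QV ov.
rewrite QV in nQ sQ dimQ *.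
have := gale_transform_exists dimQ.
rewrite (_ : p - (d - 2).+1 = r)%N; last by lia.
move=> [G0 /gale_transform_dual dual].
have simp0 := simplicial_simplicial_config dual ov sQ.
have rp : (r <= p)%N by lia.
have [G1 [gen1 cG1]] := generic_perturbation simp0 rp.
have [G [nG genG cG]] := normalize_generic rp gen1.
have cGG0 T : coface G T <-> coface G0 T by rewrite cG cG1.
have simpG := generic_simplicial rp genG.
have [e0 e0_gt0 He0] := small_and (small_enough_small simpG)
  (small_generic_labels rp nG genG).
have eps_in : 0 < e0 / 2 < e0 by lra.
have eps_gt0 : 0 < e0 / 2 by case/andP: eps_in.
have [sG genB] := He0 _ eps_in.
have [b [v cv]] := normals_cubical nG eps_gt0.
exists (pface (cube_normals (n := p.+1) (d := d) G (e0 / 2)) b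
  (proj_mx_last R p d) zero_sgn).
  exists V, G0, G, (e0 / 2), b, v; split=> //; split=> // j.
  have [r0|r_gt0] := posnP r.
    by move=> y _; apply/colP => i; have := ltn_ord i; rewrite {2}r0.
  apply: simplicial_pspanning => //; last by apply/cGG0;
    apply: coface_vertex ov.
  by rewrite -card_gt0 cardsC1 card_ord; lia.
apply: (NCP_neighborly_cubical d_ge2 d_le sG simpG genB _ cv) => F Fd.
by apply/cGG0; apply: (coface_neighborly dual ov nQ).
Qed.

End Realization.

Theorem corollary3p8 (R : realType) (n d : nat)
    (d_ge2 : (2 <= d)%N) (n_ged : (d <= n)%N) :
  (exists eps0 : 'M[R]_(n.-1, (d - 2)%N) -> R,
     (forall V, 0 < eps0 V) /\
     forall V V' : 'M[R]_(n.-1, (d - 2)%N),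
       neighborly (convhull V) -> ordered_vertices V -> general_position V ->
       neighborly (convhull V') -> ordered_vertices V' ->
       general_position V' ->
       ~ comb_iso (convhull V) (convhull V') ->
       forall (eps eps' : R) (P P' : set 'rV[R]_d),
         0 < eps < eps0 V -> 0 < eps' < eps0 V' ->
         NCP V eps P -> NCP V' eps' P' ->
         ~ comb_iso P P') /\
  ([set comb_type Q | Q in [set Q : set 'rV[R]_(d - 2)%N |
       [/\ neighborly Q, simplicial Q & (vertices Q #= `I_(n.-1))%card]]]
   #<= [set comb_type P | P in [set P : set 'rV[R]_d |
       neighborly_cubical n P]])%card.
Proof.
case: n n_ged => [|p] d_le; first by exfalso; lia.
split.
  have /choice [eps0 eps0P] : forall V : 'M[R]_(p, (d - 2)%N), exists e0 : R,
      0 < e0 /\ (ordered_vertices V -> general_position V ->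
        forall eps P, 0 < eps < e0 -> NCP (n := p.+1) V eps P ->
          realizes p (convhull V) P).
    by move=> V; have [e0 e0_gt0 He0] := NCP_realizes d_ge2 d_le V; exists e0.
  exists eps0; split=> [V|V V' _ ov gp _ ov' gp' nQQ' eps eps' P P' e_in e_in'
    NP NP'].
    exact: (eps0P V).1.
  apply: contra_not nQQ'; apply: (realizes_iso d_ge2 d_le).
    exact: (eps0P V).2 ov gp _ _ e_in NP.
  exact: (eps0P V').2 ov' gp' _ _ e_in' NP'.
set S := [set Q | _]; set N := [set P | _].
have comb_typeP m (Q Q' : set 'rV[R]_m) : polytope Q' ->
    comb_type Q = comb_type Q' <-> comb_iso Q Q'.
  move=> polyQ'; split=> [e|iso].
    have : comb_type Q' Q' by split=> //; apply: inclusion_iso_refl.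
    by rewrite -e => -[].
  rewrite eqEsubset; split=> F [polyF isoF]; split=> //.
    exact: inclusion_iso_trans (inclusion_iso_sym iso) isoF.
  exact: inclusion_iso_trans iso isoF.
have /choice [f fP] : forall Q : set 'rV[R]_(d - 2), exists P : set 'rV[R]_d,
  S Q ->
    realizes p Q P /\ N P.
  move=> Q; have [[nQ sQ cQ]|nSQ] := pselect (S Q); last by exists set0.
  by have [P PQ NP] := simplicial_realizes d_ge2 d_le nQ sQ cQ; exists P.
have /choice [g gP] : forall T : set (set 'rV[R]_(d - 2)),
    exists Q, [set comb_type Q | Q in S] T -> S Q /\ comb_type Q = T.
  move=> T; have [[Q SQ QT]|nT] := pselect ([set comb_type Q | Q in S] T).
    by exists Q.
  by exists set0.
(* Each type is sent through a chosen representative [g T] to the type of a polytope realizing it;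
   [realizes_iso] makes this injective. *)
pose h T := comb_type (f (g T)).
have h_inj : {in [set comb_type Q | Q in S] &, injective h}.
  move=> T T' /set_mem /gP [SQ QT] /set_mem /gP [SQ' QT'].
  have [PQ NP] := fP _ SQ; have [PQ' [[polyP' _] _ _]] := fP _ SQ'.
  move=> /(comb_typeP _ _ _ polyP') /(realizes_iso d_ge2 d_le PQ PQ') iso.
  by rewrite -QT -QT'; apply/comb_typeP => //; case: SQ' => [[[]]].
rewrite -(card_le_eql (inj_card_eq h_inj)); apply: subset_card_le.
move=> _ [T /gP [SQ _] <-]; exists (f (g T)) => //.
by have [] := fP _ SQ.
Qed.
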